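(* Let $I$ be an isotopy in $\mathrm{Homeo}_0(\mathbb{A})$ from the identity to a homeomorphism $f$. Let $\gamma^+,\gamma^-$ be two disjoint essential $f$-free Jordan curves in $\mathbb{A}$, let $A$ be the closed annulus delimited by $\gamma^+$ and $\gamma^-$, and suppose $\Theta(A)\neq\emptyset$. Then $\rho_{\Theta(A)}(I)$ is an interval of $\overline{\mathbb{R}}$.
   Context: $\mathbb{T}^1=\mathbb{R}/\mathbb{Z}$, $\mathbb{A}=\mathbb{T}^1\times\mathbb{R}$ is the open annulus with universal covering $\pi:\mathbb{R}^2\to\mathbb{A}$ and $p_1:\mathbb{R}^2\to\mathbb{R}$ the first coordinate projection. $\mathrm{Homeo}_0(\mathbb{A})$ is the set of homeomorphisms of $\mathbb{A}$ isotopic to the identity. For an isotopy $I=(f_t)_{t\in[0,1]}$ from the identity to $f=f_1$, let $(\tilde f_t)$ be its lift to $\mathbb{R}^2$ with $\tilde f_0=\mathrm{Id}$, and $\tilde f=\tilde f_1$. For $z\in\mathbb{A}$ and $n\ge1$, $\rho_n(z)=\frac1n(p_1(\tilde f^n(\tilde z))-p_1(\tilde z))$ with $\tilde z\in\pi^{-1}(z)$. For a compact $K\subset\mathbb{A}$, $\rho_K(I)=\bigcap_{m\ge1}\mathrm{Cl}\big(\bigcup_{n\ge m}\{\rho_n(z): z\in K,\ f^n(z)\in K\}\big)$, closure in $\overline{\mathbb{R}}=\mathbb{R}\cup\{\pm\infty\}$. A Jordan curve $\gamma\subset\mathbb{A}$ is essential if $\mathbb{A}\setminus\gamma$ has two unbounded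 connected components; it is $f$-free if $f(\gamma)\cap\gamma=\emptyset$. For $E\subset\mathbb{A}$, $\Theta(E)=\{x\in E: f^n(x)\in E\text{ for all }n\in\mathbb{Z}\}$ is the maximal invariant set of $E$. *)

(* Defs.v *)
From Stdlib Require Import Reals Lra.
Open Scope R_scope.

(** * The open annulus A = T^1 x R, realised as the cylinder
      { (a,b,r) in R^3 | a^2 + b^2 = 1 } with the Euclidean metric of R^3.
      The universal covering is pi(x,y) = (cos 2 pi x, sin 2 pi x, y). *)

Definition R3 : Type := (R * R * R)%type.
Definition on_cyl (p : R3) : Prop :=
  let '(a, b, _) := p in a * a + b * b = 1.
Definition Ann : Type := { p : R3 | on_cyl p }.

Definition dist3 (p q : R3) : R :=
  let '(a1, b1, c1) := p in let '(a2, b2, c2) := q in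
  sqrt ((a1 - a2) ^ 2 + (b1 - b2) ^ 2 + (c1 - c2) ^ 2).
Definition distA (x y : Ann) : R := dist3 (proj1_sig x) (proj1_sig y).

Definition R2 : Type := (R * R)%type.
Definition dist2 (p q : R2) : R :=
  sqrt ((fst p - fst q) ^ 2 + (snd p - snd q) ^ 2).

Lemma pi_on_cyl (z : R2) :
  on_cyl (cos (2 * PI * fst z), sin (2 * PI * fst z), snd z).
Proof.
  simpl. pose proof (sin2_cos2 (2 * PI * fst z)) as H.
  unfold Rsqr in H. lra.
Qed.

Definition piA (z : R2) : Ann :=
  exist _ (cos (2 * PI * fst z), sin (2 * PI * fst z), snd z) (pi_on_cyl z).

Definition p1 (z : R2) : R := fst z.

Definition continuousA (h : Ann -> Ann) : Prop :=
  forall x eps, 0 < eps -> exists delta, 0 < delta /\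
    forall y, distA x y < delta -> distA (h x) (h y) < eps.

Definition homeoA (h : Ann -> Ann) : Prop :=
  exists g : Ann -> Ann,
    (forall x, g (h x) = x) /\ (forall y, h (g y) = y) /\
    continuousA h /\ continuousA g.

Definition isotopy (F : R -> Ann -> Ann) : Prop :=
  (forall x, F 0 x = x) /\
  (forall t, 0 <= t <= 1 -> homeoA (F t)) /\
  (forall t x, 0 <= t <= 1 -> forall eps, 0 < eps -> exists delta, 0 < delta /\
     forall s y, 0 <= s <= 1 -> Rabs (s - t) < delta -> distA x y < delta ->
       distA (F t x) (F s y) < eps).

Definition isotopy_lift (F : R -> Ann -> Ann) (Ft : R -> R2 -> R2) : Prop :=
  (forall z, Ft 0 z = z) /\
  (forall t z, 0 <= t <= 1 -> piA (Ft t z) = F t (piA z)) /\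
  (forall t z, 0 <= t <= 1 -> forall eps, 0 < eps -> exists delta, 0 < delta /\
     forall s w, 0 <= s <= 1 -> Rabs (s - t) < delta -> dist2 z w < delta ->
       dist2 (Ft t z) (Ft s w) < eps).

Definition openA (U : Ann -> Prop) : Prop :=
  forall x, U x -> exists eps, 0 < eps /\ forall y, distA x y < eps -> U y.

Definition connectedA (S : Ann -> Prop) : Prop :=
  forall U V : Ann -> Prop, openA U -> openA V ->
    (forall x, S x -> U x \/ V x) ->
    (forall x, ~ (S x /\ U x /\ V x)) ->
    (forall x, S x -> U x) \/ (forall x, S x -> V x).

Definition componentA (W C : Ann -> Prop) : Prop :=
  (exists x, C x) /\ (forall x, C x -> W x) /\ connectedA C /\
  (forall D : Ann -> Prop, connectedA D -> (forall x, D x -> W x) ->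
     (exists x, D x /\ C x) -> forall x, D x -> C x).

Definition boundedA (S : Ann -> Prop) : Prop :=
  exists x0 M, forall x, S x -> distA x0 x <= M.

Definition jordan_curve (g : Ann -> Prop) : Prop :=
  exists c : R -> Ann,
    (forall s eps, 0 < eps -> exists delta, 0 < delta /\
       forall u, Rabs (u - s) < delta -> distA (c s) (c u) < eps) /\
    (forall s, c (s + 1) = c s) /\
    (forall s u, 0 <= s < 1 -> 0 <= u < 1 -> c s = c u -> s = u) /\
    (forall x, g x <-> exists s, c s = x).

Definition complA (S : Ann -> Prop) : Ann -> Prop := fun x => ~ S x.

Definition essential (g : Ann -> Prop) : Prop :=
  exists C1 C2, componentA (complA g) C1 /\ componentA (complA g) C2 /\
    (exists x, C1 x /\ ~ C2 x) /\ ~ boundedA C1 /\ ~ boundedA C2.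

Definition f_free (f : Ann -> Ann) (g : Ann -> Prop) : Prop :=
  forall x, g x -> ~ g (f x).

Definition closed_annulus (gp gm : Ann -> Prop) : Ann -> Prop :=
  fun x => gp x \/ gm x \/
    exists C, componentA (fun y => ~ gp y /\ ~ gm y) C /\ boundedA C /\ C x.

(** Maximal invariant set Theta(E) = { x in E | f^n(x) in E for all n in Z };
    f^{-n}(x) is expressed as the (unique, f being bijective) y with f^n y = x. *)
Definition Theta (f : Ann -> Ann) (E : Ann -> Prop) : Ann -> Prop :=
  fun x => forall n : nat,
    E (Nat.iter n f x) /\ (forall y, Nat.iter n f y = x -> E y).

Inductive ereal : Type := Fin (r : R) | PInf | NInf.

Definition ele (a b : ereal) : Prop :=
  match a, b with
  | NInf, _ => True
  | _, PInf => True
  | Fin x, Fin y => x <= y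
  | _, _ => False
  end.

Definition in_eclosure (S : R -> Prop) (a : ereal) : Prop :=
  match a with
  | Fin r => forall eps, 0 < eps -> exists s, S s /\ Rabs (s - r) < eps
  | PInf => forall M, exists s, S s /\ M < s
  | NInf => forall M, exists s, S s /\ s < M
  end.

Definition rho_tail (f : Ann -> Ann) (ft : R2 -> R2) (K : Ann -> Prop)
    (m : nat) (r : R) : Prop :=
  exists (n : nat) (zt : R2), (1 <= n)%nat /\ (m <= n)%nat /\
    K (piA zt) /\ K (Nat.iter n f (piA zt)) /\
    r = (p1 (Nat.iter n ft zt) - p1 zt) / INR n.

Definition rhoK (f : Ann -> Ann) (ft : R2 -> R2) (K : Ann -> Prop) : ereal -> Prop :=
  fun a => forall m : nat, (1 <= m)%nat -> in_eclosure (rho_tail f ft K m) a.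

Definition e_interval (J : ereal -> Prop) : Prop :=
  (exists a, J a) /\
  (forall a b c, J a -> J b -> ele a c -> ele c b -> J c).

(* Main.v *)
Require Import Defs.
From Stdlib Require Import Reals Lra Lia ZArith Arith Classical ClassicalEpsilon ProofIrrelevance.
Open Scope R_scope.

(** Let [P] and [Q] be the components of the complement of the two curves that contain the upper and
    the lower end, so that [A] is the complement of [P] and [Q].  As the curves are free, each of
    [P], [Q] is mapped into itself by [f] or by its inverse.  If [c] lies in a gap of the rotation
    set, [Theta(A)] splits into two invariant compact pieces, of rotation less than [c] and greater
    than [c].  When [A] is an attractor or a repeller, [Theta(A)] is a decreasing intersection of
    connected sets and cannot split.  Otherwise all escaping orbits cross [A] in the same direction.
    Then the set of points whose orbit never enters [P], and the set of those whose orbit never came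
    from [Q], split in the same way, and every point of [Theta(A)] is tied to the lower end inside
    the first set and to the upper end inside the second, by ties of uniformly bounded width in the
    universal covering.  Let [z], [w] be lifts of points of the two pieces.  Pushing [w] up along its
    tie normalises the angle of [w - z]; pushing [z] down gives the same value because the two ties
    are disjoint, and the value is transported correctly by the isotopy.  Pushing [w] down and [z] up
    gives a second normalisation with the same property, so the difference of the two angles is
    preserved by the dynamics.  But this difference tells whether [w] is far to the left or far to
    the right of [z], whereas [w] moves from far left to far right. *)

(** * Compactness *)

(** The sets that tie an orbit to an end need not be path connected, so ties are [e]-chains. An
    argument is continued along a chain by taking at each step the value within PI/2 of the previous
    one; this is unambiguous once consecutive vectors have positive scalar product, which a positive
    distance between the lower and the upper set guarantees. One normalised angle alone is not
    enough, because the isotopy may turn w around z any number of times; but a vector and its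
    opposite turn by the same amount, so the two normalised angles receive the same variation. The
    infinite-time sets are replaced by finite-time ones: by compactness there is a time [m] such
    that a point staying in A for [m] steps in both directions already keeps the sign of a function
    [phi] that distinguishes the two pieces. Connectedness then comes from a single homeomorphic
    image of a connected set, without any limit of sets. The start far to the left is obtained by a
    deck translation of w, and the opposite drifts of the two orbits relative to the speed c force
    the overtaking. *)

Lemma interval_induction (a b : R) (S : R -> Prop) :
  a <= b -> S a ->
  (forall t, a <= t <= b -> exists r, 0 < r /\
     forall s s', a <= s <= t -> t <= s' <= b -> t - r < s -> s' < t + r -> S s -> S s') ->
  S b.
Proof.
  intros Hab Ha Hloc.
  (* Real induction: let [c] be the supremum of the [t] with [S t]. The local hypothesis carries [S]
     from a point just left of [c] to [c] and beyond, so [c] is reached and cannot lie below [b]. *)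
  pose (X := fun t => a <= t <= b /\ S t).
  destruct (completeness X) as [c [Hub Hleast]].
  - exists b. intros t [Ht _]; lra.
  - exists a. split; [lra | exact Ha].
  - assert (Hac : a <= c) by (apply Hub; split; [lra | exact Ha]).
    assert (Hcb : c <= b) by (apply Hleast; intros t [Ht _]; lra).
    destruct (Hloc c) as [r [Hr HS]]; [lra |].
    assert (Hs : exists s, X s /\ c - r < s).
    { apply NNPP; intro Hno.
      assert (c <= c - r); [| lra].
      apply Hleast. intros t Ht. destruct (Rle_dec t (c - r)); [assumption |].
      exfalso; apply Hno. exists t; split; [assumption | lra]. }
    destruct Hs as [s [[Hs1 Hs2] Hs3]].
    assert (Hsc : s <= c) by (apply Hub; split; assumption).
    destruct (Rlt_dec c b) as [Hlt | Hge].
    + exfalso.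
      pose (s' := Rmin (c + r / 2) b).
      assert (c < s' <= b /\ s' <= c + r / 2).
      { unfold s', Rmin. destruct (Rle_dec (c + r / 2) b); lra. }
      assert (X s').
      { split; [lra |]. apply (HS s s'); try lra; exact Hs2. }
      assert (s' <= c) by (apply Hub; assumption). lra.
    + apply (HS s b); try lra; exact Hs2.
Qed.

Lemma inv_INR_lt (e : R) : 0 < e -> exists n : nat, / (INR n + 1) < e.
Proof.
  intro He. destruct (INR_archimed e 1 He) as [n Hn].
  exists n. pose proof (pos_INR n).
  apply (Rmult_lt_reg_r (INR n + 1)); [lra |].
  rewrite Rinv_l by lra. nra.
Qed.

Lemma inv_INR_pos (n : nat) : 0 < / (INR n + 1).
Proof. apply Rinv_0_lt_compat. pose proof (pos_INR n). lra. Qed.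

Lemma inv_INR_le (m n : nat) : (m <= n)%nat -> / (INR n + 1) <= / (INR m + 1).
Proof.
  intro H. apply le_INR in H. pose proof (pos_INR m).
  apply Rinv_le_contravar; lra.
Qed.

(** Compactness without covers: an index that works locally works uniformly. The monotone [n] serves
    as a size bound, or as a radius written [/ (INR n + 1)]. *)
Lemma compact_interval (B : R -> nat -> Prop) (a b : R) :
  (forall x m n, (m <= n)%nat -> B x m -> B x n) ->
  (forall x0, a <= x0 <= b -> exists r n, 0 < r /\
     forall x, a <= x <= b -> Rabs (x - x0) < r -> B x n) ->
  exists n, forall x, a <= x <= b -> B x n.
Proof.
  intros Hmono Hloc.
  destruct (Rle_dec a b) as [Hab | Hab]; [| exists 0%nat; intros; lra].
  apply (interval_induction a b (fun t => exists n, forall x, a <= x <= t -> B x n)); auto.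
  - destruct (Hloc a) as [r [n [Hr Hn]]]; [lra |].
    exists n. intros x Hx. apply Hn; [lra |].
    replace (x - a) with 0 by lra. rewrite Rabs_R0. exact Hr.
  - intros t Ht. destruct (Hloc t Ht) as [r [n [Hr Hn]]].
    exists r; split; [exact Hr |].
    intros s s' Hs Hs' H1 H2 [m Hm].
    exists (Nat.max m n). intros x Hx.
    destruct (Rle_dec x s).
    + apply (Hmono x m); [lia |]. apply Hm; lra.
    + apply (Hmono x n); [lia |]. apply Hn; [lra |].
      apply Rabs_def1; lra.
Qed.

Definition near (e : R) (a b : R2) : Prop :=
  Rabs (fst a - fst b) < e /\ Rabs (snd a - snd b) < e.

Lemma compact_rectangle (B : R2 -> nat -> Prop) (a b c d : R) :
  (forall x m n, (m <= n)%nat -> B x m -> B x n) ->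
  (forall z0, a <= fst z0 <= b -> c <= snd z0 <= d -> exists r n, 0 < r /\
     forall z, near r z z0 -> B z n) ->
  exists n, forall z, a <= fst z <= b -> c <= snd z <= d -> B z n.
Proof.
  intros Hmono Hloc.
  destruct (compact_interval
    (fun x n => forall y, c <= y <= d -> B (x, y) n) a b) as [n Hn].
  - intros x m n Hmn H y Hy. apply (Hmono _ m); auto.
  - intros x0 Hx0.
    (* Tube argument: the index of this vertical induction also encodes the width of a strip around
       [x0]. *)
    destruct (compact_interval
      (fun y n => forall x, Rabs (x - x0) < / (INR n + 1) -> B (x, y) n) c d) as [n Hn].
    + intros y m n Hmn H x Hx. apply (Hmono _ m); auto.
      apply H. pose proof (inv_INR_le m n Hmn). lra.
    + intros y0 Hy0. destruct (Hloc (x0, y0)) as [r [n [Hr Hn]]]; auto.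
      destruct (inv_INR_lt r Hr) as [p Hp].
      exists r, (Nat.max n p). split; [exact Hr |].
      intros y Hy Hyr x Hx. apply (Hmono _ n); [lia |].
      apply Hn. split; simpl; auto.
      pose proof (inv_INR_le p (Nat.max n p) ltac:(lia)). lra.
    + exists (/ (INR n + 1)), n. split; [apply inv_INR_pos |]. auto.
  - exists n. intros [x y]; simpl; auto.
Qed.

Lemma compact_box (B : R -> R2 -> nat -> Prop) (a b c d : R) :
  (forall t z m n, (m <= n)%nat -> B t z m -> B t z n) ->
  (forall t0 z0, 0 <= t0 <= 1 -> a <= fst z0 <= b -> c <= snd z0 <= d -> exists r n, 0 < r /\
     forall t z, 0 <= t <= 1 -> Rabs (t - t0) < r -> near r z z0 -> B t z n) ->
  exists n, forall t z, 0 <= t <= 1 -> a <= fst z <= b -> c <= snd z <= d -> B t z n.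
Proof.
  intros Hmono Hloc.
  destruct (compact_interval
    (fun t n => forall z, a <= fst z <= b -> c <= snd z <= d -> B t z n) 0 1) as [n Hn].
  - intros t m n Hmn H z H1 H2. apply (Hmono _ _ m); auto.
  - intros t0 Ht0.
    destruct (compact_rectangle
      (fun z n => forall t, 0 <= t <= 1 -> Rabs (t - t0) < / (INR n + 1) -> B t z n) a b c d)
      as [n Hn].
    + intros z m n Hmn H t Ht Ht'. apply (Hmono _ _ m); auto.
      apply H; auto. pose proof (inv_INR_le m n Hmn). lra.
    + intros z0 H1 H2. destruct (Hloc t0 z0) as [r [n [Hr Hn]]]; auto.
      destruct (inv_INR_lt r Hr) as [p Hp].
      exists r, (Nat.max n p). split; [exact Hr |].
      intros z Hz t Ht Htt. apply (Hmono _ _ n); [lia |].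
      apply Hn; auto.
      pose proof (inv_INR_le p (Nat.max n p) ltac:(lia)). lra.
    + exists (/ (INR n + 1)), n. split; [apply inv_INR_pos |]. auto.
  - exists n. intros; auto.
Qed.

(** * The universal covering *)

Lemma near_sym (e : R) (a b : R2) : near e a b -> near e b a.
Proof. intros [H1 H2]; split; rewrite Rabs_minus_sym; assumption. Qed.

Lemma near_refl (e : R) (a : R2) : 0 < e -> near e a a.
Proof. intro He; split; rewrite Rminus_diag, Rabs_R0; exact He. Qed.

Lemma near_trans (e e' : R) (a b c : R2) : near e a b -> near e' b c -> near (e + e') a c.
Proof.
  intros [H1 H2] [H3 H4]. apply Rabs_def2 in H1, H2, H3, H4.
  split; apply Rabs_def1; lra.
Qed.

Lemma near_le (e e' : R) (a b : R2) : e <= e' -> near e a b -> near e' a b.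
Proof. intros H [H1 H2]; split; lra. Qed.

Lemma sqrt_sum_lt (a b c e : R) :
  0 < e -> Rabs a < e / 3 -> Rabs b < e / 3 -> Rabs c < e / 3 ->
  sqrt (a ^ 2 + b ^ 2 + c ^ 2) < e.
Proof.
  intros He Ha Hb Hc. apply Rabs_def2 in Ha, Hb, Hc.
  assert (Hsq : forall u, - (e / 3) < u < e / 3 -> 0 <= u ^ 2 < e ^ 2 / 9) by (intros u Hu; nra).
  pose proof (Hsq a ltac:(lra)). pose proof (Hsq b ltac:(lra)). pose proof (Hsq c ltac:(lra)).
  rewrite <- (sqrt_pow2 e) by lra. apply sqrt_lt_1; nra.
Qed.

Lemma Rabs_le_sqrt (a s : R) : a ^ 2 <= s -> Rabs a <= sqrt s.
Proof.
  intro H. rewrite <- (sqrt_Rsqr_abs a). apply sqrt_le_1.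
  - apply Rle_0_sqr.
  - nra.
  - unfold Rsqr; nra.
Qed.

Lemma dist2_near (e : R) (a b : R2) : dist2 a b < e -> near e a b.
Proof.
  unfold dist2; intro H.
  pose proof (pow2_ge_0 (fst a - fst b)). pose proof (pow2_ge_0 (snd a - snd b)).
  split; apply Rle_lt_trans with (2 := H); apply Rabs_le_sqrt; lra.
Qed.

Lemma near_dist2 (e : R) (a b : R2) : 0 < e -> near (e / 3) a b -> dist2 a b < e.
Proof.
  intros He [H1 H2]. unfold dist2.
  replace (_ + _) with ((fst a - fst b) ^ 2 + (snd a - snd b) ^ 2 + 0 ^ 2) by ring.
  apply sqrt_sum_lt; auto. rewrite Rabs_R0; lra.
Qed.

Definition hA (x : Ann) : R := snd (proj1_sig x).

Lemma hA_piA (z : R2) : hA (piA z) = snd z.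
Proof. reflexivity. Qed.

Lemma hA_dist (x y : Ann) : Rabs (hA x - hA y) <= distA x y.
Proof.
  destruct x as [[[a b] c] Hx], y as [[[a' b'] c'] Hy]. unfold distA, hA; simpl.
  apply Rabs_le_sqrt. pose proof (pow2_ge_0 (a - a')). pose proof (pow2_ge_0 (b - b')). lra.
Qed.

Lemma distA_sym (x y : Ann) : distA x y = distA y x.
Proof.
  destruct x as [[[a b] c] Hx], y as [[[a' b'] c'] Hy]. unfold distA; simpl.
  f_equal; ring.
Qed.

Lemma distA_refl (x : Ann) : distA x x = 0.
Proof.
  destruct x as [[[a b] c] Hx]. unfold distA; simpl.
  rewrite <- sqrt_0. f_equal; ring.
Qed.

Lemma triangle_sq (a b c a' b' c' : R) :
  sqrt ((a + a') ^ 2 + (b + b') ^ 2 + (c + c') ^ 2)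
  <= sqrt (a ^ 2 + b ^ 2 + c ^ 2) + sqrt (a' ^ 2 + b' ^ 2 + c' ^ 2).
Proof.
  set (s := a ^ 2 + b ^ 2 + c ^ 2). set (t := a' ^ 2 + b' ^ 2 + c' ^ 2).
  assert (Hs : 0 <= s) by (unfold s; nra). assert (Ht : 0 <= t) by (unfold t; nra).
  pose proof (sqrt_pos s). pose proof (sqrt_pos t).
  pose proof (sqrt_sqrt s Hs). pose proof (sqrt_sqrt t Ht).
  assert (a * a' + b * b' + c * c' <= sqrt s * sqrt t).
  { rewrite <- sqrt_mult by assumption.
    apply Rle_trans with (Rabs (a * a' + b * b' + c * c')); [apply Rle_abs |].
    apply Rabs_le_sqrt.
    assert (s * t - (a * a' + b * b' + c * c') ^ 2
      = (a * b' - b * a') ^ 2 + (a * c' - c * a') ^ 2 + (b * c' - c * b') ^ 2)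
      by (unfold s, t; ring).
    pose proof (pow2_ge_0 (a * b' - b * a')). pose proof (pow2_ge_0 (a * c' - c * a')).
    pose proof (pow2_ge_0 (b * c' - c * b')). lra. }
  rewrite <- (sqrt_pow2 (sqrt s + sqrt t)) by lra.
  apply sqrt_le_1.
  - pose proof (pow2_ge_0 (a + a')). pose proof (pow2_ge_0 (b + b')).
    pose proof (pow2_ge_0 (c + c')). lra.
  - apply pow2_ge_0.
  - replace ((sqrt s + sqrt t) ^ 2)
      with (sqrt s * sqrt s + sqrt t * sqrt t + 2 * (sqrt s * sqrt t)) by ring.
    unfold s, t in *. lra.
Qed.

Lemma distA_tri (x y z : Ann) : distA x z <= distA x y + distA y z.
Proof.
  destruct x as [[[a b] c] Hx], y as [[[a' b'] c'] Hy], z as [[[a2 b2] c2] Hz].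
  unfold distA; simpl proj1_sig; unfold dist3.
  replace (a - a2) with ((a - a') + (a' - a2)) by ring.
  replace (b - b2) with ((b - b') + (b' - b2)) by ring.
  replace (c - c2) with ((c - c') + (c' - c2)) by ring.
  apply triangle_sq.
Qed.

Lemma circle_param (a b : R) : a * a + b * b = 1 -> exists t, a = cos t /\ b = sin t.
Proof.
  intro H. assert (Ha : -1 <= a <= 1) by nra.
  assert (Hs : sqrt (1 - Rsqr a) = Rabs b).
  { rewrite <- sqrt_Rsqr_abs. f_equal. unfold Rsqr; lra. }
  destruct (Rle_dec 0 b).
  - exists (acos a). rewrite cos_acos, sin_acos, Hs, Rabs_pos_eq; auto.
  - exists (- acos a).
    rewrite cos_neg, sin_neg, cos_acos, sin_acos, Hs, Rabs_left; auto; lra.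
Qed.

Lemma cos_sin_period (s t : R) :
  cos s = cos t -> sin s = sin t -> exists k : Z, s = t + 2 * PI * IZR k.
Proof.
  intros Hc Hs.
  assert (H : sin ((s - t) / 2) = 0).
  { assert (H1 : cos (2 * ((s - t) / 2)) = 1).
    { replace (2 * ((s - t) / 2)) with (s - t) by field.
      rewrite cos_minus, Hc, Hs. pose proof (sin2_cos2 t). unfold Rsqr in *; lra. }
    rewrite cos_2a_sin in H1. nra. }
  destruct (sin_eq_0_0 _ H) as [k Hk]. exists k. lra.
Qed.

Lemma cos_sin_shift (t : R) (k : Z) :
  cos (t + 2 * PI * IZR k) = cos t /\ sin (t + 2 * PI * IZR k) = sin t.
Proof.
  assert (Hnat : forall u n, cos (u + 2 * PI * INR n) = cos u /\ sin (u + 2 * PI * INR n) = sin u).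
  { intros u n. replace (u + 2 * PI * INR n) with (u + 2 * INR n * PI) by ring.
    split; [apply cos_period | apply sin_period]. }
  destruct (Z.le_gt_cases 0 k) as [Hk | Hk].
  - rewrite <- (Z2Nat.id k Hk), <- INR_IZR_INZ. apply Hnat.
  - destruct (Hnat (t + 2 * PI * IZR k) (Z.to_nat (- k))) as [H1 H2].
    rewrite INR_IZR_INZ, Z2Nat.id, opp_IZR in H1, H2 by lia.
    replace (t + 2 * PI * IZR k + 2 * PI * - IZR k) with t in H1, H2 by ring.
    split; congruence.
Qed.

Definition deck (k : Z) (z : R2) : R2 := (fst z + IZR k, snd z).

Lemma ann_eq (x y : Ann) : proj1_sig x = proj1_sig y -> x = y.
Proof.
  destruct x as [p Hp], y as [q Hq]; simpl. intros ->. f_equal. apply proof_irrelevance.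
Qed.

Lemma piA_deck (k : Z) (z : R2) : piA (deck k z) = piA z.
Proof.
  apply ann_eq. simpl. destruct (cos_sin_shift (2 * PI * fst z) k) as [H1 H2].
  rewrite Rmult_plus_distr_l, H1, H2. reflexivity.
Qed.

Lemma piA_eq (a b : R2) : piA a = piA b -> exists k, b = deck k a.
Proof.
  intro H. apply (f_equal (@proj1_sig _ _)) in H. simpl in H. injection H as H1 H2 H3.
  destruct (cos_sin_period (2 * PI * fst b) (2 * PI * fst a)) as [k Hk]; auto.
  exists k. unfold deck. destruct a as [a1 a2], b as [b1 b2]; simpl in *. f_equal; auto.
  pose proof PI_RGT_0. nra.
Qed.

Lemma piA_surj (x : Ann) : exists z, piA z = x.
Proof.
  destruct x as [[[a b] c] H].
  destruct (circle_param a b) as [t [Ha Hb]]; [exact H |].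
  exists (t / (2 * PI), c). apply ann_eq. simpl.
  pose proof PI_RGT_0.
  replace (2 * PI * (t / (2 * PI))) with t by (field; lra).
  congruence.
Qed.

Lemma deck_deck (j k : Z) (z : R2) : deck j (deck k z) = deck (k + j) z.
Proof. unfold deck; simpl. rewrite plus_IZR. f_equal; ring. Qed.

Lemma deck_0 (z : R2) : deck 0 z = z.
Proof. destruct z; unfold deck; simpl. f_equal; ring. Qed.

Lemma near_deck (e : R) (k : Z) (a b : R2) : near e a b -> near e (deck k a) (deck k b).
Proof.
  intros [H1 H2]; split; simpl; auto.
  replace (_ - _) with (fst a - fst b) by ring. exact H1.
Qed.

Lemma deck_unit (z : R2) : exists k, 0 <= fst (deck k z) <= 1.
Proof.
  exists (- Int_part (fst z))%Z. simpl. rewrite opp_IZR.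
  pose proof (base_Int_part (fst z)). lra.
Qed.

Lemma piA_surj_unit (x : Ann) : exists z, piA z = x /\ 0 <= fst z <= 1.
Proof.
  destruct (piA_surj x) as [z <-]. destruct (deck_unit z) as [k Hk].
  exists (deck k z). split; [apply piA_deck | exact Hk].
Qed.

Lemma Rabs_sin_le (x : R) : Rabs (sin x) <= Rabs x.
Proof.
  destruct (Rtotal_order x 0) as [H | [-> | H]].
  - rewrite (Rabs_left x), <- Rabs_Ropp, <- sin_neg by lra.
    destruct (Rle_dec (- x) 1).
    + pose proof (sin_lt_x (- x) ltac:(lra)). pose proof (sin_gt_0 (- x) ltac:(lra)).
      pose proof PI2_1. rewrite Rabs_pos_eq by lra. lra.
    + pose proof (SIN_bound (- x)). apply Rabs_le; lra.
  - rewrite sin_0. lra.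
  - rewrite (Rabs_pos_eq x) by lra.
    destruct (Rle_dec x 1).
    + pose proof (sin_lt_x x ltac:(lra)). pose proof (sin_gt_0 x ltac:(lra)).
      pose proof PI2_1. rewrite Rabs_pos_eq by lra. lra.
    + pose proof (SIN_bound x). apply Rabs_le; lra.
Qed.

Lemma distA_piA (a b : R2) :
  distA (piA a) (piA b)
  = sqrt ((2 * sin (PI * (fst a - fst b))) ^ 2 + (snd a - snd b) ^ 2).
Proof.
  unfold distA; simpl proj1_sig; unfold dist3. f_equal. f_equal.
  replace ((2 * sin (PI * (fst a - fst b))) ^ 2) with (2 * (2 * sin (PI * (fst a - fst b)) * sin (PI * (fst a - fst b)))) by ring.
  replace (2 * sin (PI * (fst a - fst b)) * sin (PI * (fst a - fst b)))
    with (1 - cos (2 * PI * fst a - 2 * PI * fst b)).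
  2: { replace (2 * PI * fst a - 2 * PI * fst b) with (2 * (PI * (fst a - fst b))) by ring.
       rewrite cos_2a_sin. ring. }
  rewrite cos_minus. pose proof (sin2_cos2 (2 * PI * fst a)).
  pose proof (sin2_cos2 (2 * PI * fst b)). unfold Rsqr in *. nra.
Qed.

(** The constant 24 is 3 times 8: the chord is 2 |sin (PI u)| <= 2 PI |u| <= 8 |u|, and each
    coordinate may use [e / 3]. *)
Lemma near_distA (e : R) (a b : R2) : 0 < e -> near (e / 24) a b -> distA (piA a) (piA b) < e.
Proof.
  intros He [H1 H2]. rewrite distA_piA.
  replace (_ + _) with ((2 * sin (PI * (fst a - fst b))) ^ 2 + (snd a - snd b) ^ 2 + 0 ^ 2) by ring.
  apply sqrt_sum_lt; auto; [| lra | rewrite Rabs_R0; lra].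
  rewrite Rabs_mult, (Rabs_pos_eq 2) by lra.
  pose proof (Rabs_sin_le (PI * (fst a - fst b))) as H.
  rewrite Rabs_mult, (Rabs_pos_eq PI) in H by (pose proof PI_RGT_0; lra).
  pose proof PI_4. pose proof (Rabs_pos (fst a - fst b)). nra.
Qed.

(** Local inverse of the covering, uniform in the base point: take the lift of [y] whose abscissa is
    within 1/2 of that of [a]; in this range the chord controls the abscissa. *)
Lemma distA_lift (e : R) : 0 < e -> exists d, 0 < d /\
  forall a y, distA (piA a) y < d -> exists b, piA b = y /\ near e a b.
Proof.
  (* The cap 1/2 keeps [PI * e'] in the interval [0, PI/2], where the sine increases. *)
  intro He. set (e' := Rmin e (1 / 2)).
  assert (He' : 0 < e' /\ e' <= e /\ e' <= 1 / 2).
  { unfold e', Rmin. destruct (Rle_dec e (1 / 2)); lra. }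
  pose proof PI_RGT_0 as HPI.
  assert (Hsin : 0 < sin (PI * e')).
  { apply sin_gt_0; nra. }
  exists (Rmin e (sin (PI * e'))). split.
  { apply Rmin_pos; auto. }
  intros a y Hd.
  destruct (piA_surj y) as [b0 Hb0].
  set (k := (- Int_part (fst b0 - fst a + 1 / 2))%Z).
  exists (deck k b0).
  assert (Hy : piA (deck k b0) = y) by (rewrite piA_deck; exact Hb0).
  split; [exact Hy |].
  assert (Hu : -1 / 2 <= fst (deck k b0) - fst a <= 1 / 2).
  { unfold k; simpl. rewrite opp_IZR. pose proof (base_Int_part (fst b0 - fst a + 1 / 2)). lra. }
  rewrite <- Hy, distA_piA in Hd.
  set (b := deck k b0) in *.
  pose proof (Rmin_l e (sin (PI * e'))). pose proof (Rmin_r e (sin (PI * e'))).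
  pose proof (pow2_ge_0 (2 * sin (PI * (fst a - fst b)))).
  pose proof (pow2_ge_0 (snd a - snd b)).
  assert (Hsx : Rabs (2 * sin (PI * (fst a - fst b))) < sin (PI * e')).
  { eapply Rle_lt_trans; [apply Rabs_le_sqrt with (s := (2 * sin (PI * (fst a - fst b))) ^ 2 + (snd a - snd b) ^ 2) |]; lra. }
  assert (Hsy : Rabs (snd a - snd b) < e).
  { eapply Rle_lt_trans; [apply Rabs_le_sqrt with (s := (2 * sin (PI * (fst a - fst b))) ^ 2 + (snd a - snd b) ^ 2) |]; lra. }
  split; [| exact Hsy].
  apply Rabs_def2 in Hsx.
  apply Rlt_le_trans with e'; [| lra].
  apply Rabs_def1; apply Rnot_le_lt; intro Hc.
  - assert (sin (PI * e') <= sin (PI * (fst a - fst b))); [| lra].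
    apply sin_incr_1; nra.
  - assert (sin (PI * e') <= sin (- (PI * (fst a - fst b)))); [| rewrite sin_neg in *; lra].
    apply sin_incr_1; nra.
Qed.

Lemma Rabs_bounds (x H : R) : Rabs x <= H -> - H <= x <= H.
Proof. intro Hx. pose proof (Rle_abs x). pose proof (Rle_abs (- x)). rewrite Rabs_Ropp in *. lra. Qed.

Lemma compact_annulus (B : Ann -> nat -> Prop) (H : R) :
  (forall x m n, (m <= n)%nat -> B x m -> B x n) ->
  (forall x0, exists r n, 0 < r /\ forall x, distA x0 x < r -> B x n) ->
  exists n, forall x, Rabs (hA x) <= H -> B x n.
Proof.
  intros Hmono Hloc.
  destruct (compact_rectangle (fun z n => B (piA z) n) 0 1 (- H) H) as [n Hn].
  - intros z m n Hmn. apply Hmono; exact Hmn.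
  - intros z0 _ _. destruct (Hloc (piA z0)) as [r [n [Hr Hn]]].
    exists (r / 24), n. split; [lra |]. intros z Hz. apply Hn.
    rewrite distA_sym. apply near_distA; auto.
  - exists n. intros x Hx. destruct (piA_surj_unit x) as [z [<- Hz]].
    apply Hn; auto. rewrite hA_piA in Hx. apply Rabs_bounds in Hx. lra.
Qed.

(** A Lebesgue number for a band; only the first of the two points has to lie in the band. *)
Lemma lebesgue_annulus (Rel : Ann -> Ann -> Prop) (H : R) :
  (forall x0, exists r, 0 < r /\ forall x y, distA x0 x < r -> distA x0 y < r -> Rel x y) ->
  exists e, 0 < e /\ forall x y, Rabs (hA x) <= H -> distA x y < e -> Rel x y.
Proof.
  intro Hloc.
  destruct (compact_annulus (fun x n => forall y, distA x y < / (INR n + 1) -> Rel x y) H)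
    as [n Hn].
  - intros x m n Hmn HB y Hy. apply HB. pose proof (inv_INR_le m n Hmn). lra.
  - intro x0. destruct (Hloc x0) as [r [Hr HR]].
    destruct (inv_INR_lt (r / 2)) as [n Hn]; [lra |].
    exists (r / 2), n. split; [lra |]. intros x Hx y Hy.
    apply HR; [lra |]. pose proof (distA_tri x0 x y). lra.
  - exists (/ (INR n + 1)). split; [apply inv_INR_pos |]. auto.
Qed.

(** * Lifted angles along chains *)

Definition sub2 (a b : R2) : R2 := (fst a - fst b, snd a - snd b).
Definition opp2 (a : R2) : R2 := (- fst a, - snd a).
Definition dot (p q : R2) : R := fst p * fst q + snd p * snd q.

Definition polar (p : R2) (th : R) : Prop :=
  exists r, 0 < r /\ fst p = r * cos th /\ snd p = r * sin th.

Lemma polar_exists (p : R2) : fst p <> 0 \/ snd p <> 0 -> exists th, polar p th.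
Proof.
  intro Hp. set (s := fst p ^ 2 + snd p ^ 2).
  assert (Hs : 0 < s).
  { unfold s. pose proof (pow2_ge_0 (fst p)). pose proof (pow2_ge_0 (snd p)).
    destruct Hp as [Hp | Hp]; apply (pow_nonzero _ 2) in Hp; lra. }
  pose proof (sqrt_lt_R0 s Hs). pose proof (sqrt_sqrt s ltac:(lra)) as Hss.
  destruct (circle_param (fst p / sqrt s) (snd p / sqrt s)) as [t [Hc Hsn]].
  - replace (_ + _) with (s / (sqrt s * sqrt s)) by (unfold s; field; fold s; lra).
    rewrite Hss. field. lra.
  - exists t, (sqrt s). rewrite <- Hc, <- Hsn.
    repeat split; auto; field; lra.
Qed.

Lemma polar_shift (p : R2) (th : R) (k : Z) : polar p th -> polar p (th + 2 * PI * IZR k).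
Proof.
  intros [r [Hr [H1 H2]]]. exists r. destruct (cos_sin_shift th k) as [-> ->]. auto.
Qed.

Lemma polar_unique (p : R2) (th th' : R) :
  polar p th -> polar p th' -> exists k : Z, th' = th + 2 * PI * IZR k.
Proof.
  intros [r [Hr [H1 H2]]] [r' [Hr' [H1' H2']]].
  assert (Hrr : r = r').
  { pose proof (sin2_cos2 th). pose proof (sin2_cos2 th'). unfold Rsqr in *.
    assert (r * r = r' * r').
    { replace (r * r) with ((r * cos th) * (r * cos th) + (r * sin th) * (r * sin th)) by nra.
      rewrite <- H1, <- H2, H1', H2'. nra. }
    nra. }
  subst r'. apply cos_sin_period; apply (Rmult_eq_reg_l r); lra.
Qed.

Lemma polar_opp (p : R2) (th : R) : polar p th -> polar (opp2 p) (th + PI).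
Proof.
  intros [r [Hr [H1 H2]]]. exists r. rewrite neg_cos, neg_sin. unfold opp2; simpl.
  repeat split; auto; lra.
Qed.

Lemma polar_dot (p q : R2) (th th' : R) :
  polar p th -> polar q th' -> 0 < dot p q -> 0 < cos (th - th').
Proof.
  intros [r [Hr [H1 H2]]] [r' [Hr' [H1' H2']]] Hd.
  unfold dot in Hd. rewrite H1, H2, H1', H2' in Hd. rewrite cos_minus.
  assert (0 < r * r') by nra.
  apply (Rmult_lt_reg_l (r * r')); [assumption | nra].
Qed.

Lemma cos_pos_small (x : R) : 0 < cos x -> Rabs x < 3 * (PI / 2) -> Rabs x < PI / 2.
Proof.
  intros Hc Hx. apply Rnot_le_lt; intro H.
  assert (cos (Rabs x) <= 0) by (apply cos_le_0; lra).
  unfold Rabs in *. destruct (Rcase_abs x); [rewrite cos_neg in * |]; lra.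
Qed.

(** The slack explains the constants: three successive changes below PI/2 add up to less than 3
    PI/2, and the positive scalar product brings the bound back to PI/2. *)
Lemma polar_close (p q : R2) (th th' : R) :
  polar p th -> polar q th' -> 0 < dot p q ->
  Rabs (th - th') < 3 * (PI / 2) -> Rabs (th - th') < PI / 2.
Proof. intros Hp Hq Hd. apply cos_pos_small. apply (polar_dot p q); assumption. Qed.

Lemma dot_nonzero (p q : R2) : 0 < dot p q -> fst q <> 0 \/ snd q <> 0.
Proof.
  intro Hd. destruct (Req_dec (fst q) 0) as [E1 |]; [right | now left].
  intro E2. unfold dot in Hd. rewrite E1, E2 in Hd. lra.
Qed.

Lemma polar_next (p q : R2) (th : R) :
  polar p th -> 0 < dot p q -> exists th', polar q th' /\ Rabs (th - th') < PI / 2.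
Proof.
  intros Hp Hd. destruct (polar_exists q (dot_nonzero p q Hd)) as [t Ht].
  pose proof PI_RGT_0.
  set (k := Int_part ((th - t) / (2 * PI) + 1 / 2)).
  exists (t + 2 * PI * IZR k). split; [apply polar_shift; exact Ht |].
  apply (polar_close p q); auto; [apply polar_shift; exact Ht |].
  pose proof (base_Int_part ((th - t) / (2 * PI) + 1 / 2)) as Hk. fold k in Hk.
  assert (E : th - t = 2 * PI * ((th - t) / (2 * PI))) by (field; lra).
  set (u := (th - t) / (2 * PI)) in *.
  apply Rle_lt_trans with PI; [| lra]. apply Rabs_le. nra.
Qed.

Lemma polar_upper (p : R2) (th : R) :
  polar p th -> 0 < snd p -> - (PI / 2) < th < 3 * (PI / 2) -> 0 < th < PI.
Proof.
  intros [r [Hr [_ H2]]] Hp Hth. rewrite H2 in Hp.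
  assert (Hs : 0 < sin th) by nra. pose proof PI_RGT_0.
  split; apply Rnot_le_lt; intro Hc.
  - pose proof (sin_ge_0 (- th) ltac:(lra) ltac:(lra)) as Hn. rewrite sin_neg in Hn. lra.
  - pose proof (sin_le_0 th ltac:(lra) ltac:(lra)). lra.
Qed.

Lemma polar_right (p : R2) (th : R) :
  polar p th -> 0 < fst p -> Rabs th < 3 * (PI / 2) -> Rabs th < PI / 2.
Proof.
  intros [r [Hr [H1 _]]] Hp. rewrite H1 in Hp. apply cos_pos_small. nra.
Qed.

Lemma polar_left (p : R2) (th : R) :
  polar p th -> fst p < 0 -> Rabs (th - PI) < 3 * (PI / 2) -> Rabs (th - PI) < PI / 2.
Proof.
  intros [r [Hr [H1 _]]] Hp. rewrite H1 in Hp. apply cos_pos_small.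
  replace (th - PI) with (- (PI - th)) by ring.
  rewrite cos_neg, cos_minus, cos_PI, sin_PI. nra.
Qed.

Definition far (d : R) (p : R2) : Prop := ~ (Rabs (fst p) < d /\ Rabs (snd p) < d).

(** In the sup norm, a change of less than half the size of a vector cannot turn it by a right
    angle. *)
Lemma dot_pos (p q : R2) (d : R) :
  0 < d -> far d p -> near (d / 2) p q -> 0 < dot p q.
Proof.
  intros Hd Hf [Hx Hy]. apply Rabs_def2 in Hx, Hy. unfold dot, far in *.
  destruct p as [a b], q as [a' b']; simpl in *.
  replace a' with (a - (a - a')) by ring. replace b' with (b - (b - b')) by ring.
  set (u := a - a') in *. set (v := b - b') in *. clearbody u v.
  assert (Hsmall : forall t s, - (d / 2) < s < d / 2 -> - (d * d / 16) <= t * (t - s)).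
  { intros t s Hs. pose proof (pow2_ge_0 (t - s / 2)). nra. }
  assert (Hbig : forall t s, - (d / 2) < s < d / 2 -> d <= Rabs t -> d * d / 2 <= t * (t - s)).
  { intros t s Hs Ht. unfold Rabs in Ht. destruct (Rcase_abs t); nra. }
  destruct (Rlt_dec (Rabs a) d) as [Ha | Ha].
  - destruct (Rlt_dec (Rabs b) d) as [Hb | Hb]; [tauto |].
    pose proof (Hsmall a u ltac:(lra)). pose proof (Hbig b v ltac:(lra) ltac:(lra)). nra.
  - pose proof (Hsmall b v ltac:(lra)). pose proof (Hbig a u ltac:(lra) ltac:(lra)). nra.
Qed.

(* [th] is the angle of [p w] obtained by continuation along an [e]-chain in [G] that joins [w]
   to a point of height at least [H], where the angle is normalised to lie in (0, PI). *)
Inductive lifted_angle (G : R2 -> Prop) (e H : R) (p : R2 -> R2) : R2 -> R -> Prop :=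
| lifted_top w th :
    G w -> H <= snd w -> polar (p w) th -> 0 < th < PI -> lifted_angle G e H p w th
| lifted_step w w' th th' :
    G w -> near e w w' -> polar (p w) th -> Rabs (th - th') < PI / 2 ->
    lifted_angle G e H p w' th' -> lifted_angle G e H p w th.

(** The chains underlying [lifted_angle], with a vertical strip that contains them. The strip
    measures the width of a tie in the plane: a base point outside it sees the whole chain on one
    side. *)
Inductive chain_up (G : R2 -> Prop) (e H lo hi : R) : R2 -> Prop :=
| chain_top w : G w -> H <= snd w -> lo < fst w < hi -> chain_up G e H lo hi w
| chain_step w w' :
    G w -> lo < fst w < hi -> near e w w' -> chain_up G e H lo hi w' -> chain_up G e H lo hi w.

Lemma lifted_polar G e H p w th : lifted_angle G e H p w th -> polar (p w) th.
Proof. intros []; assumption. Qed.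

Lemma lifted_in G e H p w th : lifted_angle G e H p w th -> G w.
Proof. intros []; assumption. Qed.

Lemma chain_in G e H lo hi w : chain_up G e H lo hi w -> G w /\ lo < fst w < hi.
Proof. intros []; auto. Qed.

Lemma chain_up_sub (G G' : R2 -> Prop) e e' H H' lo hi lo' hi' w :
  (forall a, G a -> G' a) -> e <= e' -> H' <= H -> lo' <= lo -> hi <= hi' ->
  chain_up G e H lo hi w -> chain_up G' e' H' lo' hi' w.
Proof.
  intros HG He HH Hlo Hhi. induction 1 as [w Hw HwH Hb | w w' Hw Hb Hn _ IH].
  - apply chain_top; auto; lra.
  - apply chain_step with w'; auto; [lra | apply (near_le e); assumption].
Qed.

(** Stopping the chain at its first passage above [H] keeps it below [H + 1], in a region where the
    isotopy is uniformly controlled. *)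
Lemma chain_up_truncate G e H lo hi w :
  e <= 1 -> snd w < H + 1 -> chain_up G e H lo hi w ->
  chain_up (fun a => G a /\ snd a < H + 1) e H lo hi w.
Proof.
  intros He Hw Hc. induction Hc as [w Gw HwH Hb | w w' Gw Hb Hn Hc IH].
  - apply chain_top; auto.
  - destruct (Rle_dec H (snd w)).
    + apply chain_top; auto.
    + apply chain_step with w'; auto. apply IH.
      destruct Hn as [_ Hn]. apply Rabs_def2 in Hn. lra.
Qed.

Lemma chain_up_lifted G e H lo hi p w :
  (forall a b, G a -> G b -> near e a b -> 0 < dot (p b) (p a)) ->
  (forall a, G a -> H <= snd a -> 0 < snd (p a)) ->
  chain_up G e H lo hi w -> exists th, lifted_angle G e H p w th.
Proof.
  intros Hdot Htop. induction 1 as [w Hw HwH _ | w w' Hw _ Hn Hc [th' IH]].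
  - pose proof (Htop w Hw HwH) as Hp.
    assert (Hup : polar (0, 1) (PI / 2)).
    { exists 1. rewrite cos_PI2, sin_PI2. simpl. lra. }
    destruct (polar_next (0, 1) (p w) (PI / 2) Hup) as [th [Hth Hd]].
    { unfold dot; simpl. lra. }
    apply Rabs_def2 in Hd. exists th. apply lifted_top; auto. lra.
  - destruct (polar_next (p w') (p w) th') as [th [Hth Hd]].
    + apply (lifted_polar G e H). exact IH.
    + apply Hdot; auto. apply (chain_in _ _ _ _ _ _ Hc).
    + exists th. apply lifted_step with w' th'; auto. rewrite Rabs_minus_sym; exact Hd.
Qed.

(** When the chain lies entirely to the right of the base point, every vector is in the right half
    plane. From (-PI/2, PI/2) a step below PI/2 cannot reach another interval where the cosine is
    positive, so the angle stays there. *)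
Lemma lifted_right G e H lo hi p w :
  (forall a b, G a -> G b -> near e a b -> 0 < dot (p b) (p a)) ->
  (forall a, G a -> H <= snd a -> 0 < snd (p a)) ->
  (forall a, lo < fst a < hi -> 0 < fst (p a)) ->
  chain_up G e H lo hi w -> exists th, lifted_angle G e H p w th /\ Rabs th < PI / 2.
Proof.
  intros Hdot Htop Hx. induction 1 as [w Hw HwH Hb | w w' Hw Hb Hn Hc [th' [IH Hth']]].
  - pose proof (Hx w Hb) as Hpx. pose proof (Htop w Hw HwH) as Hp.
    assert (Href : polar (1, 0) 0).
    { exists 1. rewrite cos_0, sin_0. simpl. lra. }
    destruct (polar_next (1, 0) (p w) 0 Href) as [th [Hth Hd]].
    { unfold dot; simpl. lra. }
    rewrite Rminus_0_l, Rabs_Ropp in Hd.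
    exists th. split; auto. apply lifted_top; auto.
    apply (polar_upper (p w)); auto. apply Rabs_def2 in Hd. lra.
  - destruct (polar_next (p w') (p w) th') as [th [Hth Hd]].
    + apply (lifted_polar G e H). exact IH.
    + apply Hdot; auto. apply (chain_in _ _ _ _ _ _ Hc).
    + exists th. split.
      * apply lifted_step with w' th'; auto. rewrite Rabs_minus_sym; exact Hd.
      * apply (polar_right (p w)); auto.
        apply Rabs_def2 in Hd, Hth'. apply Rabs_def1; lra.
Qed.

Lemma lifted_left G e H lo hi p w :
  (forall a b, G a -> G b -> near e a b -> 0 < dot (p b) (p a)) ->
  (forall a, G a -> H <= snd a -> 0 < snd (p a)) ->
  (forall a, lo < fst a < hi -> fst (p a) < 0) ->
  chain_up G e H lo hi w -> exists th, lifted_angle G e H p w th /\ Rabs (th - PI) < PI / 2.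
Proof.
  intros Hdot Htop Hx. induction 1 as [w Hw HwH Hb | w w' Hw Hb Hn Hc [th' [IH Hth']]].
  - pose proof (Hx w Hb) as Hpx. pose proof (Htop w Hw HwH) as Hp.
    assert (Href : polar (-1, 0) PI).
    { exists 1. rewrite cos_PI, sin_PI. simpl. lra. }
    destruct (polar_next (-1, 0) (p w) PI Href) as [th [Hth Hd]].
    { unfold dot; simpl. lra. }
    rewrite Rabs_minus_sym in Hd.
    exists th. split; auto. apply lifted_top; auto.
    apply (polar_upper (p w)); auto. apply Rabs_def2 in Hd. lra.
  - destruct (polar_next (p w') (p w) th') as [th [Hth Hd]].
    + apply (lifted_polar G e H). exact IH.
    + apply Hdot; auto. apply (chain_in _ _ _ _ _ _ Hc).
    + exists th. split.
      * apply lifted_step with w' th'; auto. rewrite Rabs_minus_sym; exact Hd.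
      * apply (polar_left (p w)); auto.
        apply Rabs_def2 in Hd, Hth'. apply Rabs_def1; lra.
Qed.

(** The whole chain is moved at once: each angle is replaced by the nearest argument of the new
    vector. Neighbours stay within PI/2 by [polar_close], and the top vector is still in the upper
    half plane, so the normalisation survives. *)
Lemma lifted_move G e H p p' w th :
  (forall a b, G a -> G b -> near e a b -> 0 < dot (p' a) (p' b)) ->
  (forall a, G a -> H <= snd a -> 0 < snd (p' a)) ->
  (forall a, G a -> 0 < dot (p a) (p' a)) ->
  lifted_angle G e H p w th ->
  forall th', polar (p' w) th' -> Rabs (th - th') < PI / 2 -> lifted_angle G e H p' w th'.
Proof.
  intros Hdot Htop Hpp. induction 1 as [w th Hw HwH Hp Hth | w w1 th th1 Hw Hn Hp Hd Hl IH];
    intros th' Hp' Hd'.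
  - apply lifted_top; auto. apply (polar_upper (p' w)); auto.
    apply Rabs_def2 in Hd'. lra.
  - pose proof (lifted_in _ _ _ _ _ _ Hl) as Hw1.
    pose proof (lifted_polar _ _ _ _ _ _ Hl) as Hp1.
    destruct (polar_next (p w1) (p' w1) th1 Hp1 (Hpp w1 Hw1)) as [th1' [Hp1' Hd1]].
    apply lifted_step with w1 th1'; auto.
    apply (polar_close (p' w) (p' w1)); auto.
    apply Rabs_def2 in Hd, Hd', Hd1. apply Rabs_def1; lra.
Qed.

Lemma lifted_upper G e H p w th :
  (forall a, G a -> 0 < snd (p a)) -> lifted_angle G e H p w th -> 0 < th < PI.
Proof.
  intro Hpos. induction 1 as [w th Hw HwH Hp Hth | w w1 th th1 Hw Hn Hp Hd Hl IH]; auto.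
  apply (polar_upper (p w)); auto. apply Rabs_def2 in Hd. lra.
Qed.

Lemma lifted_image (G G' : R2 -> Prop) e e' H H' (f : R2 -> R2) p p' w th :
  (forall a, G a -> G' (f a)) ->
  (forall a b, G a -> G b -> near e a b -> near e' (f a) (f b)) ->
  (forall a, G a -> H <= snd a -> H' <= snd (f a)) ->
  (forall a, p' (f a) = p a) ->
  lifted_angle G e H p w th -> lifted_angle G' e' H' p' (f w) th.
Proof.
  intros HG He HH Hp. induction 1 as [w th Hw HwH Hpw Hth | w w1 th th1 Hw Hn Hpw Hd Hl IH].
  - apply lifted_top; auto. rewrite Hp; exact Hpw.
  - apply lifted_step with (f w1) th1; auto.
    + apply He; auto. apply (lifted_in _ _ _ _ _ _ Hl).
    + rewrite Hp; exact Hpw.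
Qed.

(** * Two points seen from each other *)

Definition from (z w : R2) : R2 := sub2 w z.

(* [E] plays the role of the points attached to the lower end, [G] of those attached to the upper
   end. *)
Definition separated (E G : R2 -> Prop) (d H : R) : Prop :=
  (forall z k, E z -> E (deck k z)) /\
  (forall z w, E z -> G w -> ~ near d z w) /\
  (forall z, E z -> snd z < H) /\ (forall w, G w -> - H < snd w).

Lemma from_far E G d H z w : separated E G d H -> E z -> G w -> far d (from z w).
Proof.
  intros [_ [Hsep _]] Hz Hw [H1 H2]. apply (Hsep z w Hz Hw).
  apply near_sym. split; assumption.
Qed.

Lemma from_dot E G d H e z :
  0 < d -> separated E G d H -> e <= d / 2 -> E z ->
  forall a b, G a -> G b -> near e a b -> 0 < dot (from z a) (from z b).
Proof.
  intros Hd Hs He Hz a b Ha Hb Hn. apply (dot_pos _ _ d); auto.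
  - apply (from_far E G d H); assumption.
  - apply near_le with (e := e); auto. destruct Hn as [H1 H2].
    split; simpl; [replace (_ - _) with (fst a - fst b) by ring
                  | replace (_ - _) with (snd a - snd b) by ring]; assumption.
Qed.

Lemma from_top E G d H z :
  separated E G d H -> E z -> forall a, G a -> H <= snd a -> 0 < snd (from z a).
Proof.
  intros [_ [_ [HE _]]] Hz a _ Ha. simpl. specialize (HE z Hz). lra.
Qed.

Definition unique_angle (G : R2 -> Prop) (e H : R) (z : R2) : Prop :=
  forall w th th', lifted_angle G e H (from z) w th -> lifted_angle G e H (from z) w th' -> th = th'.

(* Push the base point down to the lower end, where it sees all of [G] in the upper half plane. *)
Lemma unique_angle_chain E G d H e lo hi a :
  0 < d -> separated E G d H -> e <= d / 2 ->
  chain_up (fun b => E (opp2 b)) e H lo hi a -> unique_angle G e H (opp2 a).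
Proof.
  intros Hd Hs He. induction 1 as [a Ha HaH _ | a a' Ha _ Hn Hc IH]; intros w th th' Hl Hl'.
  - assert (Hup : forall b, G b -> 0 < snd (from (opp2 a) b)).
    { intros b Hb. destruct Hs as [_ [_ [_ HG]]]. specialize (HG b Hb). simpl. lra. }
    pose proof (lifted_upper _ _ _ _ _ _ Hup Hl).
    pose proof (lifted_upper _ _ _ _ _ _ Hup Hl').
    destruct (polar_unique _ _ _ (lifted_polar _ _ _ _ _ _ Hl) (lifted_polar _ _ _ _ _ _ Hl'))
      as [k Hk].
    assert (k = 0%Z); [| subst k; lra].
    pose proof PI_RGT_0.
    assert (-1 < IZR k < 1) by nra.
    apply one_IZR_lt1; lra.
  - destruct (chain_in _ _ _ _ _ _ Hc) as [Ha' _].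
    assert (Hmove : forall b, G b -> 0 < dot (from (opp2 a) b) (from (opp2 a') b)).
    { intros b Hb. apply (dot_pos _ _ d); auto.
      - apply (from_far E G d H); assumption.
      - apply near_le with (e := e); auto. destruct Hn as [H1 H2].
        split; simpl.
        + replace (_ - _) with (fst a - fst a') by ring. assumption.
        + replace (_ - _) with (snd a - snd a') by ring. assumption. }
    pose proof (lifted_in _ _ _ _ _ _ Hl) as Hw.
    pose proof (lifted_polar _ _ _ _ _ _ Hl) as Hp.
    (* Both angles are moved by the same amount, so their difference, a multiple of 2 PI, is
       unchanged along the chain and vanishes at its end. *)
    destruct (polar_unique _ _ _ Hp (lifted_polar _ _ _ _ _ _ Hl')) as [k ->].
    destruct (polar_next _ _ _ Hp (Hmove w Hw)) as [t [Ht Htd]].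
    assert (E1 : lifted_angle G e H (from (opp2 a')) w t).
    { apply (lifted_move G e H (from (opp2 a))) with th; auto.
      - apply (from_dot E G d H e); auto.
      - apply (from_top E G d H); auto. }
    assert (E2 : lifted_angle G e H (from (opp2 a')) w (t + 2 * PI * IZR k)).
    { apply (lifted_move G e H (from (opp2 a))) with (th + 2 * PI * IZR k); auto.
      - apply (from_dot E G d H e); auto.
      - apply (from_top E G d H); auto.
      - apply polar_shift; exact Ht.
      - replace (_ - _) with (th - t) by ring. exact Htd. }
    pose proof (IH w _ _ E1 E2). lra.
Qed.

(** What the angle argument uses of a lifted isotopy, in a form stable under the half turn. The
    third clause excludes all deck translates of [z], because separation is proved in the annulus,
    where they are the same point. *)
Definition tame_isotopy (Phi : R -> R2 -> R2) : Prop :=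
  (forall w, Phi 0 w = w) /\
  (forall H eta, 0 < eta -> exists e, 0 < e /\
     forall t t' w w', 0 <= t <= 1 -> 0 <= t' <= 1 -> Rabs (snd w) <= H ->
       near e w w' -> Rabs (t - t') < e -> near eta (Phi t w) (Phi t' w')) /\
  (forall H r z, 0 < r -> exists eta, 0 < eta /\
     forall t w, 0 <= t <= 1 -> Rabs (snd w) <= H ->
       (forall k, ~ near r (deck k z) w) -> ~ near eta (Phi t z) (Phi t w)) /\
  (forall H, exists M, forall t w, 0 <= t <= 1 ->
     (M <= snd w -> H <= snd (Phi t w)) /\ (snd w <= - M -> snd (Phi t w) <= - H)).

Lemma frac_bounds (j N : nat) : (1 <= N)%nat -> (j <= N)%nat -> 0 <= INR j / INR N <= 1.
Proof.
  intros HN Hj. apply le_INR in HN, Hj. simpl in HN. pose proof (pos_INR j).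
  split.
  - apply Rle_mult_inv_pos; lra.
  - apply (Rmult_le_reg_r (INR N)); [lra |]. field_simplify; lra.
Qed.

Lemma frac_step (e : R) : 0 < e -> exists N0, (1 <= N0)%nat /\ forall N j, (N0 <= N)%nat ->
  Rabs (INR j / INR N - INR (S j) / INR N) < e.
Proof.
  intro He. destruct (inv_INR_lt e He) as [n Hn].
  exists (S n). split; [lia |]. intros N j HN.
  apply le_INR in HN. rewrite S_INR in HN. pose proof (pos_INR n).
  rewrite S_INR. replace (_ - _) with (- / INR N) by (field; lra).
  rewrite Rabs_Ropp, Rabs_pos_eq.
  - apply Rle_lt_trans with (2 := Hn). apply Rinv_le_contravar; lra.
  - apply Rlt_le, Rinv_0_lt_compat; lra.
Qed.

Definition rel (Phi : R -> R2 -> R2) (z : R2) (t : R) (w : R2) : R2 := from (Phi t z) (Phi t w).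

(** A continuous argument of the vector from the orbit of [z] to that of [w], sampled at the times
    [j / N]. *)
Definition angle_path (Phi : R -> R2 -> R2) (z w : R2) (N : nat) (th : nat -> R) : Prop :=
  (forall j, (j <= N)%nat -> polar (rel Phi z (INR j / INR N) w) (th j)) /\
  (forall j, (j < N)%nat -> Rabs (th j - th (S j)) < PI / 2).

Lemma not_near_far (eta : R) (a b : R2) : ~ near eta a b -> far eta (from a b).
Proof. intros Hn [H1 H2]. apply Hn. apply near_sym. split; assumption. Qed.

Lemma rel_far Phi E G d H z M :
  tame_isotopy Phi -> 0 < d -> separated E G d H -> E z ->
  exists eta, 0 < eta /\ forall t w, 0 <= t <= 1 -> G w -> snd w < M -> far eta (rel Phi z t w).
Proof.
  intros [_ [_ [Hsep _]]] Hd [Hk [Hs [_ HG]]] Hz.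
  destruct (Hsep (Rabs M + Rabs H) d z Hd) as [eta [Heta Hfar]].
  exists eta. split; auto. intros t w Ht Hw HM.
  apply not_near_far. apply Hfar; auto.
  specialize (HG w Hw). pose proof (Rle_abs M). pose proof (Rle_abs H).
  pose proof (Rabs_pos M). pose proof (Rabs_pos H).
  apply Rabs_le; lra.
Qed.

Lemma near_from (e e' : R) (a a' b b' : R2) :
  near e a a' -> near e' b b' -> near (e + e') (from a b) (from a' b').
Proof.
  intros [H1 H2] [H3 H4]. apply Rabs_def2 in H1, H2, H3, H4.
  split; simpl; apply Rabs_def1; lra.
Qed.

(** One subdivision of time suits all points of [G] below [M], so that all the points of a chain can
    be moved together. *)
Lemma rel_time_dot Phi E G d H z M :
  tame_isotopy Phi -> 0 < d -> separated E G d H -> E z ->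
  exists N0, (1 <= N0)%nat /\ forall N j w, (N0 <= N)%nat -> (j < N)%nat -> G w -> snd w < M ->
    0 < dot (rel Phi z (INR j / INR N) w) (rel Phi z (INR (S j) / INR N) w).
Proof.
  intros HPhi Hd Hs Hz.
  destruct (rel_far Phi E G d H z M HPhi Hd Hs Hz) as [eta [Heta Hfar]].
  destruct HPhi as [_ [Hc _]].
  destruct (Hc (Rmax (Rabs (snd z)) (Rabs M + Rabs H)) (eta / 4)) as [e [He Hcont]]; [lra |].
  destruct (frac_step e He) as [N0 [HN0 Hstep]].
  exists N0. split; auto. intros N j w HN Hj Hw HM.
  apply (dot_pos _ _ eta); auto.
  - apply Hfar; auto. apply frac_bounds; lia.
  - apply near_le with (eta / 4 + eta / 4); [lra |].
    apply near_from; apply Hcont; try (apply frac_bounds; lia); auto using near_refl.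
    + apply Rmax_l.
    + apply Rle_trans with (2 := Rmax_r _ _).
      destruct Hs as [_ [_ [_ HG]]]. specialize (HG w Hw).
      pose proof (Rle_abs M). pose proof (Rle_abs H).
      pose proof (Rabs_pos M). pose proof (Rabs_pos H). apply Rabs_le; lra.
Qed.

Lemma angle_path_exists Phi E G d H z w :
  tame_isotopy Phi -> 0 < d -> separated E G d H -> E z -> G w ->
  exists N0, (1 <= N0)%nat /\ forall N th0, (N0 <= N)%nat -> polar (from z w) th0 ->
    exists th, angle_path Phi z w N th /\ th 0%nat = th0.
Proof.
  intros HPhi Hd Hs Hz Hw.
  destruct (rel_time_dot Phi E G d H z (snd w + 1) HPhi Hd Hs Hz) as [N0 [HN0 Hdot]].
  exists N0. split; auto. intros N th0 HN Hth0.
  assert (Hind : forall m, (m <= N)%nat -> exists th : nat -> R,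
    (forall j, (j <= m)%nat -> polar (rel Phi z (INR j / INR N) w) (th j)) /\
    (forall j, (j < m)%nat -> Rabs (th j - th (S j)) < PI / 2) /\ th 0%nat = th0).
  { induction m as [| m IH]; intro Hm.
    - exists (fun _ => th0). repeat split; auto; [| intros; lia].
      intros j Hj. replace j with 0%nat by lia. unfold rel. simpl.
      unfold Rdiv; rewrite Rmult_0_l. destruct HPhi as [H0 _]. rewrite !H0. exact Hth0.
    - destruct IH as [th [Hp [Hst H0]]]; [lia |].
      destruct (polar_next _ _ _ (Hp m ltac:(lia)) (Hdot N m w HN ltac:(lia) Hw ltac:(lra)))
        as [t [Ht Htd]].
      exists (fun j => if (j <=? m)%nat then th j else t). repeat split.
      + intros j Hj. destruct (Nat.leb_spec j m); [apply Hp; lia |].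
        replace j with (S m) by lia. exact Ht.
      + intros j Hj. destruct (Nat.leb_spec j m); [| lia].
        destruct (Nat.leb_spec (S j) m); [apply Hst; lia |].
        replace j with m by lia. exact Htd.
      + simpl. exact H0. }
  destruct (Hind N (le_n N)) as [th [Hp [Hst H0]]].
  exists th. split; auto. split; assumption.
Qed.

Lemma orbit_height_bounded Phi z :
  tame_isotopy Phi -> exists M, forall t, 0 <= t <= 1 -> snd (Phi t z) <= M.
Proof.
  intros [_ [Hc _]].
  destruct (compact_interval (fun t n => snd (Phi t z) <= INR n) 0 1) as [n Hn].
  - intros t m n Hmn Ht. apply le_INR in Hmn. lra.
  - intros t0 Ht0. destruct (Hc (Rabs (snd z)) 1 ltac:(lra)) as [e [He Hcont]].
    destruct (INR_archimed 1 (snd (Phi t0 z) + 1) ltac:(lra)) as [n Hn].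
    exists e, n. split; auto. intros t Ht Htt.
    destruct (Hcont t t0 z z) as [_ Hy]; auto using near_refl; [lra |].
    apply Rabs_def2 in Hy. lra.
  - exists (INR n). exact Hn.
Qed.

Definition reaches_up (G : R2 -> Prop) (w : R2) : Prop :=
  forall e H, 0 < e -> exists lo hi, chain_up G e H lo hi w.

(* The angle of [w] seen from [z], continued along the isotopy, is again the one normalised at
   the upper end, because the isotopy carries chains of [G] to chains of [G]. *)
Lemma lifted_transport Phi E G d H e z w :
  tame_isotopy Phi -> 0 < d -> separated E G d H -> 0 < e <= d / 2 ->
  (forall a, G a -> G (Phi 1 a)) -> E z -> reaches_up G w -> unique_angle G e H z ->
  exists N0, (1 <= N0)%nat /\ forall N th, (N0 <= N)%nat -> angle_path Phi z w N th ->
    lifted_angle G e H (from z) w (th 0%nat) ->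
    lifted_angle G e H (from (Phi 1 z)) (Phi 1 w) (th N).
Proof.
  intros HPhi Hd Hs He HG Hz Hw Huniq.
  destruct (orbit_height_bounded Phi z HPhi) as [Mz HMz].
  pose proof HPhi as [Hid [Hc [Hsep Hend]]].
  destruct (Hend (Rmax (Mz + 1) H)) as [M HM].
  set (T := Rmax (Rmax M H) (snd w)).
  assert (HT : M <= T /\ H <= T /\ snd w <= T).
  { unfold T. pose proof (Rmax_l M H). pose proof (Rmax_r M H).
    pose proof (Rmax_l (Rmax M H) (snd w)). pose proof (Rmax_r (Rmax M H) (snd w)). lra. }
  destruct (rel_far Phi E G d H z (T + 1) HPhi Hd Hs Hz) as [eta [Heta Hfar]].
  destruct (rel_time_dot Phi E G d H z (T + 1) HPhi Hd Hs Hz) as [N0 [HN0 Hdot]].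
  destruct (Hc (Rabs T + 1 + Rabs H) (Rmin (eta / 2) e)) as [e' [He' Hcont]].
  { apply Rmin_pos; lra. }
  (* At most 1 for the truncation, at most [e'] so that chain steps stay small at every time, and at
     most [e] so that the fine chain can be compared with those of [unique_angle]. *)
  set (e1 := Rmin 1 (Rmin e' e)).
  assert (He1 : 0 < e1 /\ e1 <= 1 /\ e1 <= e' /\ e1 <= e).
  { unfold e1. pose proof (Rmin_l 1 (Rmin e' e)). pose proof (Rmin_r 1 (Rmin e' e)).
    pose proof (Rmin_l e' e). pose proof (Rmin_r e' e).
    split; [apply Rmin_pos; [lra | apply Rmin_pos; lra] | lra]. }
  exists N0. split; auto. intros N th HN [Hpol Hstep] Hl.
  set (G' := fun a => G a /\ snd a < T + 1).
  assert (HG'h : forall a, G' a -> Rabs (snd a) <= Rabs T + 1 + Rabs H).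
  { intros a [Ha HaT]. destruct Hs as [_ [_ [_ Hlow]]]. specialize (Hlow a Ha).
    pose proof (Rle_abs T). pose proof (Rle_abs H).
    pose proof (Rabs_pos T). pose proof (Rabs_pos H). apply Rabs_le; lra. }
  destruct (Hw e1 T) as [lo [hi Hchain]]; [lra |].
  apply chain_up_truncate in Hchain; [| lra | lra]. fold G' in Hchain.
  assert (Hadj : forall t, 0 <= t <= 1 -> forall a b, G' a -> G' b -> near e1 a b ->
    0 < dot (rel Phi z t a) (rel Phi z t b)).
  { intros t Ht a b Ha Hb Hn. apply (dot_pos _ _ eta); auto; [apply Hfar; auto; apply Ha |].
    assert (near (Rmin (eta / 2) e) (Phi t a) (Phi t b)).
    { apply Hcont; auto; [apply near_le with e1; auto; lra |].
      rewrite Rminus_diag, Rabs_R0; lra. }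
    apply near_le with (e' := eta / 2) in H0; [| apply Rmin_l].
    destruct H0 as [Hx Hy]. split; unfold rel; simpl.
    - replace (_ - _) with (fst (Phi t a) - fst (Phi t b)) by ring. exact Hx.
    - replace (_ - _) with (snd (Phi t a) - snd (Phi t b)) by ring. exact Hy. }
  assert (Htop : forall t, 0 <= t <= 1 -> forall a, G' a -> T <= snd a -> 0 < snd (rel Phi z t a)).
  { intros t Ht a _ Ha. unfold rel; simpl. specialize (HMz t Ht).
    destruct (HM t a Ht) as [HMa _]. specialize (HMa ltac:(lra)).
    pose proof (Rmax_l (Mz + 1) H). lra. }
  assert (Hrel0 : forall a, rel Phi z 0 a = from z a) by (intro a; unfold rel; now rewrite !Hid).
  assert (H0 : lifted_angle G' e1 T (rel Phi z (INR 0 / INR N)) w (th 0%nat)).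
  { replace (INR 0 / INR N) with 0 by (simpl; unfold Rdiv; ring).
    destruct (chain_up_lifted G' e1 T lo hi (rel Phi z 0) w) as [t0 Ht0]; auto.
    { intros a b Ha Hb Hn. apply Hadj; auto; [lra | apply near_sym; exact Hn]. }
    { apply Htop; lra. }
    (* A priori the fine chain yields another angle than the given one; [unique_angle] identifies
       them. *)
    replace (th 0%nat) with t0; auto.
    apply (Huniq w); auto.
    replace w with ((fun x : R2 => x) w) by reflexivity.
    apply (lifted_image G' G e1 e T H (fun a => a) (rel Phi z 0)); auto.
    - intros a Ha; apply Ha.
    - intros a b _ _ Hn. apply near_le with e1; auto; lra.
    - intros a _ Ha; lra. }
  assert (Hj : forall j, (j <= N)%nat -> lifted_angle G' e1 T (rel Phi z (INR j / INR N)) w (th j)).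
  { induction j as [| j IH]; intro Hj; auto.
    apply (lifted_move G' e1 T (rel Phi z (INR j / INR N))) with (th j); auto.
    - apply Hadj. apply frac_bounds; lia.
    - apply Htop. apply frac_bounds; lia.
    - intros a [Ha HaT]. apply Hdot; auto; lia.
    - apply IH; lia. }
  specialize (Hj N (le_n N)).
  replace (INR N / INR N) with 1 in Hj.
  2: { field. apply not_0_INR. lia. }
  apply (lifted_image G' G e1 e T H (Phi 1) (rel Phi z 1)); auto.
  - intros a Ha. apply HG. apply Ha.
  - intros a b Ha Hb Hn. apply near_le with (Rmin (eta / 2) e); [apply Rmin_r |].
    apply Hcont; auto; try lra; [apply near_le with e1; auto; lra |].
    rewrite Rminus_diag, Rabs_R0; lra.
  - intros a _ Ha. destruct (HM 1 a ltac:(lra)) as [HMa _]. specialize (HMa ltac:(lra)).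
    pose proof (Rmax_r (Mz + 1) H). lra.
Qed.

Lemma from_opp (a b : R2) : from a b = opp2 (from b a).
Proof. unfold from, sub2, opp2; simpl; f_equal; ring. Qed.

(** The vector from [w] to [z] is opposite to the one from [z] to [w], so [c] is PI modulo 2 PI and
    one path of angles, shifted by [c], serves both points. Hence the two normalised angles vary by
    the same amount. *)
Lemma angle_path_swap Phi z w N th c :
  angle_path Phi z w N th -> polar (rel Phi w 0 z) (th 0%nat + c) -> (1 <= N)%nat ->
  angle_path Phi w z N (fun j => th j + c).
Proof.
  intros [Hp Hs] Hc HN.
  assert (Hcp : exists k, c = PI + 2 * PI * IZR k).
  { pose proof (Hp 0%nat ltac:(lia)) as H0. simpl in H0.
    replace (0 / INR N) with 0 in H0 by (unfold Rdiv; ring).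
    apply polar_opp in H0. unfold rel in *. rewrite <- from_opp in H0.
    destruct (polar_unique _ _ _ H0 Hc) as [k Hk]. exists k. lra. }
  destruct Hcp as [k ->]. split.
  - intros j Hj. specialize (Hp j Hj). apply polar_opp in Hp. unfold rel in *.
    rewrite <- from_opp in Hp. rewrite <- Rplus_assoc. apply polar_shift. exact Hp.
  - intros j Hj. replace (_ - _) with (th j - th (S j)) by ring. auto.
Qed.

Section TwoOrbits.

Variables (Phi : R -> R2 -> R2) (E G E' G' : R2 -> Prop) (d H e W : R) (z w : R2).

Let f := Phi 1.
Let zn n := Nat.iter n f z.
Let wn n := Nat.iter n f w.

(* The lifted angles of [w_n] seen from [z_n] (normalised at the upper end) and of [z_n] seen from
   [w_n] have a difference independent of [n], which is incompatible with [w_n] overtaking [z_n]. *)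
Lemma no_overtaking_up (n : nat) :
  tame_isotopy Phi -> 0 < d -> 0 < e <= d / 2 -> separated E G d H -> separated E' G' d H ->
  (forall a, G a -> G (f a)) -> (forall a, G' a -> G' (f a)) ->
  (forall i, E (zn i) /\ G (wn i) /\ E' (wn i) /\ G' (zn i)) ->
  (forall i, reaches_up G (wn i) /\ reaches_up G' (zn i) /\
     reaches_up (fun a => E (opp2 a)) (opp2 (zn i)) /\
     reaches_up (fun a => E' (opp2 a)) (opp2 (wn i))) ->
  (forall i, chain_up G e H (fst (wn i) - W) (fst (wn i) + W) (wn i) /\
     chain_up G' e H (fst (zn i) - W) (fst (zn i) + W) (zn i)) ->
  fst w - fst z < - W -> W < fst (wn n) - fst (zn n) -> False.
Proof.
  intros HPhi Hd He Hs Hs' HG HG' Hin Hreach Hwid H0 Hn.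
  assert (HW : 0 < W).
  { destruct (Hwid 0%nat) as [Hc _]. apply chain_in in Hc. lra. }
  assert (Hu : forall i, unique_angle G e H (zn i) /\ unique_angle G' e H (wn i)).
  { intro i. destruct (Hreach i) as [_ [_ [R1 R2]]].
    destruct (R1 e H ltac:(lra)) as [lo [hi C1]]. destruct (R2 e H ltac:(lra)) as [lo' [hi' C2]].
    assert (Hoo : forall a, opp2 (opp2 a) = a).
    { intros [a b]; unfold opp2; simpl; f_equal; ring. }
    split.
    - rewrite <- (Hoo (zn i)). apply (unique_angle_chain E G d H e lo hi); auto; lra.
    - rewrite <- (Hoo (wn i)). apply (unique_angle_chain E' G' d H e lo' hi'); auto; lra. }
  assert (Hdot : forall i a b, G a -> G b -> near e a b -> 0 < dot (from (zn i) b) (from (zn i) a)).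
  { intros i a b Ha Hb Hab. apply (from_dot E G d H e); auto; [lra | apply Hin |].
    apply near_sym; exact Hab. }
  assert (Hdot' : forall i a b, G' a -> G' b -> near e a b -> 0 < dot (from (wn i) b) (from (wn i) a)).
  { intros i a b Ha Hb Hab. apply (from_dot E' G' d H e); auto; [lra | apply Hin |].
    apply near_sym; exact Hab. }
  assert (Htop : forall i a, G a -> H <= snd a -> 0 < snd (from (zn i) a)).
  { intro i. apply (from_top E G d H); auto. apply Hin. }
  assert (Htop' : forall i a, G' a -> H <= snd a -> 0 < snd (from (wn i) a)).
  { intro i. apply (from_top E' G' d H); auto. apply Hin. }
  (* At the start [w] is far to the left: its angle [th] from [z] is within PI/2 of PI, and the
     angle [th'] of [z] from [w] is within PI/2 of 0. *)
  destruct (lifted_left G e H (fst w - W) (fst w + W) (from z) w) as [th [Hth Hthv]].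
  { apply (Hdot 0%nat). } { apply (Htop 0%nat). }
  { intros a Ha; simpl; lra. } { apply (Hwid 0%nat). }
  destruct (lifted_right G' e H (fst z - W) (fst z + W) (from w) z) as [th' [Hth' Hthv']].
  { apply (Hdot' 0%nat). } { apply (Htop' 0%nat). }
  { intros a Ha; simpl; lra. } { apply (Hwid 0%nat). }
  assert (Hinv : forall i, exists t, lifted_angle G e H (from (zn i)) (wn i) t /\
    lifted_angle G' e H (from (wn i)) (zn i) (t + (th' - th))).
  { induction i as [| i [t [Ht Ht']]].
    - exists th. split; auto. replace (th + _) with th' by ring. exact Hth'.
    - destruct (Hin i) as [EZ [GW [EW GZ]]]. destruct (Hreach i) as [RW [RZ _]].
      destruct (Hu i) as [U U'].
      destruct (angle_path_exists Phi E G d H (zn i) (wn i)) as [N1 [HN1 Hpath]]; auto.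
      destruct (lifted_transport Phi E G d H e (zn i) (wn i)) as [N2 [HN2 Htr]]; auto.
      destruct (lifted_transport Phi E' G' d H e (wn i) (zn i)) as [N3 [HN3 Htr']]; auto.
      set (N := (N1 + N2 + N3)%nat).
      destruct (Hpath N t) as [ph [Hph Hph0]]; [unfold N; lia | |].
      { apply (lifted_polar _ _ _ _ _ _ Ht). }
      exists (ph N). split.
      + apply (Htr N); auto; [unfold N; lia |]. rewrite Hph0. exact Ht.
      + apply (Htr' N (fun j => ph j + (th' - th))); [unfold N; lia | |].
        * apply angle_path_swap; auto; [| unfold N; lia].
          rewrite Hph0. unfold rel. destruct HPhi as [Hid _]. rewrite !Hid.
          apply (lifted_polar _ _ _ _ _ _ Ht').
        * simpl. rewrite Hph0. exact Ht'. }
  destruct (Hinv n) as [t [Ht Ht']].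
  destruct (lifted_right G e H (fst (wn n) - W) (fst (wn n) + W) (from (zn n)) (wn n))
    as [u [Hul Huv]]; auto.
  { intros a Ha; simpl; lra. } { apply Hwid. }
  destruct (lifted_left G' e H (fst (zn n) - W) (fst (zn n) + W) (from (wn n)) (zn n))
    as [u' [Hul' Huv']]; auto.
  { intros a Ha; simpl; lra. } { apply Hwid. }
  destruct (Hu n) as [U U'].
  pose proof (U _ _ _ Ht Hul). pose proof (U' _ _ _ Ht' Hul').
  (* At time [n] the values 0 and PI are exchanged. The invariant difference lies in (-2 PI, 0) by
     the situation at the start and in (0, 2 PI) by the situation at time [n]. *)
  apply Rabs_def2 in Hthv, Hthv', Huv, Huv'. lra.
Qed.

End TwoOrbits.

(** * The half turn of the plane *)

Lemma opp2_opp2 (a : R2) : opp2 (opp2 a) = a.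
Proof. destruct a; unfold opp2; simpl; f_equal; ring. Qed.

Lemma near_opp2 (e : R) (a b : R2) : near e a b -> near e (opp2 a) (opp2 b).
Proof.
  intros [H1 H2]; split; simpl; rewrite Rabs_minus_sym;
    [replace (_ - _) with (fst a - fst b) by ring | replace (_ - _) with (snd a - snd b) by ring];
    assumption.
Qed.

Lemma deck_opp2 (k : Z) (a : R2) : opp2 (deck k a) = deck (- k) (opp2 a).
Proof. unfold opp2, deck; simpl. rewrite opp_IZR. f_equal; ring. Qed.

Lemma tame_isotopy_opp Phi : tame_isotopy Phi -> tame_isotopy (fun t a => opp2 (Phi t (opp2 a))).
Proof.
  intros [Hid [Hc [Hsep Hend]]]. repeat split.
  - intro w. rewrite Hid. apply opp2_opp2.
  - intros H eta Heta. destruct (Hc H eta Heta) as [e [He Hcont]].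
    exists e. split; auto. intros t t' w w' Ht Ht' Hw Hn Htt.
    apply near_opp2. apply Hcont; auto; [| apply near_opp2; exact Hn].
    simpl. rewrite Rabs_Ropp. exact Hw.
  - intros H r z Hr. destruct (Hsep H r (opp2 z) Hr) as [eta [Heta Hfar]].
    exists eta. split; auto. intros t w Ht Hw Hk Hn.
    apply (Hfar t (opp2 w) Ht).
    + simpl. rewrite Rabs_Ropp. exact Hw.
    + intros k Hnk. apply (Hk (- k)%Z). apply near_opp2 in Hnk.
      rewrite deck_opp2, !opp2_opp2 in Hnk. exact Hnk.
    + apply near_opp2 in Hn. rewrite !opp2_opp2 in Hn. exact Hn.
  - intro H. destruct (Hend H) as [M HM]. exists M. intros t w Ht.
    destruct (HM t (opp2 w) Ht) as [H1 H2]. simpl in *. split; intro; [assert (snd (Phi t (opp2 w)) <= - H) by (apply H2; lra) | assert (H <= snd (Phi t (opp2 w))) by (apply H1; lra)]; lra.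
Qed.

Lemma iter_opp2 (f : R2 -> R2) (n : nat) (a : R2) :
  Nat.iter n (fun b => opp2 (f (opp2 b))) (opp2 a) = opp2 (Nat.iter n f a).
Proof.
  induction n as [| n IH]; simpl; auto. rewrite IH, opp2_opp2. reflexivity.
Qed.

Lemma separated_opp E G d H :
  separated E G d H -> (forall w k, G w -> G (deck k w)) ->
  separated (fun a => G (opp2 a)) (fun a => E (opp2 a)) d H.
Proof.
  intros [Hk [Hs [HE HG]]] HGk. repeat split.
  - intros z k Hz. rewrite deck_opp2. auto.
  - intros z w Hz Hw Hn. apply (Hs (opp2 w) (opp2 z)); auto.
    apply near_opp2, near_sym. exact Hn.
  - intros z Hz. specialize (HG _ Hz). simpl in HG. lra.
  - intros w Hw. specialize (HE _ Hw). simpl in HE. lra.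
Qed.

Lemma reaches_up_sub (G G' : R2 -> Prop) (w : R2) :
  (forall a, G a -> G' a) -> reaches_up G w -> reaches_up G' w.
Proof.
  intros HG Hw e H He. destruct (Hw e H He) as [lo [hi Hc]]. exists lo, hi.
  apply (chain_up_sub G G' e e H H lo hi lo hi); auto; lra.
Qed.

(* The half turn of the plane exchanges the two ends and keeps the difference vector when the two
   points are also exchanged. *)
Lemma no_overtaking_down (Phi : R -> R2 -> R2) (E G E' G' : R2 -> Prop) (d H e W : R) (z w : R2)
    (n : nat) :
  let zn i := Nat.iter i (Phi 1) z in
  let wn i := Nat.iter i (Phi 1) w in
  tame_isotopy Phi -> 0 < d -> 0 < e <= d / 2 -> separated E G d H -> separated E' G' d H ->
  (forall a k, G a -> G (deck k a)) -> (forall a k, G' a -> G' (deck k a)) ->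
  (forall a, E a -> E (Phi 1 a)) -> (forall a, E' a -> E' (Phi 1 a)) ->
  (forall i, E (zn i) /\ G (wn i) /\ E' (wn i) /\ G' (zn i)) ->
  (forall i, reaches_up G (wn i) /\ reaches_up G' (zn i) /\
     reaches_up (fun a => E (opp2 a)) (opp2 (zn i)) /\
     reaches_up (fun a => E' (opp2 a)) (opp2 (wn i))) ->
  (forall i, chain_up (fun a => E (opp2 a)) e H (- fst (zn i) - W) (- fst (zn i) + W) (opp2 (zn i)) /\
     chain_up (fun a => E' (opp2 a)) e H (- fst (wn i) - W) (- fst (wn i) + W) (opp2 (wn i))) ->
  fst w - fst z < - W -> W < fst (wn n) - fst (zn n) -> False.
Proof.
  intros zn wn HPhi Hd He Hs Hs' HGk HGk' HE HE' Hin Hreach Hwid H0 Hn.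
  apply (no_overtaking_up (fun t a => opp2 (Phi t (opp2 a)))
    (fun a => G (opp2 a)) (fun a => E (opp2 a)) (fun a => G' (opp2 a)) (fun a => E' (opp2 a))
    d H e W (opp2 w) (opp2 z) n); auto.
  - apply tame_isotopy_opp; exact HPhi.
  - apply separated_opp; auto.
  - apply separated_opp; auto.
  - intros a Ha. rewrite opp2_opp2. auto.
  - intros a Ha. rewrite opp2_opp2. auto.
  - intro i. cbv beta. rewrite !iter_opp2, !opp2_opp2. destruct (Hin i) as [? [? [? ?]]]. auto.
  - intro i. cbv beta. rewrite !iter_opp2, !opp2_opp2.
    destruct (Hreach i) as [? [? [? ?]]]. repeat split; auto.
    + apply (reaches_up_sub G); auto. intros a Ha. rewrite opp2_opp2. exact Ha.
    + apply (reaches_up_sub G'); auto. intros a Ha. rewrite opp2_opp2. exact Ha.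
  - intro i. cbv beta. rewrite !iter_opp2. simpl fst. apply Hwid.
  - simpl. lra.
  - rewrite !iter_opp2. simpl. fold (zn n) (wn n). lra.
Qed.

(** * Isotopies and their lifts *)

Definition cont_on (b : R) (u : R -> R) : Prop :=
  forall t eps, 0 <= t <= b -> 0 < eps -> exists r, 0 < r /\
    forall s, 0 <= s <= b -> Rabs (s - t) < r -> Rabs (u s - u t) < eps.

Lemma never_cross (b : R) (u : R -> R) (c : R) :
  0 <= b -> cont_on b u -> (forall t, 0 <= t <= b -> u t <> c) -> u 0 < c -> u b < c.
Proof.
  intros Hb Hu Hc H0.
  apply (interval_induction 0 b (fun t => u t < c)); auto.
  intros t Ht. destruct (Hu t (Rabs (u t - c)) Ht) as [r [Hr Hs]].
  { apply Rabs_pos_lt. specialize (Hc t Ht). lra. }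
  exists r. split; auto. intros s s' Hs1 Hs2 H1 H2 Hlt.
  specialize (Hs s ltac:(lra) ltac:(apply Rabs_def1; lra)) as Ha.
  specialize (Hs s' ltac:(lra) ltac:(apply Rabs_def1; lra)) as Hb'.
  apply Rabs_def2 in Ha, Hb'. unfold Rabs in *. destruct (Rcase_abs (u t - c)); lra.
Qed.

Lemma integer_valued_constant (b : R) (u : R -> R) :
  0 <= b -> cont_on b u -> (forall t, 0 <= t <= b -> exists k : Z, u t = IZR k) -> u b = u 0.
Proof.
  intros Hb Hu Hk.
  apply (interval_induction 0 b (fun t => u t = u 0)); auto.
  intros t Ht. destruct (Hu t (1 / 2) Ht ltac:(lra)) as [r [Hr Hs]].
  exists r. split; auto. intros s s' Hs1 Hs2 H1 H2 Heq. rewrite <- Heq.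
  specialize (Hs s ltac:(lra) ltac:(apply Rabs_def1; lra)) as Ha.
  specialize (Hs s' ltac:(lra) ltac:(apply Rabs_def1; lra)) as Hb'.
  destruct (Hk s ltac:(lra)) as [k E]. destruct (Hk s' ltac:(lra)) as [k' E'].
  apply Rabs_def2 in Ha, Hb'. rewrite E, E' in *.
  assert (Hkk : (k' - k)%Z = 0%Z).
  { apply one_IZR_lt1. rewrite minus_IZR. lra. }
  f_equal. lia.
Qed.

Definition seg (a b : R2) (s : R) : R2 :=
  (fst a + s * (fst b - fst a), snd a + s * (snd b - snd a)).

Lemma seg_0 a b : seg a b 0 = a.
Proof. destruct a; unfold seg; simpl; f_equal; ring. Qed.

Lemma seg_1 a b : seg a b 1 = b.
Proof. destruct b; unfold seg; simpl; f_equal; ring. Qed.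

Lemma seg_cont a b e : 0 < e -> exists r, 0 < r /\
  forall s s', Rabs (s - s') < r -> near e (seg a b s) (seg a b s').
Proof.
  intro He. set (L := Rabs (fst b - fst a) + Rabs (snd b - snd a) + 1).
  pose proof (Rabs_pos (fst b - fst a)). pose proof (Rabs_pos (snd b - snd a)).
  assert (HL : 0 < L) by (unfold L; lra).
  exists (e / L). split; [apply Rdiv_lt_0_compat; auto |].
  intros s s' Hs.
  assert (HsL : Rabs (s - s') * L < e).
  { apply (Rmult_lt_compat_r L) in Hs; auto. replace (e / L * L) with e in Hs by (field; lra). exact Hs. }
  pose proof (Rabs_pos (s - s')).
  split; simpl.
  - replace (_ - _) with ((s - s') * (fst b - fst a)) by ring.
    rewrite Rabs_mult. unfold L in HsL. nra.
  - replace (_ - _) with ((s - s') * (snd b - snd a)) by ring.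
    rewrite Rabs_mult. unfold L in HsL. nra.
Qed.

Lemma seg_height a b s H : 0 <= s <= 1 -> Rabs (snd a) <= H -> Rabs (snd b) <= H ->
  Rabs (snd (seg a b s)) <= H.
Proof.
  intros Hs Ha Hb. apply Rabs_bounds in Ha, Hb. simpl. apply Rabs_le.
  pose proof (Rmult_le_pos s (H - snd b) ltac:(lra) ltac:(lra)).
  pose proof (Rmult_le_pos s (H + snd b) ltac:(lra) ltac:(lra)).
  pose proof (Rmult_le_pos (1 - s) (H - snd a) ltac:(lra) ltac:(lra)).
  pose proof (Rmult_le_pos (1 - s) (H + snd a) ltac:(lra) ltac:(lra)). lra.
Qed.

Lemma distA_0_eq (x y : Ann) : distA x y = 0 -> x = y.
Proof.
  intro Hd. apply ann_eq.
  destruct x as [[[a b] c] Hx], y as [[[a' b'] c'] Hy]. unfold distA in Hd; simpl in *.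
  pose proof (pow2_ge_0 (a - a')). pose proof (pow2_ge_0 (b - b')). pose proof (pow2_ge_0 (c - c')).
  assert (Hd' : (a - a') ^ 2 + (b - b') ^ 2 + (c - c') ^ 2 = 0) by (apply sqrt_eq_0; [lra | exact Hd]).
  assert (Hz : forall u, u ^ 2 = 0 -> u = 0) by (intros u Hu; apply NNPP; intro Hn; apply (pow_nonzero u 2 Hn Hu)).
  pose proof (Hz (a - a') ltac:(lra)). pose proof (Hz (b - b') ltac:(lra)).
  pose proof (Hz (c - c') ltac:(lra)).
  repeat f_equal; lra.
Qed.

Lemma distA_pos (x y : Ann) : 0 <= distA x y.
Proof.
  destruct x as [[[a b] c] Hx], y as [[[a' b'] c'] Hy]. apply sqrt_pos.
Qed.

Lemma Rabs_hA_dist (x y : Ann) : Rabs (Rabs (hA x) - Rabs (hA y)) <= distA x y.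
Proof. eapply Rle_trans; [apply Rabs_triang_inv2 | apply hA_dist]. Qed.

Lemma continuousA_height_bounded (h : Ann -> Ann) (H : R) :
  continuousA h -> exists M, forall x, Rabs (hA x) <= H -> Rabs (hA (h x)) <= M.
Proof.
  intro Hc.
  destruct (compact_annulus (fun x n => Rabs (hA (h x)) <= INR n) H) as [n Hn].
  - intros x m n Hmn Hx. apply le_INR in Hmn. lra.
  - intro x0. destruct (Hc x0 1 ltac:(lra)) as [r [Hr Hx]].
    destruct (INR_archimed 1 (Rabs (hA (h x0)) + 1) ltac:(lra)) as [n Hn].
    exists r, n. split; auto. intros x Hd. specialize (Hx x Hd).
    pose proof (Rabs_hA_dist (h x0) (h x)) as Hh. apply Rabs_bounds in Hh. lra.
  - exists (INR n). exact Hn.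
Qed.

(* For [t] near [t0], the preimage under [F t] of a band is connected, avoids two far circles and
   meets the band between them. *)
Lemma isotopy_proper (F : R -> Ann -> Ann) (H : R) :
  isotopy F -> exists M, forall t x, 0 <= t <= 1 -> Rabs (hA (F t x)) <= H -> Rabs (hA x) <= M.
Proof.
  intros [_ [Hhom Hcont]].
  (* At least 1, so that the band contains [F t x1] for [t] near [t0], where [F t0 x1] has height
     0. *)
  set (H1 := Rmax H 1).
  assert (HH1 : H <= H1 /\ 1 <= H1) by (unfold H1; split; [apply Rmax_l | apply Rmax_r]).
  destruct (compact_interval
    (fun t n => forall x, Rabs (hA (F t x)) <= H1 -> Rabs (hA x) <= INR n) 0 1) as [n Hn].
  - intros t m n Hmn Ht x Hx. apply le_INR in Hmn. specialize (Ht x Hx). lra.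
  - intros t0 Ht0. destruct (Hhom t0 Ht0) as [g [Hgl [Hgr [_ Hgc]]]].
    destruct (continuousA_height_bounded g H1 Hgc) as [M HM].
    (* The circles of height [R1] and [- R1] miss the preimage of the band under [F t0], hence under
       [F t] for [t] near [t0]. *)
    set (R1 := M + 1).
    destruct (compact_annulus (fun x n => Rabs (hA x) = R1 -> forall t, 0 <= t <= 1 ->
      Rabs (t - t0) < / (INR n + 1) -> H1 < Rabs (hA (F t x))) R1) as [n Hn].
    { intros x m n Hmn Hx HR t Ht Htt. apply Hx; auto. pose proof (inv_INR_le m n Hmn). lra. }
    { intro x0. destruct (Req_dec (Rabs (hA x0)) R1) as [E | E].
      - assert (Hbig : H1 < Rabs (hA (F t0 x0))).
        { apply Rnot_le_lt. intro Hle. specialize (HM _ Hle). rewrite Hgl in HM. unfold R1 in E. lra. }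
        destruct (Hcont t0 x0 Ht0 (Rabs (hA (F t0 x0)) - H1)) as [r [Hr Hx]]; [lra |].
        destruct (inv_INR_lt r Hr) as [n Hn].
        exists r, n. split; auto. intros x Hxd _ t Ht Htt.
        specialize (Hx t x Ht ltac:(lra) Hxd).
        pose proof (Rabs_hA_dist (F t0 x0) (F t x)) as Hh. apply Rabs_bounds in Hh. lra.
      - exists (Rabs (Rabs (hA x0) - R1)), 0%nat. split.
        { apply Rabs_pos_lt. lra. }
        intros x Hx Ex. exfalso. pose proof (Rabs_hA_dist x0 x) as Hh. rewrite Ex in Hh. lra. }
    set (x1 := g (piA (0, 0))).
    destruct (Hcont t0 x1 Ht0 1 ltac:(lra)) as [r [Hr Hx1]].
    destruct (INR_archimed 1 R1 ltac:(lra)) as [p Hp].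
    exists (Rmin r (/ (INR n + 1))), p. split.
    { apply Rmin_pos; auto. apply inv_INR_pos. }
    intros t Ht Htt x Hx.
    pose proof (Rmin_l r (/ (INR n + 1))). pose proof (Rmin_r r (/ (INR n + 1))).
    assert (Hx1t : Rabs (hA (F t x1)) <= H1).
    { specialize (Hx1 t x1 Ht ltac:(lra)). rewrite distA_refl in Hx1. specialize (Hx1 Hr).
      pose proof (Rabs_hA_dist (F t0 x1) (F t x1)) as Hh. apply Rabs_bounds in Hh.
      assert (Ex : F t0 x1 = piA (0, 0)) by apply Hgr.
      rewrite Ex, hA_piA in Hh. simpl in Hh. rewrite Rabs_R0, Ex in *. lra. }
    destruct (Hhom t Ht) as [g' [Hgl' [Hgr' [_ Hgc']]]].
    destruct (piA_surj (F t x1)) as [a Ha]. destruct (piA_surj (F t x)) as [b Hb].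
    set (u := fun s => Rabs (hA (g' (piA (seg a b s))))).
    assert (Hu : u 1 < R1).
    { apply never_cross; [lra | | |].
      - intros s eps Hs Heps.
        destruct (Hgc' (piA (seg a b s)) eps Heps) as [d [Hd Hgd]].
        destruct (seg_cont a b (d / 24) ltac:(lra)) as [q [Hq Hseg]].
        exists q. split; auto. intros s' Hs' Hss. unfold u.
        eapply Rle_lt_trans; [apply Rabs_hA_dist |].
        rewrite distA_sym. apply Hgd. apply near_distA; auto. apply Hseg.
        rewrite Rabs_minus_sym. exact Hss.
      - intros s Hs E. unfold u in E.
        set (y := g' (piA (seg a b s))) in *.
        specialize (Hn y ltac:(lra) E t Ht ltac:(lra)). unfold y in Hn.
        rewrite Hgr', hA_piA in Hn.
        pose proof (seg_height a b s H1 Hs) as Hh.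
        rewrite <- Ha, hA_piA in Hx1t. rewrite <- Hb, hA_piA in Hx.
        specialize (Hh Hx1t Hx). lra.
      - unfold u. rewrite seg_0, Ha, Hgl'. unfold x1.
        specialize (HM (piA (0, 0))). rewrite hA_piA in HM. simpl snd in HM. rewrite Rabs_R0 in HM.
        unfold R1. specialize (HM ltac:(lra)). lra. }
    unfold u in Hu. rewrite seg_1, Hb, Hgl' in Hu. lra.
  - exists (INR n). intros t x Ht Hx. apply (Hn t Ht). lra.
Qed.

(** At each time the two points have the same projection, so their abscissas differ by an integer,
    which is continuous in time and hence constant. *)
Lemma lift_deck F Ft (t : R) (k : Z) (z : R2) :
  isotopy_lift F Ft -> 0 <= t <= 1 -> Ft t (deck k z) = deck k (Ft t z).
Proof.
  intros [H0 [Hpi Hc]] Ht.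
  assert (Hj : forall s, 0 <= s <= 1 -> exists j, Ft s (deck k z) = deck j (Ft s z)).
  { intros s Hs. apply piA_eq. rewrite !Hpi, piA_deck by assumption. reflexivity. }
  set (u := fun s => fst (Ft s (deck k z)) - fst (Ft s z)).
  assert (Hu : u t = u 0).
  { apply integer_valued_constant; [lra | |].
    - intros s eps Hs Heps.
      destruct (Hc s (deck k z) ltac:(lra) (eps / 2) ltac:(lra)) as [d1 [Hd1 C1]].
      destruct (Hc s z ltac:(lra) (eps / 2) ltac:(lra)) as [d2 [Hd2 C2]].
      assert (Hrefl : forall a, dist2 a a = 0).
      { intro a. unfold dist2. rewrite <- sqrt_0. f_equal. ring. }
      exists (Rmin d1 d2). split; [apply Rmin_pos; auto |]. intros s' Hs' Hss.
      pose proof (Rmin_l d1 d2). pose proof (Rmin_r d1 d2).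
      specialize (C1 s' (deck k z) ltac:(lra) ltac:(lra)). rewrite Hrefl in C1.
      specialize (C2 s' z ltac:(lra) ltac:(lra)). rewrite Hrefl in C2.
      destruct (dist2_near _ _ _ (C1 Hd1)) as [N1 _].
      destruct (dist2_near _ _ _ (C2 Hd2)) as [N2 _].
      apply Rabs_def2 in N1, N2. unfold u. apply Rabs_def1; lra.
    - intros s Hs. destruct (Hj s ltac:(lra)) as [j Ej]. exists j. unfold u. rewrite Ej.
      simpl. ring. }
  destruct (Hj t Ht) as [j Ej]. unfold u in Hu. rewrite Ej, !H0 in Hu. simpl in Hu.
  rewrite Ej. unfold deck. f_equal. lra.
Qed.

Lemma lift_unif_cont F Ft :
  isotopy_lift F Ft -> forall H eta, 0 < eta -> exists e, 0 < e /\
     forall t t' w w', 0 <= t <= 1 -> 0 <= t' <= 1 -> Rabs (snd w) <= H ->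
       near e w w' -> Rabs (t - t') < e -> near eta (Ft t w) (Ft t' w').
Proof.
  intros HL H eta Heta. pose proof HL as [_ [_ Hc]].
  destruct (compact_box (fun t w n => forall t' w', 0 <= t' <= 1 -> near (/ (INR n + 1)) w w' ->
    Rabs (t - t') < / (INR n + 1) -> near eta (Ft t w) (Ft t' w')) 0 1 (- H) H) as [n Hn].
  - intros t w m n Hmn Hw t' w' Ht' Hn Htt. pose proof (inv_INR_le m n Hmn).
    apply Hw; auto; [apply near_le with (/ (INR n + 1)); auto | lra].
  - intros t0 w0 Ht0 _ _.
    destruct (Hc t0 w0 Ht0 (eta / 2) ltac:(lra)) as [d [Hd Hcd]].
    destruct (inv_INR_lt (d / 6) ltac:(lra)) as [n Hn].
    exists (d / 6), n. split; [lra |].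
    intros t w Ht Htt Hw t' w' Ht' Hww Htt'.
    apply near_le with (eta / 2 + eta / 2); [lra |].
    apply near_trans with (Ft t0 w0).
    + apply near_sym, dist2_near, Hcd; auto; [lra |].
      apply near_dist2; auto. apply near_sym. apply near_le with (d / 6); auto; lra.
    + apply dist2_near, Hcd; auto.
      * apply Rabs_def2 in Htt, Htt'. apply Rabs_def1; lra.
      * apply near_dist2; auto. apply near_le with (d / 6 + / (INR n + 1)); [lra |].
        apply near_trans with w; auto. apply near_sym; exact Hw.
  - exists (/ (INR n + 1)). split; [apply inv_INR_pos |].
    intros t t' w w' Ht Ht' Hw Hww Htt.
    destruct (deck_unit w) as [k Hk]. apply Rabs_bounds in Hw.
    specialize (Hn t (deck k w) Ht Hk Hw t' (deck k w') Ht' (near_deck _ k _ _ Hww) Htt).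
    rewrite !(lift_deck F) in Hn by assumption.
    apply (near_deck _ (- k)) in Hn. rewrite !deck_deck, Z.add_opp_diag_r, !deck_0 in Hn. exact Hn.
Qed.

(** Compactness is applied to the distance in the annulus. Near a pair [t0], [w0], either [w] stays
    close to a translate of [z] and the hypothesis fails, or injectivity of [F t0] gives a positive
    distance. *)
Lemma lift_separation F Ft :
  isotopy F -> isotopy_lift F Ft ->
  forall H r z, 0 < r -> exists eta, 0 < eta /\
     forall t w, 0 <= t <= 1 -> Rabs (snd w) <= H ->
       (forall k, ~ near r (deck k z) w) -> ~ near eta (Ft t z) (Ft t w).
Proof.
  intros [_ [Hhom Hcont]] HL H r z Hr. pose proof HL as [_ [Hpi _]].
  destruct (compact_box (fun t w n => (forall k, ~ near r (deck k z) w) ->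
    / (INR n + 1) <= distA (F t (piA z)) (F t (piA w))) 0 1 (- H) H) as [n Hn].
  - intros t w m n Hmn Hw Hk. specialize (Hw Hk). pose proof (inv_INR_le m n Hmn). lra.
  - intros t0 w0 Ht0 _ _. destruct (classic (exists k, near r (deck k z) w0)) as [[k Hk] | Hno].
    + destruct Hk as [K1 K2].
      set (q := Rmin (r - Rabs (fst (deck k z) - fst w0)) (r - Rabs (snd (deck k z) - snd w0))).
      assert (Hq : 0 < q) by (apply Rmin_pos; lra).
      exists q, 0%nat. split; auto. intros t w _ _ [W1 W2] Hall. exfalso. apply (Hall k).
      pose proof (Rmin_l (r - Rabs (fst (deck k z) - fst w0)) (r - Rabs (snd (deck k z) - snd w0))).
      pose proof (Rmin_r (r - Rabs (fst (deck k z) - fst w0)) (r - Rabs (snd (deck k z) - snd w0))).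
      fold q in H0, H1. split.
      * replace (_ - _) with ((fst (deck k z) - fst w0) + - (fst w - fst w0)) by ring.
        eapply Rle_lt_trans; [apply Rabs_triang |]. rewrite Rabs_Ropp. lra.
      * replace (_ - _) with ((snd (deck k z) - snd w0) + - (snd w - snd w0)) by ring.
        eapply Rle_lt_trans; [apply Rabs_triang |]. rewrite Rabs_Ropp. lra.
    + assert (Hne : 0 < distA (F t0 (piA z)) (F t0 (piA w0))).
      { destruct (Rle_lt_or_eq_dec 0 _ (distA_pos (F t0 (piA z)) (F t0 (piA w0)))) as [| E]; auto.
        exfalso. symmetry in E. apply distA_0_eq in E.
        destruct (Hhom t0 Ht0) as [g [Hgl _]].
        apply (f_equal g) in E. rewrite !Hgl in E. apply piA_eq in E. destruct E as [k ->].
        apply Hno. exists k. apply near_refl; exact Hr. }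
      set (D := distA (F t0 (piA z)) (F t0 (piA w0))) in *.
      destruct (Hcont t0 (piA z) Ht0 (D / 3) ltac:(lra)) as [d1 [Hd1 C1]].
      destruct (Hcont t0 (piA w0) Ht0 (D / 3) ltac:(lra)) as [d2 [Hd2 C2]].
      destruct (inv_INR_lt (D / 3) ltac:(lra)) as [n Hn].
      exists (Rmin d1 (d2 / 24)), n. split; [apply Rmin_pos; lra |].
      intros t w Ht Htt Hw _.
      pose proof (Rmin_l d1 (d2 / 24)). pose proof (Rmin_r d1 (d2 / 24)).
      specialize (C1 t (piA z) Ht ltac:(lra)). rewrite distA_refl in C1. specialize (C1 Hd1).
      specialize (C2 t (piA w) Ht ltac:(lra)).
      assert (Hwd : distA (piA w0) (piA w) < d2).
      { apply near_distA; auto. apply near_sym. apply near_le with (2 := Hw). lra. }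
      specialize (C2 Hwd).
      pose proof (distA_tri (F t0 (piA z)) (F t (piA z)) (F t0 (piA w0))).
      pose proof (distA_tri (F t (piA z)) (F t (piA w)) (F t0 (piA w0))).
      rewrite (distA_sym (F t (piA w)) (F t0 (piA w0))) in *. fold D in H2. lra.
  - pose proof (inv_INR_pos n) as Hpos.
    exists (/ (INR n + 1) / 24). split; [lra |].
    intros t w Ht Hw Hk Hnear.
    destruct (deck_unit w) as [j Hj]. apply Rabs_bounds in Hw.
    specialize (Hn t (deck j w) Ht Hj Hw). rewrite piA_deck, <- !Hpi in Hn by assumption.
    apply near_distA in Hnear; auto.
    assert (Hall : forall k, ~ near r (deck k z) (deck j w)).
    { intros k Hkj. apply (near_deck _ (- j)) in Hkj.
      rewrite !deck_deck, Z.add_opp_diag_r, deck_0 in Hkj. apply (Hk _ Hkj). }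
    specialize (Hn Hall). lra.
Qed.

(** By [isotopy_proper], a point that starts far out is kept out of the band of height [Rmax H 0] at
    all times. In particular its height never vanishes, so it keeps its sign. *)
Lemma lift_ends F Ft :
  isotopy F -> isotopy_lift F Ft ->
  forall H, exists M, forall t w, 0 <= t <= 1 ->
     (M <= snd w -> H <= snd (Ft t w)) /\ (snd w <= - M -> snd (Ft t w) <= - H).
Proof.
  intros HF HL H. pose proof HL as [H0 [Hpi Hc]].
  destruct (isotopy_proper F (Rmax H 0) HF) as [M HM].
  pose proof (Rmax_l H 0). pose proof (Rmax_r H 0).
  set (M' := Rmax M (Rmax H 0) + 1).
  assert (HM' : M < M' /\ Rmax H 0 < M').
  { unfold M'. pose proof (Rmax_l M (Rmax H 0)). pose proof (Rmax_r M (Rmax H 0)). lra. }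
  assert (Hout : forall t w, 0 <= t <= 1 -> M' <= Rabs (snd w) -> Rmax H 0 < Rabs (snd (Ft t w))).
  { intros t w Ht Hw. apply Rnot_le_lt. intro Hle. rewrite <- hA_piA, Hpi in Hle by assumption.
    apply HM in Hle; auto. rewrite hA_piA in Hle. lra. }
  assert (Hcu : forall t w, 0 <= t <= 1 -> cont_on t (fun s => snd (Ft s w))).
  { intros t w Ht s eps Hs Heps.
    destruct (lift_unif_cont F Ft HL (Rabs (snd w)) eps Heps) as [e [He Hcc]].
    exists e. split; auto. intros s' Hs' Hss.
    apply (Hcc s' s w w); auto using near_refl; lra. }
  exists M'. intros t w Ht. split; intro Hw.
  - assert (Hs : - snd (Ft t w) < 0).
    { apply (never_cross t (fun s => - snd (Ft s w)) 0); [lra | | |].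
      - intros s eps Hs Heps. destruct (Hcu t w Ht s eps Hs Heps) as [q [Hq Hqs]].
        exists q. split; auto. intros s' Hs' Hss. rewrite <- Rabs_Ropp.
        replace (- _) with (snd (Ft s' w) - snd (Ft s w)) by ring. auto.
      - intros s Hs E. pose proof (Hout s w ltac:(lra)) as Ho.
        rewrite (Rabs_pos_eq (snd w)) in Ho by lra. specialize (Ho Hw).
        replace (snd (Ft s w)) with 0 in Ho by lra. rewrite Rabs_R0 in Ho. lra.
      - rewrite H0. lra. }
    specialize (Hout t w Ht). rewrite !Rabs_pos_eq in Hout by lra. specialize (Hout Hw). lra.
  - assert (Hs : snd (Ft t w) < 0).
    { apply (never_cross t (fun s => snd (Ft s w)) 0); [lra | apply Hcu; auto | |].
      - intros s Hs E. pose proof (Hout s w ltac:(lra)) as Ho.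
        rewrite (Rabs_left (snd w)) in Ho by lra. specialize (Ho ltac:(lra)).
        rewrite E, Rabs_R0 in Ho. lra.
      - rewrite H0. lra. }
    specialize (Hout t w Ht). rewrite !Rabs_left in Hout by lra. specialize (Hout ltac:(lra)). lra.
Qed.

Lemma lift_tame F Ft : isotopy F -> isotopy_lift F Ft -> tame_isotopy Ft.
Proof.
  intros HF HL. split; [apply HL |]. split; [apply (lift_unif_cont F); auto |].
  split; [apply (lift_separation F); auto | apply (lift_ends F); auto].
Qed.

(** * Connected subsets of the annulus *)

Lemma path_stays (U V : Ann -> Prop) (c : R -> Ann) (a b : R) :
  openA U -> openA V -> a <= b ->
  (forall s eps, a <= s <= b -> 0 < eps -> exists r, 0 < r /\
     forall u, a <= u <= b -> Rabs (u - s) < r -> distA (c s) (c u) < eps) ->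
  (forall s, a <= s <= b -> U (c s) \/ V (c s)) ->
  (forall s, a <= s <= b -> ~ (U (c s) /\ V (c s))) ->
  U (c a) -> U (c b).
Proof.
  intros HU HV Hab Hc Hcov Hdis Ha.
  apply (interval_induction a b (fun s => U (c s))); auto.
  intros t Ht. destruct (Hcov t Ht) as [Hu | Hv].
  - destruct (HU _ Hu) as [eps [Heps HB]]. destruct (Hc t eps Ht Heps) as [r [Hr Hs]].
    exists r. split; auto. intros s s' _ Hs' _ Hr' _. apply HB, Hs; [lra | apply Rabs_def1; lra].
  - destruct (HV _ Hv) as [eps [Heps HB]]. destruct (Hc t eps Ht Heps) as [r [Hr Hs]].
    exists r. split; auto. intros s s' Hs1 _ Hr' _ HUs. exfalso.
    apply (Hdis s); [lra |]. split; auto. apply HB, Hs; [lra | apply Rabs_def1; lra].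
Qed.

Lemma convex_connected (C : R2 -> Prop) :
  (forall a b s, C a -> C b -> 0 <= s <= 1 -> C (seg a b s)) ->
  connectedA (fun x => exists z, C z /\ piA z = x).
Proof.
  intros HC U V HU HV Hcov Hdis.
  apply NNPP; intro Hno. apply not_or_and in Hno. destruct Hno as [H1 H2].
  apply not_all_ex_not in H1. destruct H1 as [x H1]. apply imply_to_and in H1. destruct H1 as [Sx NUx].
  apply not_all_ex_not in H2. destruct H2 as [y H2]. apply imply_to_and in H2. destruct H2 as [Sy NVy].
  assert (Uy : U y) by (destruct (Hcov y Sy); tauto).
  destruct Sx as [b [Cb Eb]]. destruct Sy as [a [Ca Ea]].
  apply NUx. rewrite <- Eb, <- (seg_1 a b).
  apply (path_stays U V (fun s => piA (seg a b s)) 0 1); auto; [lra | | | |].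
  - intros s eps Hs Heps. destruct (seg_cont a b (eps / 24) ltac:(lra)) as [r [Hr Hseg]].
    exists r. split; auto. intros u Hu Hus. apply near_distA; auto. apply Hseg.
    rewrite Rabs_minus_sym. exact Hus.
  - intros s Hs. apply Hcov. exists (seg a b s). auto.
  - intros s Hs HUV. apply (Hdis (piA (seg a b s))). split; auto. exists (seg a b s). auto.
  - rewrite seg_0, Ea. exact Uy.
Qed.

Lemma connectedA_ext (S S' : Ann -> Prop) :
  (forall x, S x <-> S' x) -> connectedA S -> connectedA S'.
Proof.
  intros HS Hc U V HU HV Hcov Hdis.
  destruct (Hc U V HU HV) as [H | H].
  - intros x Hx. apply Hcov, HS, Hx.
  - intros x [Hx HUV]. apply (Hdis x). split; [apply HS, Hx | exact HUV].
  - left. intros x Hx. apply H, HS, Hx.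
  - right. intros x Hx. apply H, HS, Hx.
Qed.

Lemma openA_and (U V : Ann -> Prop) : openA U -> openA V -> openA (fun x => U x /\ V x).
Proof.
  intros HU HV x [Ux Vx]. destruct (HU x Ux) as [a [Ha Ba]]. destruct (HV x Vx) as [b [Hb Bb]].
  exists (Rmin a b). split; [apply Rmin_pos; auto |]. intros y Hy.
  pose proof (Rmin_l a b). pose proof (Rmin_r a b). split; [apply Ba | apply Bb]; lra.
Qed.

Lemma openA_ext (U V : Ann -> Prop) : (forall x, U x <-> V x) -> openA U -> openA V.
Proof.
  intros HUV HU x Vx. destruct (HU x (proj2 (HUV x) Vx)) as [a [Ha Ba]].
  exists a. split; auto. intros y Hy. apply HUV, Ba, Hy.
Qed.

Lemma clopen_full (U : Ann -> Prop) :
  openA U -> openA (fun x => ~ U x) -> (exists x, U x) -> forall x, U x.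
Proof.
  intros HU HU' [x0 Hx0] x.
  assert (Hconn : connectedA (fun y => exists z, True /\ piA z = y)) by (apply convex_connected; auto).
  destruct (Hconn U (fun x => ~ U x) HU HU') as [H | H].
  - intros y _. apply classic.
  - intros y [_ [H1 H2]]. tauto.
  - apply H. destruct (piA_surj x) as [z Hz]. exists z; auto.
  - exfalso. apply (H x0); auto. destruct (piA_surj x0) as [z Hz]. exists z; auto.
Qed.

Lemma band_above_connected (H : R) : connectedA (fun x => H < hA x).
Proof.
  apply connectedA_ext with (fun x => exists z, H < snd z /\ piA z = x).
  - intro x. split; [intros [z [Hz <-]]; exact Hz |].
    destruct (piA_surj x) as [z <-]. intro Hz. exists z. auto.
  - apply convex_connected. intros a b s Ha Hb Hs. simpl.
    destruct (Rlt_dec s 1).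
    + pose proof (Rmult_le_pos s (snd b - H) ltac:(lra) ltac:(lra)).
      pose proof (Rmult_lt_0_compat (1 - s) (snd a - H) ltac:(lra) ltac:(lra)). lra.
    + replace s with 1 by lra. lra.
Qed.

Lemma band_below_connected (H : R) : connectedA (fun x => hA x < H).
Proof.
  apply connectedA_ext with (fun x => exists z, snd z < H /\ piA z = x).
  - intro x. split; [intros [z [Hz <-]]; exact Hz |].
    destruct (piA_surj x) as [z <-]. intro Hz. exists z. auto.
  - apply convex_connected. intros a b s Ha Hb Hs. simpl.
    destruct (Rlt_dec s 1).
    + pose proof (Rmult_le_pos s (H - snd b) ltac:(lra) ltac:(lra)).
      pose proof (Rmult_lt_0_compat (1 - s) (H - snd a) ltac:(lra) ltac:(lra)). lra.
    + replace s with 1 by lra. lra.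
Qed.

Lemma small_connected_nbhd (x : Ann) (r : R) : 0 < r ->
  exists D, connectedA D /\ (forall y, D y -> distA x y < r) /\
    exists r', 0 < r' /\ forall y, distA x y < r' -> D y.
Proof.
  intro Hr. destruct (piA_surj x) as [z <-].
  exists (fun y => exists w, near (r / 24) z w /\ piA w = y). repeat split.
  - apply convex_connected. intros a b s [A1 A2] [B1 B2] Hs.
    apply Rabs_def2 in A1, A2, B1, B2.
    assert (Hcvx : forall u v q, - q < u < q -> - q < v < q -> - q < u + s * (v - u) < q).
    { intros u v q Hu Hv. destruct (Rlt_dec s 1).
      - pose proof (Rmult_le_pos s (q - v) ltac:(lra) ltac:(lra)).
        pose proof (Rmult_le_pos s (q + v) ltac:(lra) ltac:(lra)).
        pose proof (Rmult_lt_0_compat (1 - s) (q - u) ltac:(lra) ltac:(lra)).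
        pose proof (Rmult_lt_0_compat (1 - s) (q + u) ltac:(lra) ltac:(lra)). lra.
      - replace s with 1 by lra. lra. }
    pose proof (Hcvx (fst z - fst a) (fst z - fst b) (r / 24) ltac:(lra) ltac:(lra)).
    pose proof (Hcvx (snd z - snd a) (snd z - snd b) (r / 24) ltac:(lra) ltac:(lra)).
    split; simpl; apply Rabs_def1; lra.
  - intros y [w [Hw <-]]. apply near_distA; auto.
  - destruct (distA_lift (r / 24) ltac:(lra)) as [d [Hd Hl]].
    exists d. split; auto. intros y Hy. destruct (Hl z y Hy) as [w [Hw Hn]]. exists w. auto.
Qed.

Lemma component_open (W C : Ann -> Prop) : openA W -> componentA W C -> openA C.
Proof.
  intros HW [_ [HCW [_ Hmax]]] x Cx.
  destruct (HW x (HCW x Cx)) as [r [Hr HB]].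
  destruct (small_connected_nbhd x r Hr) as [D [HD [HDr [r' [Hr' HDr']]]]].
  exists r'. split; auto. intros y Hy. apply (Hmax D); auto.
  exists x. split; auto. apply HDr'. rewrite distA_refl. exact Hr'.
Qed.

Lemma component_rel_closed (W C : Ann -> Prop) :
  openA W -> componentA W C -> openA (fun x => W x /\ ~ C x).
Proof.
  intros HW [_ [HCW [_ Hmax]]] x [Wx NCx].
  destruct (HW x Wx) as [r [Hr HB]].
  destruct (small_connected_nbhd x r Hr) as [D [HD [HDr [r' [Hr' HDr']]]]].
  exists r'. split; auto. intros y Hy. split; [apply HB, HDr, HDr', Hy |].
  intro Cy. apply NCx. apply (Hmax D); auto.
  - exists y. auto.
  - apply HDr'. rewrite distA_refl. exact Hr'.
Qed.

Lemma connected_side (S U V : Ann -> Prop) :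
  connectedA S -> openA U -> openA V -> (forall x, S x -> U x \/ V x) ->
  (forall x, S x -> ~ (U x /\ V x)) -> (forall x, S x -> U x) \/ (forall x, S x -> V x).
Proof. intros HS HU HV Hcov Hdis. apply HS; auto. intros x [Hx H]. exact (Hdis x Hx H). Qed.

(** The frontier of [C] lies in [g]. If open sets separated [C] from [g], then [C] would be open and
    closed in the annulus. *)
Lemma component_union_connected (g C : Ann -> Prop) :
  (exists x, g x) -> connectedA g -> openA (complA g) -> componentA (complA g) C ->
  connectedA (fun x => C x \/ g x).
Proof.
  intros [x0 gx0] Hg Hog HC.
  assert (Hkey : forall U V : Ann -> Prop, openA V ->
    (forall x, ~ ((C x \/ g x) /\ U x /\ V x)) ->
    (forall x, C x -> U x) -> (forall x, g x -> V x) -> False).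
  { intros U V HV Hdis HCU HgV.
    assert (HCg : forall x, C x -> ~ g x) by (intros x Cx; apply HC; exact Cx).
    apply (HCg x0); auto.
    apply (clopen_full C).
    - apply (component_open (complA g)); auto.
    - intros x NCx. destruct (classic (g x)) as [gx | ngx].
      + destruct (HV x (HgV x gx)) as [r [Hr HB]]. exists r. split; auto.
        intros y Hy Cy. apply (Hdis y). auto.
      + destruct (component_rel_closed (complA g) C Hog HC x) as [r [Hr HB]]; [split; auto |].
        exists r. split; auto. intros y Hy. apply HB, Hy.
    - apply HC. }
  intros U V HU HV Hcov Hdis.
  assert (HcC : connectedA C) by apply HC.
  destruct (connected_side C U V HcC HU HV) as [CU | CV]; auto.
  { intros x Cx HUV. apply (Hdis x). auto. }
  - destruct (connected_side g U V Hg HU HV) as [GU | GV]; auto.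
    { intros x gx HUV. apply (Hdis x). auto. }
    + left. intros x [Cx | gx]; auto.
    + exfalso. apply (Hkey U V); auto.
  - destruct (connected_side g U V Hg HU HV) as [GU | GV]; auto.
    { intros x gx HUV. apply (Hdis x). auto. }
    + exfalso. apply (Hkey V U); auto. intros x [Hx [H1 H2]]. apply (Hdis x). auto.
    + right. intros x [Cx | gx]; auto.
Qed.

(** In a splitting by [U] and [V] with [g] in [U], the points of [V] outside [C] form an open and
    closed set of the annulus that misses [g], so there are none. *)
Lemma component_compl_connected (g C : Ann -> Prop) :
  (exists x, g x) -> connectedA g -> openA (complA g) -> componentA (complA g) C ->
  connectedA (fun x => ~ C x).
Proof.
  intros [x0 gx0] Hg Hog HC.
  assert (HCo : openA C) by (apply (component_open (complA g)); auto).
  assert (HCg : forall x, C x -> ~ g x) by (intros x Cx; apply HC; exact Cx).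
  assert (Hkey : forall U V : Ann -> Prop, openA U -> openA V ->
    (forall x, ~ C x -> U x \/ V x) -> (forall x, ~ (~ C x /\ U x /\ V x)) ->
    (forall x, g x -> U x) -> forall x, ~ C x -> U x).
  { intros U V HU HV Hcov Hdis HgU x NCx.
    apply NNPP; intro NUx.
    assert (Hall : forall y, V y /\ ~ C y).
    { apply clopen_full.
      - apply openA_ext with (fun y => V y /\ (complA g y /\ ~ C y)).
        + intro y. split; [tauto |]. intros [Vy NCy]. repeat split; auto.
          intro gy. apply (Hdis y). auto.
        + apply openA_and; auto. apply component_rel_closed; auto.
      - intros y Hy. destruct (classic (C y)) as [Cy | NCy].
        + destruct (HCo y Cy) as [r [Hr HB]]. exists r. split; auto.
          intros y' Hy' [_ H']. apply H', HB, Hy'.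
        + assert (Uy : U y) by (destruct (Hcov y NCy); tauto).
          destruct (HU y Uy) as [r [Hr HB]]. exists r. split; auto.
          intros y' Hy' [V' C']. apply (Hdis y'). auto.
      - exists x. destruct (Hcov x NCx); tauto. }
    apply (Hdis x0). split; [apply Hall | split; [auto | apply Hall]]. }
  intros U V HU HV Hcov Hdis.
  destruct (connected_side g U V Hg HU HV) as [GU | GV].
  - intros x gx. apply Hcov. intro Cx. exact (HCg x Cx gx).
  - intros x gx HUV. apply (Hdis x). split; auto. intro Cx. exact (HCg x Cx gx).
  - left. apply (Hkey U V); auto.
  - right. apply (Hkey V U); auto.
    + intros x Hx. destruct (Hcov x Hx); auto.
    + intros x [Hx [H1 H2]]. apply (Hdis x). auto.
Qed.

(** Suppose two open sets split the middle part. If both curves lie in the same one, what the other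
    one contains is open and closed in the annulus. If the curves are split, [P] together with the
    part that contains [g1] is open and closed, yet misses [g2]. *)
Lemma between_components_connected (g1 g2 P Q : Ann -> Prop) :
  (exists x, g1 x) -> (exists x, g2 x) -> connectedA g1 -> connectedA g2 ->
  openA P -> openA Q ->
  openA (fun x => ~ (P x \/ g1 x)) -> openA (fun x => ~ (Q x \/ g2 x)) ->
  (forall x, ~ ((P x \/ g1 x) /\ (Q x \/ g2 x))) ->
  (forall x, g1 x -> ~ P x) -> (forall x, g2 x -> ~ Q x) ->
  connectedA (fun x => ~ P x /\ ~ Q x).
Proof.
  intros [x1 Hx1] [x2 Hx2] Hg1 Hg2 HP HQ HPb HQb Hd HgP HgQ.
  set (A := fun x => ~ P x /\ ~ Q x).
  assert (HA1 : forall x, g1 x -> A x).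
  { intros x gx. split; auto. intro Qx. apply (Hd x). auto. }
  assert (HA2 : forall x, g2 x -> A x).
  { intros x gx. split; auto. intro Px. apply (Hd x). auto. }
  assert (Hkey : forall U V : Ann -> Prop, openA U -> openA V ->
    (forall x, A x -> U x \/ V x) -> (forall x, A x -> ~ (U x /\ V x)) ->
    (forall x, g1 x -> U x) -> forall x, A x -> U x).
  { intros U V HU HV Hcov Hdis HgU.
    destruct (connected_side g2 U V Hg2 HU HV) as [GU | GV]; auto.
    - intros x Ax. apply NNPP; intro NUx.
      assert (Hall : forall y, V y /\ A y).
      { apply clopen_full.
        - apply openA_ext with (fun y => V y /\ (~ (P y \/ g1 y) /\ ~ (Q y \/ g2 y))).
          + intro y. split; [unfold A; tauto |]. intros [Vy Ay].
            assert (~ g1 y) by (intro gy; apply (Hdis y Ay); auto).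
            assert (~ g2 y) by (intro gy; apply (Hdis y Ay); auto).
            unfold A in Ay. tauto.
          + apply openA_and; auto. apply openA_and; auto.
        - intros y Hy. destruct (classic (P y)) as [Py | NPy].
          { destruct (HP y Py) as [r [Hr HB]]. exists r. split; auto.
            intros y' Hy' [_ [H' _]]. apply H', HB, Hy'. }
          destruct (classic (Q y)) as [Qy | NQy].
          { destruct (HQ y Qy) as [r [Hr HB]]. exists r. split; auto.
            intros y' Hy' [_ [_ H']]. apply H', HB, Hy'. }
          assert (Ay : A y) by (split; auto).
          assert (Uy : U y) by (destruct (Hcov y Ay); tauto).
          destruct (HU y Uy) as [r [Hr HB]]. exists r. split; auto.
          intros y' Hy' [V' A']. apply (Hdis y' A'). auto.
        - exists x. destruct (Hcov x Ax); tauto. }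
      apply (Hdis x1); [apply HA1; auto | split; [auto | apply Hall]].
    - exfalso.
      assert (Hall : forall y, P y \/ (U y /\ A y)).
      { apply clopen_full.
        - intros y [Py | [Uy Ay]].
          + destruct (HP y Py) as [r [Hr HB]]. exists r. auto.
          + destruct (HU y Uy) as [r [Hr HB]].
            destruct (HQb y) as [r' [Hr' HB']].
            { intros [Qy | gy]; [exact (proj2 Ay Qy) | apply (Hdis y Ay); auto]. }
            exists (Rmin r r'). split; [apply Rmin_pos; auto |]. intros y' Hy'.
            pose proof (Rmin_l r r'). pose proof (Rmin_r r r').
            specialize (HB y' ltac:(lra)). specialize (HB' y' ltac:(lra)).
            destruct (classic (P y')); [left; auto | right]. split; auto. split; auto.
        - intros y Hy.
          destruct (classic (Q y)) as [Qy | NQy].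
          + destruct (HQ y Qy) as [r [Hr HB]]. exists r. split; auto.
            intros y' Hy' Hor. specialize (HB y' Hy').
            destruct Hor as [Py' | [_ [_ Nq]]]; [apply (Hd y'); auto | auto].
          + assert (Ay : A y) by (split; auto).
            assert (Vy : V y) by (destruct (Hcov y Ay); tauto).
            destruct (HV y Vy) as [r [Hr HB]].
            destruct (HPb y) as [r' [Hr' HB']].
            { intros [Py | gy]; [exact (proj1 Ay Py) | apply (Hdis y Ay); auto]. }
            exists (Rmin r r'). split; [apply Rmin_pos; auto |]. intros y' Hy'.
            pose proof (Rmin_l r r'). pose proof (Rmin_r r r').
            specialize (HB y' ltac:(lra)). specialize (HB' y' ltac:(lra)).
            intros [Py' | [Uy' Ay']]; [tauto | apply (Hdis y' Ay'); auto].
        - exists x1. right. auto. }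
      destruct (Hall x2) as [Px2 | [Ux2 Ax2]].
      + apply (Hd x2). auto.
      + apply (Hdis x2 Ax2). auto. }
  intros U V HU HV Hcov Hdis.
  assert (Hdis' : forall x, A x -> ~ (U x /\ V x)) by (intros x Ax HUV; apply (Hdis x); auto).
  destruct (connected_side g1 U V Hg1 HU HV) as [GU | GV]; auto.
  - left. apply (Hkey U V); auto.
  - right. apply (Hkey V U); auto.
    + intros x Hx. destruct (Hcov x Hx); auto.
    + intros x Ax [H1 H2]. apply (Hdis' x Ax). auto.
Qed.

(** * Essential curves *)

Definition separates (g P Q : Ann -> Prop) : Prop :=
  (exists x, g x) /\ connectedA g /\ openA (complA g) /\
  componentA (complA g) P /\ componentA (complA g) Q /\ (forall x, ~ (P x /\ Q x)) /\
  exists H, (forall x, H < hA x -> P x) /\ (forall x, hA x < - H -> Q x).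

Lemma periodic_unit (c : R -> Ann) (s : R) :
  (forall s, c (s + 1) = c s) -> exists u, 0 <= u <= 1 /\ c u = c s.
Proof.
  intro Hper.
  assert (Hnat : forall n u, c (u + INR n) = c u).
  { induction n as [| n IH]; intro u.
    - simpl. f_equal. ring.
    - rewrite S_INR, <- Rplus_assoc, Hper. apply IH. }
  exists (s - IZR (Int_part s)). pose proof (base_Int_part s). split; [lra |].
  destruct (Z.le_gt_cases 0 (Int_part s)) as [Hk | Hk].
  - rewrite <- (Hnat (Z.to_nat (Int_part s))). f_equal.
    rewrite INR_IZR_INZ, Z2Nat.id by assumption. ring.
  - rewrite <- (Hnat (Z.to_nat (- Int_part s)) s). f_equal.
    rewrite INR_IZR_INZ, Z2Nat.id, opp_IZR by lia. ring.
Qed.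

Lemma jordan_connected g : jordan_curve g -> connectedA g.
Proof.
  intros [c [Hc [_ [_ Hg]]]] U V HU HV Hcov Hdis.
  assert (Hkey : forall U V : Ann -> Prop, openA U -> openA V ->
    (forall x, g x -> U x \/ V x) -> (forall x, ~ (g x /\ U x /\ V x)) ->
    forall s u, s <= u -> U (c s) -> U (c u)).
  { intros U' V' HU' HV' Hcov' Hdis' s u Hsu.
    apply (path_stays U' V' c s u); auto.
    - intros t eps _ Heps. destruct (Hc t eps Heps) as [d [Hd Hcd]]. exists d. auto.
    - intros t _. apply Hcov', Hg. exists t; auto.
    - intros t _ HUV. apply (Hdis' (c t)). split; auto. apply Hg. exists t; auto. }
  assert (Hcov' : forall x, g x -> V x \/ U x) by (intros x Hx; destruct (Hcov x Hx); auto).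
  assert (Hdis' : forall x, ~ (g x /\ V x /\ U x)).
  { intros x [Hx [H1 H2]]. apply (Hdis x). auto. }
  assert (Hall : forall u, U (c 0) -> U (c u)).
  { intros u H0. destruct (Rle_dec 0 u) as [Hu | Hu].
    - apply (Hkey U V) with 0; auto.
    - assert (Hgu : g (c u)) by (apply Hg; exists u; auto).
      destruct (Hcov _ Hgu) as [| Vu]; auto. exfalso.
      apply (Hdis (c 0)). split; [apply Hg; exists 0; auto | split; auto].
      apply (Hkey V U) with u; auto. lra. }
  assert (Hall' : forall u, V (c 0) -> V (c u)).
  { intros u H0. destruct (Rle_dec 0 u) as [Hu | Hu].
    - apply (Hkey V U) with 0; auto.
    - assert (Hgu : g (c u)) by (apply Hg; exists u; auto).
      destruct (Hcov _ Hgu) as [Uu |]; auto. exfalso.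
      apply (Hdis (c 0)). split; [apply Hg; exists 0; auto | split; auto].
      apply (Hkey U V) with u; auto. lra. }
  destruct (Hcov (c 0)) as [H0 | H0].
  - apply Hg. exists 0; auto.
  - left. intros x Hx. apply Hg in Hx. destruct Hx as [s <-]. auto.
  - right. intros x Hx. apply Hg in Hx. destruct Hx as [s <-]. auto.
Qed.

Lemma jordan_closed g : jordan_curve g -> openA (complA g).
Proof.
  intros [c [Hc [Hper [_ Hg]]]] x Hx.
  destruct (compact_interval (fun s n => / (INR n + 1) <= distA x (c s)) 0 1) as [n Hn].
  - intros s m n Hmn Hs. pose proof (inv_INR_le m n Hmn). lra.
  - intros s0 _.
    assert (Hpos : 0 < distA x (c s0)).
    { destruct (Rle_lt_or_eq_dec 0 _ (distA_pos x (c s0))) as [| E]; auto.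
      exfalso. apply Hx. symmetry in E. apply distA_0_eq in E. rewrite E.
      apply Hg. exists s0; auto. }
    destruct (Hc s0 (distA x (c s0) / 2) ltac:(lra)) as [d [Hd Hcd]].
    destruct (inv_INR_lt (distA x (c s0) / 2) ltac:(lra)) as [n Hn].
    exists d, n. split; auto. intros s _ Hs. specialize (Hcd s Hs).
    pose proof (distA_tri x (c s) (c s0)). rewrite (distA_sym (c s) (c s0)) in *. lra.
  - exists (/ (INR n + 1)). split; [apply inv_INR_pos |].
    intros y Hy gy. apply Hg in gy. destruct gy as [s <-].
    destruct (periodic_unit c s Hper) as [u [Hu Eu]]. rewrite <- Eu in Hy.
    specialize (Hn u Hu). lra.
Qed.

Lemma jordan_height_bounded g : jordan_curve g -> exists M, forall x, g x -> Rabs (hA x) <= M.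
Proof.
  intros [c [Hc [Hper [_ Hg]]]].
  destruct (compact_interval (fun s n => Rabs (hA (c s)) <= INR n) 0 1) as [n Hn].
  - intros s m n Hmn Hs. apply le_INR in Hmn. lra.
  - intros s0 _. destruct (Hc s0 1 ltac:(lra)) as [d [Hd Hcd]].
    destruct (INR_archimed 1 (Rabs (hA (c s0)) + 1) ltac:(lra)) as [n Hn].
    exists d, n. split; auto. intros s _ Hs. specialize (Hcd s Hs).
    pose proof (Rabs_hA_dist (c s0) (c s)) as Hh. apply Rabs_bounds in Hh. lra.
  - exists (INR n). intros x Hx. apply Hg in Hx. destruct Hx as [s <-].
    destruct (periodic_unit c s Hper) as [u [Hu Eu]]. rewrite <- Eu. auto.
Qed.

Lemma bounded_of_height (S : Ann -> Prop) (M : R) :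
  (forall x, S x -> Rabs (hA x) <= M) -> boundedA S.
Proof.
  intro HS. set (x0 := piA (0, 0)).
  destruct (compact_annulus (fun x n => distA x0 x <= INR n) M) as [n Hn].
  - intros x m n Hmn Hx. apply le_INR in Hmn. lra.
  - intro x1. destruct (INR_archimed 1 (distA x0 x1 + 1) ltac:(lra)) as [n Hn].
    exists 1, n. split; [lra |]. intros x Hx. pose proof (distA_tri x0 x1 x). lra.
  - exists x0, (INR n). auto.
Qed.

Lemma bounded_height (S : Ann -> Prop) :
  boundedA S -> exists M, forall x, S x -> Rabs (hA x) <= M.
Proof.
  intros [x0 [M HM]]. exists (Rabs (hA x0) + M). intros x Hx.
  pose proof (Rabs_hA_dist x0 x) as Hh. apply Rabs_bounds in Hh. specialize (HM x Hx). lra.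
Qed.

(** The regions above and below all heights of the curve are connected and miss it, so an unbounded
    component contains one of them, and two disjoint components contain different ones. *)
Lemma essential_separates g : jordan_curve g -> essential g -> exists P Q, separates g P Q.
Proof.
  intros Hj [C1 [C2 [HC1 [HC2 [[x [C1x NC2x]] [Hub1 Hub2]]]]]].
  destruct (jordan_height_bounded g Hj) as [M HM].
  assert (Hup : forall y, M < hA y -> complA g y).
  { intros y Hy gy. specialize (HM y gy). apply Rabs_bounds in HM. lra. }
  assert (Hdown : forall y, hA y < - M -> complA g y).
  { intros y Hy gy. specialize (HM y gy). apply Rabs_bounds in HM. lra. }
  assert (Hend : forall C, componentA (complA g) C -> ~ boundedA C ->
    (forall y, M < hA y -> C y) \/ (forall y, hA y < - M -> C y)).
  { intros C [_ [_ [_ Hmax]]] Hub.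
    assert (Hy : exists y, C y /\ M < Rabs (hA y)).
    { apply NNPP; intro Hno. apply Hub. apply bounded_of_height with M.
      intros y Cy. apply Rnot_lt_le. intro Hlt. apply Hno. exists y; auto. }
    destruct Hy as [y [Cy Hy]]. unfold Rabs in Hy. destruct (Rcase_abs (hA y)).
    - right. apply Hmax; auto; [apply band_below_connected |]. exists y. split; auto. lra.
    - left. apply Hmax; auto; [apply band_above_connected |]. exists y. auto. }
  assert (Hdisj : forall y, ~ (C1 y /\ C2 y)).
  { intros y [Y1 Y2]. apply NC2x. destruct HC2 as [_ [_ [_ Hmax]]].
    destruct HC1 as [_ [Hsub [Hconn _]]]. apply (Hmax C1); auto. exists y; auto. }
  assert (Hne : exists y, g y).
  { destruct Hj as [c [_ [_ [_ Hg]]]]. exists (c 0). apply Hg. exists 0; auto. }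
  pose proof (jordan_connected g Hj). pose proof (jordan_closed g Hj).
  set (u := piA (0, M + 1)). set (v := piA (0, - M - 1)).
  assert (Hu : M < hA u) by (unfold u; rewrite hA_piA; simpl; lra).
  assert (Hv : hA v < - M) by (unfold v; rewrite hA_piA; simpl; lra).
  destruct (Hend C1 HC1 Hub1) as [E1 | E1]; destruct (Hend C2 HC2 Hub2) as [E2 | E2].
  - exfalso. apply (Hdisj u). auto.
  - exists C1, C2. split; [exact Hne |]. repeat (split; [assumption |]). exists M. auto.
  - exists C2, C1. split; [exact Hne |]. repeat (split; [assumption |]).
    split; [intros y [Y1 Y2]; apply (Hdisj y); auto |]. exists M. auto.
  - exfalso. apply (Hdisj v). auto.
Qed.

Lemma component_swallows (g1 g2 C1 C2 : Ann -> Prop) :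
  (exists x, g1 x) -> connectedA g1 -> openA (complA g1) ->
  componentA (complA g1) C1 -> componentA (complA g2) C2 ->
  (forall x, ~ (g1 x /\ g2 x)) -> (forall x, C1 x -> ~ g2 x) ->
  (exists x, C1 x /\ C2 x) -> forall x, C1 x \/ g1 x -> C2 x.
Proof.
  intros Hne Hconn Hop HC1 [_ [_ [_ Hmax]]] Hdis HC1g [y [Y1 Y2]].
  apply (Hmax (fun x => C1 x \/ g1 x)).
  - apply component_union_connected; auto.
  - intros x [Cx | gx]; [apply HC1g; exact Cx |]. intro g2x. apply (Hdis x); auto.
  - exists y. auto.
Qed.

(** The curve [g2] is connected and misses [g1], so it lies in [P1] or avoids it; either alternative
    fixes the order by [component_swallows]. This serves for the two boundary curves, and for a free
    curve and its image. *)
Lemma separates_order (g1 P1 Q1 g2 P2 Q2 : Ann -> Prop) :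
  separates g1 P1 Q1 -> separates g2 P2 Q2 -> (forall x, ~ (g1 x /\ g2 x)) ->
  ((forall x, P1 x \/ g1 x -> P2 x) /\ (forall x, Q2 x \/ g2 x -> Q1 x)) \/
  ((forall x, P2 x \/ g2 x -> P1 x) /\ (forall x, Q1 x \/ g1 x -> Q2 x)).
Proof.
  intros [N1 [K1 [O1 [HP1 [HQ1 [D1 [H1 [U1 L1]]]]]]]] [N2 [K2 [O2 [HP2 [HQ2 [D2 [H2 [U2 L2]]]]]]]] Hdis.
  assert (Hdis' : forall x, ~ (g2 x /\ g1 x)) by (intros x [X1 X2]; apply (Hdis x); auto).
  set (M := Rmax H1 H2 + 1).
  assert (HM : H1 < M /\ H2 < M).
  { unfold M. pose proof (Rmax_l H1 H2). pose proof (Rmax_r H1 H2). lra. }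
  assert (HPP : exists x, P1 x /\ P2 x).
  { exists (piA (0, M)). split; [apply U1 | apply U2]; rewrite hA_piA; simpl; lra. }
  assert (HQQ : exists x, Q1 x /\ Q2 x).
  { exists (piA (0, - M)). split; [apply L1 | apply L2]; rewrite hA_piA; simpl; lra. }
  assert (HPP' : exists x, P2 x /\ P1 x) by (destruct HPP as [x []]; exists x; auto).
  assert (HQQ' : exists x, Q2 x /\ Q1 x) by (destruct HQQ as [x []]; exists x; auto).
  destruct (connected_side g2 P1 (fun x => complA g1 x /\ ~ P1 x) K2) as [In | Out].
  - apply (component_open (complA g1)); auto.
  - apply component_rel_closed; auto.
  - intros x gx. destruct (classic (P1 x)); [left; auto | right]. split; auto.
    intro g1x. apply (Hdis x). auto.
  - intros x _ [X1 [_ X2]]. auto.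
  - right.
    assert (HQ : forall x, Q1 x \/ g1 x -> Q2 x).
    { apply (component_swallows g1 g2); auto. intros x Qx gx. apply (D1 x). auto. }
    split; auto.
    apply (component_swallows g2 g1); auto.
    intros x Px gx. apply (D2 x). auto.
  - left.
    assert (HP : forall x, P1 x \/ g1 x -> P2 x).
    { apply (component_swallows g1 g2); auto. intros x Px gx. apply (Out x); auto. }
    split; auto.
    apply (component_swallows g2 g1); auto.
    intros x Qx gx. apply (D2 x). auto.
Qed.

(** * Images of separating curves under a homeomorphism *)

Lemma open_preimage (h : Ann -> Ann) (U : Ann -> Prop) :
  continuousA h -> openA U -> openA (fun x => U (h x)).
Proof.
  intros Hh HU x Ux. destruct (HU _ Ux) as [e [He HB]].
  destruct (Hh x e He) as [d [Hd Hxd]]. exists d. split; auto.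
Qed.

Lemma connected_image (f g : Ann -> Ann) (S : Ann -> Prop) :
  (forall x, g (f x) = x) -> (forall x, f (g x) = x) -> continuousA f ->
  connectedA S -> connectedA (fun x => S (g x)).
Proof.
  intros Hgf Hfg Hf HS U V HU HV Hcov Hdis.
  destruct (HS (fun x => U (f x)) (fun x => V (f x))) as [H | H].
  - apply open_preimage; auto.
  - apply open_preimage; auto.
  - intros x Sx. apply Hcov. rewrite Hgf. exact Sx.
  - intros x [Sx HUV]. apply (Hdis (f x)). rewrite Hgf. auto.
  - left. intros x Sx. rewrite <- (Hfg x). apply H. exact Sx.
  - right. intros x Sx. rewrite <- (Hfg x). apply H. exact Sx.
Qed.

Lemma component_image (f g : Ann -> Ann) (W C : Ann -> Prop) :
  (forall x, g (f x) = x) -> (forall x, f (g x) = x) -> continuousA f -> continuousA g ->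
  componentA W C -> componentA (fun x => W (g x)) (fun x => C (g x)).
Proof.
  intros Hgf Hfg Hf Hg [[x Cx] [Hsub [Hconn Hmax]]]. split; [| split; [| split]].
  - exists (f x). rewrite Hgf. exact Cx.
  - intros y Cy. auto.
  - apply (connected_image f); auto.
  - intros D HD HDW [y [Dy Cy]] z Dz.
    apply (Hmax (fun u => D (f u))).
    + apply (connected_image g); auto.
    + intros u Du. rewrite <- (Hgf u). auto.
    + exists (g y). rewrite Hfg. auto.
    + rewrite Hfg. exact Dz.
Qed.

Lemma separates_image (f g : Ann -> Ann) (c P Q : Ann -> Prop) :
  (forall x, g (f x) = x) -> (forall x, f (g x) = x) -> continuousA f -> continuousA g ->
  (forall H, exists M, forall x, (M < hA x -> H < hA (g x)) /\ (hA x < - M -> hA (g x) < - H)) ->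
  separates c P Q -> separates (fun x => c (g x)) (fun x => P (g x)) (fun x => Q (g x)).
Proof.
  intros Hgf Hfg Hf Hg Hend [[x Hx] [K [O [HP [HQ [D [H [U L]]]]]]]].
  split; [exists (f x); rewrite Hgf; exact Hx |].
  split; [apply (connected_image f); auto |].
  split; [apply (open_preimage g (complA c)); auto |].
  split; [apply (component_image f g (complA c)); auto |].
  split; [apply (component_image f g (complA c)); auto |].
  split; [intro y; apply D |].
  destruct (Hend H) as [M HM]. exists M. split; intros y Hy.
  - apply U, HM, Hy.
  - apply L, HM, Hy.
Qed.

(** The image of a band under [F 1] is bounded, so [g] sends far points to far points. The sign
    follows from [lift_ends]: a point of great height has an image of nonnegative height. *)
Lemma inverse_ends F Ft g :
  isotopy F -> isotopy_lift F Ft -> (forall x, g (F 1 x) = x) -> (forall x, F 1 (g x) = x) ->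
  continuousA (F 1) ->
  forall H, exists M, forall x, (M < hA x -> H < hA (g x)) /\ (hA x < - M -> hA (g x) < - H).
Proof.
  intros HF HL Hgf Hfg Hf H.
  destruct (lift_ends F Ft HF HL 0) as [R1 HR1].
  destruct (continuousA_height_bounded (F 1) (Rmax H R1) Hf) as [M HM].
  exists (Rmax M 0). intro x.
  pose proof (Rmax_l M 0). pose proof (Rmax_r M 0). pose proof (Rmax_l H R1). pose proof (Rmax_r H R1).
  assert (Hbig : Rmax M 0 < Rabs (hA x) -> Rmax H R1 < Rabs (hA (g x))).
  { intro Hx. apply Rnot_le_lt. intro Hle. apply HM in Hle. rewrite Hfg in Hle. lra. }
  assert (Hside : (R1 <= hA (g x) -> 0 <= hA x) /\ (hA (g x) <= - R1 -> hA x <= 0)).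
  { destruct (piA_surj (g x)) as [z Hz].
    assert (Ex : piA (Ft 1 z) = x).
    { destruct HL as [_ [Hpi _]]. rewrite Hpi by lra. rewrite Hz. apply Hfg. }
    assert (Eg : hA (g x) = snd z) by (rewrite <- Hz; reflexivity).
    assert (Eh : hA x = snd (Ft 1 z)) by (rewrite <- Ex at 1; reflexivity).
    rewrite Eg, Eh. destruct (HR1 1 z ltac:(lra)) as [A1 A2].
    split; intro; [apply A1 | replace 0 with (- 0) by ring; apply A2]; auto. }
  destruct Hside as [S1 S2].
  split; intro Hx.
  - rewrite (Rabs_pos_eq (hA x)) in Hbig by lra. specialize (Hbig Hx).
    unfold Rabs in Hbig. destruct (Rcase_abs (hA (g x))); [specialize (S2 ltac:(lra)) |]; lra.
  - rewrite (Rabs_left (hA x)) in Hbig by lra. specialize (Hbig ltac:(lra)).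
    unfold Rabs in Hbig. destruct (Rcase_abs (hA (g x))); [| specialize (S1 ltac:(lra))]; lra.
Qed.

Lemma component_through (W : Ann -> Prop) (x : Ann) : W x -> exists C, componentA W C /\ C x.
Proof.
  intro Wx.
  exists (fun y => exists D, connectedA D /\ (forall u, D u -> W u) /\ D x /\ D y).
  assert (Hpt : connectedA (fun y => y = x)).
  { intros U V HU HV Hcov Hdis. destruct (Hcov x eq_refl); [left | right]; intros y ->; auto. }
  assert (Hcx : exists D, connectedA D /\ (forall u, D u -> W u) /\ D x /\ D x).
  { exists (fun y => y = x). split; auto. split; [intros u ->; auto |]. auto. }
  assert (Hconn : connectedA (fun y => exists D, connectedA D /\ (forall u, D u -> W u) /\ D x /\ D y)).
  { intros U V HU HV Hcov Hdis.
    assert (Hsub : forall D, connectedA D -> (forall u, D u -> W u) -> D x ->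
      (forall y, D y -> U y) \/ (forall y, D y -> V y)).
    { intros D HD HDW Dx. apply HD; auto.
      - intros y Dy. apply Hcov. exists D; auto.
      - intros y [Dy HUV]. apply (Hdis y). split; auto. exists D; auto. }
    destruct (Hcov x Hcx) as [Ux | Vx].
    - left. intros y [D [HD [HDW [Dx Dy]]]]. destruct (Hsub D HD HDW Dx) as [H | H]; auto.
      exfalso. apply (Hdis x). auto.
    - right. intros y [D [HD [HDW [Dx Dy]]]]. destruct (Hsub D HD HDW Dx) as [H | H]; auto.
      exfalso. apply (Hdis x). auto. }
  split; auto. split; [exists x; auto |]. split.
  { intros y [D [_ [HDW [_ Dy]]]]. auto. }
  split; auto.
  intros D HD HDW [y [Dy [D' [HD' [HDW' [Dx' Dy']]]]]] z Dz.
  exists (fun u => D u \/ D' u). split; [| split; [intros u []; auto | auto]].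
  intros U V HU HV Hcov Hdis.
  assert (S1 : (forall u, D u -> U u) \/ (forall u, D u -> V u)).
  { apply HD; auto. intros u [Du HUV]. apply (Hdis u). auto. }
  assert (S2 : (forall u, D' u -> U u) \/ (forall u, D' u -> V u)).
  { apply HD'; auto. intros u [Du HUV]. apply (Hdis u). auto. }
  destruct S1 as [S1 | S1]; destruct S2 as [S2 | S2].
  - left. intros u []; auto.
  - exfalso. apply (Hdis y). auto.
  - exfalso. apply (Hdis y). auto.
  - right. intros u []; auto.
Qed.

(** A component of the complement of both curves that meets [P1] or [Q2] contains it, so it is
    unbounded. One that goes above [H1] or below [- H2] meets [P1] or [Q2], hence lies in it. *)
Lemma closed_annulus_compl (g1 P1 Q1 g2 P2 Q2 : Ann -> Prop) :
  separates g1 P1 Q1 -> separates g2 P2 Q2 ->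
  (forall x, P1 x \/ g1 x -> P2 x) -> (forall x, Q2 x \/ g2 x -> Q1 x) ->
  forall x, closed_annulus g1 g2 x <-> ~ P1 x /\ ~ Q2 x.
Proof.
  intros [N1 [K1 [O1 [HP1 [HQ1 [D1 [H1 [U1 L1]]]]]]]] [N2 [K2 [O2 [HP2 [HQ2 [D2 [H2 [U2 L2]]]]]]]] HP HQ x.
  assert (HP1g : forall y, P1 y -> ~ g1 y /\ ~ g2 y).
  { intros y Py. split; [apply HP1; exact Py |]. intro gy. apply (D1 y). auto. }
  assert (HQ2g : forall y, Q2 y -> ~ g1 y /\ ~ g2 y).
  { intros y Qy. split; [| apply HQ2; exact Qy]. intro gy. apply (D2 y). auto. }
  assert (Hub : forall C : Ann -> Prop, boundedA C -> (forall y, P1 y -> C y) -> False).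
  { intros C Hb HC. destruct (bounded_height C Hb) as [M HM].
    set (t := Rmax H1 M + 1). pose proof (Rmax_l H1 M). pose proof (Rmax_r H1 M).
    specialize (HM (piA (0, t))). rewrite hA_piA in HM. simpl in HM.
    assert (Ht : Rabs t <= M) by (apply HM, HC, U1; rewrite hA_piA; simpl; unfold t; lra).
    apply Rabs_bounds in Ht. unfold t in Ht. lra. }
  assert (Hub' : forall C : Ann -> Prop, boundedA C -> (forall y, Q2 y -> C y) -> False).
  { intros C Hb HC. destruct (bounded_height C Hb) as [M HM].
    set (t := Rmax H2 M + 1). pose proof (Rmax_l H2 M). pose proof (Rmax_r H2 M).
    specialize (HM (piA (0, - t))). rewrite hA_piA in HM. simpl in HM.
    assert (Ht : Rabs (- t) <= M) by (apply HM, HC, L2; rewrite hA_piA; simpl; unfold t; lra).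
    apply Rabs_bounds in Ht. unfold t in Ht. lra. }
  split.
  - intros [gx | [gx | [C [HC [Hb Cx]]]]].
    + split; intro Hx; [apply HP1g in Hx | apply HQ2g in Hx]; tauto.
    + split; intro Hx; [apply HP1g in Hx | apply HQ2g in Hx]; tauto.
    + destruct HC as [_ [_ [_ Hmax]]]. split; intro Hx.
      * apply (Hub C Hb). apply Hmax; auto; [apply HP1 | exists x; auto].
      * apply (Hub' C Hb). apply Hmax; auto; [apply HQ2 | exists x; auto].
  - intros [NP NQ]. unfold closed_annulus.
    destruct (classic (g1 x)) as [| N1x]; auto. destruct (classic (g2 x)) as [| N2x]; auto.
    right; right.
    destruct (component_through (fun y => ~ g1 y /\ ~ g2 y) x) as [C [HC Cx]]; auto.
    exists C. split; auto. split; auto.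
    destruct HC as [_ [HCs [HCc _]]].
    apply bounded_of_height with (Rmax H1 H2). intros y Cy.
    pose proof (Rmax_l H1 H2). pose proof (Rmax_r H1 H2).
    apply Rabs_le. split; apply Rnot_lt_le; intro Hy.
    + apply NQ. destruct HQ2 as [_ [_ [_ Hmax]]]. apply (Hmax C); auto.
      * intros u Cu. apply HCs, Cu.
      * exists y. split; auto. apply L2. lra.
    + apply NP. destruct HP1 as [_ [_ [_ Hmax]]]. apply (Hmax C); auto.
      * intros u Cu. apply HCs, Cu.
      * exists y. split; auto. apply U1. lra.
Qed.

(* [P] and [Q] are the components of the complement of the two curves that contain the upper and
   the lower end, [Pb] and [Qb] their unions with the adjacent curve. *)
Record annulus_between (f g : Ann -> Ann) (P Pb Q Qb : Ann -> Prop) (H : R) : Prop := {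
  ab_gf : forall x, g (f x) = x;
  ab_fg : forall x, f (g x) = x;
  ab_f : continuousA f;
  ab_g : continuousA g;
  ab_P : openA P;
  ab_Q : openA Q;
  ab_Pb : openA (fun x => ~ Pb x);
  ab_Qb : openA (fun x => ~ Qb x);
  ab_PPb : forall x, P x -> Pb x;
  ab_QQb : forall x, Q x -> Qb x;
  ab_PQ : forall x, ~ (Pb x /\ Qb x);
  ab_Pc : connectedA P;
  ab_Qc : connectedA Q;
  ab_Pcc : connectedA (fun x => ~ P x);
  ab_Qcc : connectedA (fun x => ~ Q x);
  ab_Ac : connectedA (fun x => ~ P x /\ ~ Q x);
  ab_Pend : forall x, H < hA x -> P x;
  ab_Qend : forall x, hA x < - H -> Q x }.

Lemma annulus_between_ordered F Ft g (c1 P1 Q1 c2 P2 Q2 : Ann -> Prop) :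
  isotopy F -> isotopy_lift F Ft ->
  (forall x, g (F 1 x) = x) -> (forall x, F 1 (g x) = x) -> continuousA (F 1) -> continuousA g ->
  separates c1 P1 Q1 -> separates c2 P2 Q2 ->
  (forall x, P1 x \/ c1 x -> P2 x) -> (forall x, Q2 x \/ c2 x -> Q1 x) ->
  f_free (F 1) c1 -> f_free (F 1) c2 ->
  exists P Pb Q Qb H, annulus_between (F 1) g P Pb Q Qb H /\
    (forall x, closed_annulus c1 c2 x <-> ~ P x /\ ~ Q x) /\
    ((forall x, Pb x -> P (F 1 x)) \/ (forall x, Pb x -> P (g x))) /\
    ((forall x, Qb x -> Q (F 1 x)) \/ (forall x, Qb x -> Q (g x))).
Proof.
  intros HF HL Hgf Hfg Hf Hg S1 S2 HP HQ Hfree1 Hfree2.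
  pose proof (inverse_ends F Ft g HF HL Hgf Hfg Hf) as Hend.
  pose proof (separates_image (F 1) g c1 P1 Q1 Hgf Hfg Hf Hg Hend S1) as I1.
  pose proof (separates_image (F 1) g c2 P2 Q2 Hgf Hfg Hf Hg Hend S2) as I2.
  assert (F1 : forall x, ~ (c1 x /\ c1 (g x))).
  { intros x [X1 X2]. apply (Hfree1 (g x) X2). rewrite Hfg. exact X1. }
  assert (F2 : forall x, ~ (c2 x /\ c2 (g x))).
  { intros x [X1 X2]. apply (Hfree2 (g x) X2). rewrite Hfg. exact X1. }
  pose proof (separates_order _ _ _ _ _ _ S1 I1 F1) as O1.
  pose proof (separates_order _ _ _ _ _ _ S2 I2 F2) as O2.
  pose proof (closed_annulus_compl _ _ _ _ _ _ S1 S2 HP HQ) as HA.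
  destruct S1 as [N1 [K1 [Op1 [HP1 [HQ1 [D1 [H1 [U1 L1]]]]]]]].
  destruct S2 as [N2 [K2 [Op2 [HP2 [HQ2 [D2 [H2 [U2 L2]]]]]]]].
  assert (oPb : openA (fun x => ~ (P1 x \/ c1 x))).
  { apply openA_ext with (fun x => complA c1 x /\ ~ P1 x).
    - intro x. unfold complA. tauto.
    - apply component_rel_closed; auto. }
  assert (oQb : openA (fun x => ~ (Q2 x \/ c2 x))).
  { apply openA_ext with (fun x => complA c2 x /\ ~ Q2 x).
    - intro x. unfold complA. tauto.
    - apply component_rel_closed; auto. }
  assert (HPQb : forall x, ~ ((P1 x \/ c1 x) /\ (Q2 x \/ c2 x))).
  { intros x [X1 X2]. apply HP in X1. destruct X2 as [X2 | X2]; [apply (D2 x); auto |].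
    destruct HP2 as [_ [Hsub _]]. apply (Hsub x X1). exact X2. }
  assert (oP : openA P1) by (apply (component_open (complA c1)); auto).
  assert (oQ : openA Q2) by (apply (component_open (complA c2)); auto).
  exists P1, (fun x => P1 x \/ c1 x), Q2, (fun x => Q2 x \/ c2 x), (Rmax H1 H2).
  pose proof (Rmax_l H1 H2). pose proof (Rmax_r H1 H2).
  split; [| split; [exact HA | split]].
  - constructor; auto.
    + apply HP1.
    + apply HQ2.
    + apply (component_compl_connected c1); auto.
    + apply (component_compl_connected c2); auto.
    + apply (between_components_connected c1 c2); auto.
      * intros x cx Px. destruct HP1 as [_ [Hsub _]]. apply (Hsub x Px cx).
      * intros x cx Qx. destruct HQ2 as [_ [Hsub _]]. apply (Hsub x Qx cx).
    + intros x Hx. apply U1. lra.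
    + intros x Hx. apply L2. lra.
  (* The order between a curve and its image tells whether [F 1] or its inverse maps the side into
     itself. *)
  - destruct O1 as [[O1 _] | [O1 _]]; [right; exact O1 | left].
    intros x Hx. apply O1. rewrite Hgf. exact Hx.
  - destruct O2 as [[_ O2] | [_ O2]]; [left | right; exact O2].
    intros x Hx. apply O2. rewrite Hgf. exact Hx.
Qed.

Lemma annulus_between_exists F Ft gp gm :
  isotopy F -> isotopy_lift F Ft -> jordan_curve gp -> jordan_curve gm ->
  essential gp -> essential gm -> (forall x, ~ (gp x /\ gm x)) ->
  f_free (F 1) gp -> f_free (F 1) gm ->
  exists g P Pb Q Qb H, annulus_between (F 1) g P Pb Q Qb H /\
    (forall x, closed_annulus gp gm x <-> ~ P x /\ ~ Q x) /\
    ((forall x, Pb x -> P (F 1 x)) \/ (forall x, Pb x -> P (g x))) /\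
    ((forall x, Qb x -> Q (F 1 x)) \/ (forall x, Qb x -> Q (g x))).
Proof.
  intros HF HL Jp Jm Ep Em Hdis Fp Fm.
  destruct (essential_separates gp Jp Ep) as [P1 [Q1 S1]].
  destruct (essential_separates gm Jm Em) as [P2 [Q2 S2]].
  pose proof HF as [HF0 [Hhom HFc]].
  destruct (Hhom 1 ltac:(lra)) as [g [Hgf [Hfg [Hf Hg]]]].
  exists g.
  destruct (separates_order _ _ _ _ _ _ S1 S2 Hdis) as [[O1 O2] | [O1 O2]].
  - apply (annulus_between_ordered F Ft g gp P1 Q1 gm P2 Q2); auto.
  - destruct (annulus_between_ordered F Ft g gm P2 Q2 gp P1 Q1)
      as [P [Pb [Q [Qb [H [HA [HC Hdir]]]]]]]; auto.
    exists P, Pb, Q, Qb, H. split; auto. split; auto.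
    intro x. rewrite <- HC. unfold closed_annulus.
    assert (Hcomp : forall C, componentA (fun y => ~ gp y /\ ~ gm y) C
      <-> componentA (fun y => ~ gm y /\ ~ gp y) C).
    { intro C. split; intros [C1 [C2 [C3 C4]]]; (split; [exact C1 |]);
        (split; [intros y Cy; specialize (C2 y Cy); tauto |]); (split; [exact C3 |]);
        intros D HD HDs; apply C4; auto; intros y Dy; specialize (HDs y Dy); tauto. }
    split; intros [X | [X | [C [X Y]]]]; auto; right; right; exists C; split; auto; apply Hcomp; exact X.
Qed.

(** * Chains attached to the ends *)

Inductive reachA (S : Ann -> Prop) (e : R) : Ann -> Ann -> Prop :=
| reach_refl x : S x -> reachA S e x x
| reach_step x y z : S x -> distA x y < e -> reachA S e y z -> reachA S e x z.

Lemma reachA_snoc S e x y z : reachA S e x y -> S z -> distA y z < e -> reachA S e x z.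
Proof.
  induction 1 as [x Sx | x y u Sx Hd _ IH]; intros Sz Hz.
  - apply reach_step with z; auto. apply reach_refl; auto.
  - apply reach_step with y; auto.
Qed.

Lemma reachA_sub (S S' : Ann -> Prop) e e' x y :
  (forall u, S u -> S' u) -> e <= e' -> reachA S e x y -> reachA S' e' x y.
Proof.
  intros HS He. induction 1 as [x Sx | x y u Sx Hd _ IH].
  - apply reach_refl; auto.
  - apply reach_step with y; auto. lra.
Qed.

(** Within [S], the points reachable from [x] and the other points have disjoint neighbourhoods of
    radius [e / 2], so there are no other points. *)
Lemma connected_reachA S e x y : connectedA S -> 0 < e -> S x -> S y -> reachA S e x y.
Proof.
  intros HS He Sx Sy.
  set (near_some := fun (T : Ann -> Prop) u => exists v, T v /\ distA v u < e / 2).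
  assert (Hopen : forall T, openA (near_some T)).
  { intros T u [v [Tv Hv]]. exists (e / 2 - distA v u). split; [lra |].
    intros u' Hu'. exists v. split; auto. pose proof (distA_tri v u u'). lra. }
  set (T1 := fun v => reachA S e x v).
  set (T2 := fun v => S v /\ ~ reachA S e x v).
  assert (Hself : forall (T : Ann -> Prop) u, T u -> near_some T u).
  { intros T u Tu. exists u. rewrite distA_refl. split; auto. lra. }
  destruct (HS (near_some T1) (near_some T2) (Hopen T1) (Hopen T2)) as [H | H].
  - intros u Su. destruct (classic (reachA S e x u)); [left | right]; apply Hself; auto.
    split; auto.
  - intros u [Su [[v [Tv Hv]] [v' [[Sv' Tv'] Hv']]]]. apply Tv'.
    apply reachA_snoc with u; auto; [| rewrite distA_sym; lra].
    apply reachA_snoc with v; auto. lra.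
  - destruct (H y Sy) as [v [Tv Hv]]. apply reachA_snoc with v; auto. lra.
  - exfalso. destruct (H x Sx) as [v [[Sv NTv] Hv]]. apply NTv.
    apply reach_step with v; auto; [rewrite distA_sym; lra |]. apply reach_refl; auto.
Qed.

Definition continuousR (phi : Ann -> R) : Prop :=
  forall x eps, 0 < eps -> exists d, 0 < d /\ forall y, distA x y < d -> Rabs (phi x - phi y) < eps.

Lemma continuousA_iter (h : Ann -> Ann) n : continuousA h -> continuousA (Nat.iter n h).
Proof.
  intro Hh. induction n as [| n IH]; intros x eps Heps; simpl.
  - exists eps. auto.
  - destruct (Hh (Nat.iter n h x) eps Heps) as [d [Hd Hhd]].
    destruct (IH x d Hd) as [d' [Hd' IHd]]. exists d'. split; auto.
Qed.

Lemma open_positive (phi : Ann -> R) (h : Ann -> Ann) :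
  continuousR phi -> continuousA h -> openA (fun x => 0 < phi (h x)).
Proof.
  intros Hphi Hh x Hx. destruct (Hphi (h x) (phi (h x)) Hx) as [d [Hd Hd']].
  destruct (Hh x d Hd) as [d1 [Hd1 Hd1']]. exists d1. split; auto. intros y Hy.
  specialize (Hd' (h y) (Hd1' y Hy)). apply Rabs_def2 in Hd'. lra.
Qed.

Lemma continuousR_opp (phi : Ann -> R) : continuousR phi -> continuousR (fun x => - phi x).
Proof.
  intros H x eps Heps. destruct (H x eps Heps) as [d [Hd Hy]]. exists d. split; auto.
  intros y Hxy. rewrite <- Rabs_Ropp. replace (- _) with (phi x - phi y) by ring. auto.
Qed.

Lemma iter_cancel {T : Type} (h k : T -> T) (n : nat) (x : T) :
  (forall x, k (h x) = x) -> Nat.iter n k (Nat.iter n h x) = x.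
Proof.
  intro Hkh. revert x. induction n as [| n IH]; intro x; auto.
  rewrite Nat.iter_succ_r. simpl. rewrite Hkh. apply IH.
Qed.

Lemma iter_cancel_le {T : Type} (h k : T -> T) (i n : nat) (x : T) :
  (forall x, k (h x) = x) -> (i <= n)%nat -> Nat.iter i k (Nat.iter n h x) = Nat.iter (n - i) h x.
Proof.
  intros Hkh Hi. remember (n - i)%nat as j eqn:Ej. replace n with (i + j)%nat by lia.
  rewrite Nat.iter_add. apply iter_cancel; exact Hkh.
Qed.

(** Finite-time form of the invariance of the sign of [phi] on the maximal invariant set. It also
    forces [phi] not to vanish at the points concerned. *)
Definition sign_rigid (h k : Ann -> Ann) (P Q : Ann -> Prop) (phi : Ann -> R) (m : nat) : Prop :=
  forall x, (forall i, (i <= m)%nat -> (~ P (Nat.iter i h x) /\ ~ Q (Nat.iter i h x)) /\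
                                   (~ P (Nat.iter i k x) /\ ~ Q (Nat.iter i k x))) ->
    0 < phi x * phi (h x) /\ 0 < phi x * phi (k x).

Lemma sign_rigid_opp h k P Q phi m :
  sign_rigid h k P Q phi m -> sign_rigid h k P Q (fun x => - phi x) m.
Proof. intros Hs x Hx. destruct (Hs x Hx). split; nra. Qed.

Lemma sign_rigid_swap h k P Q phi m :
  sign_rigid h k P Q phi m -> sign_rigid k h Q P phi m.
Proof.
  intros Hs x Hx. destruct (Hs x).
  - intros i Hi. destruct (Hx i Hi) as [[? ?] [? ?]]. auto.
  - split; auto.
Qed.

(* A finite-time version of the set of points whose forward orbit never enters [P], restricted to one
   sign of [phi] and completed by [Q]. *)
Definition attached (h : Ann -> Ann) (P Q : Ann -> Prop) (phi : Ann -> R) (m : nat) (x : Ann) : Prop :=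
  Q x \/ (~ P (Nat.iter (2 * m) h x) /\ 0 < phi (Nat.iter m h x)).

Definition pushes (h k : Ann -> Ann) (P Pb Q Qb : Ann -> Prop) : Prop :=
  (forall x, k (h x) = x) /\ (forall x, h (k x) = x) /\
  (forall x, P x -> Pb x) /\ (forall x, Q x -> Qb x) /\
  (forall x, Pb x -> P (h x)) /\ (forall x, Qb x -> Q (k x)).

Lemma pushes_swap h k P Pb Q Qb : pushes h k P Pb Q Qb -> pushes k h Q Qb P Pb.
Proof. intros [? [? [? [? [? ?]]]]]. repeat split; auto. Qed.

Lemma iter_P h k P Pb Q Qb n x : pushes h k P Pb Q Qb -> P x -> P (Nat.iter n h x).
Proof.
  intros [_ [_ [HPP [_ [HPh _]]]]] Px.
  induction n as [| n IH]; simpl; auto.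
Qed.

Lemma not_P_earlier h k P Pb Q Qb n j x :
  pushes h k P Pb Q Qb -> (j <= n)%nat -> ~ P (Nat.iter n h x) -> ~ P (Nat.iter j h x).
Proof.
  intros Hpush Hj HN HP. apply HN. replace n with ((n - j) + j)%nat by lia.
  rewrite Nat.iter_add. apply (iter_P h k P Pb Q Qb); assumption.
Qed.

Lemma not_Q_later h k P Pb Q Qb n x : pushes h k P Pb Q Qb -> ~ Q x -> ~ Q (Nat.iter n h x).
Proof.
  intros [Hkh [_ [_ [HQQ [_ HQk]]]]] NQ.
  induction n as [| n IH]; simpl; auto.
  intro HQ. apply IH. rewrite <- (Hkh (Nat.iter n h x)). auto.
Qed.

(** The forward orbit of a point outside [Q] never meets [Q], and this one has not met [P] by time
    [2 * m]; so its point at time [m] has [m] free steps on each side. This is why [attached] reads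
    the sign in the middle of a segment of length [2 * m]. *)
Lemma rigid_middle h k P Pb Q Qb phi m x :
  pushes h k P Pb Q Qb -> sign_rigid h k P Q phi m ->
  ~ P (Nat.iter (2 * m) h x) -> ~ Q x ->
  0 < phi (Nat.iter m h x) * phi (h (Nat.iter m h x)) /\
  0 < phi (Nat.iter m h x) * phi (k (Nat.iter m h x)).
Proof.
  intros Hpush Hrigid NP NQ. apply Hrigid. intros i Hi.
  rewrite <- Nat.iter_add, iter_cancel_le by (try apply Hpush; lia).
  repeat split; try (apply (not_P_earlier h k P Pb Q Qb (2 * m)); auto; lia);
    apply (not_Q_later h k P Pb Q Qb); assumption.
Qed.

(** Each of the first [m] iterates still has [m] free steps on both sides, so the sign is carried
    from one to the next. *)
Lemma rigid_forward h k P Q phi m x :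
  (forall x, k (h x) = x) -> sign_rigid h k P Q phi m ->
  (forall i, (i <= 2 * m)%nat -> (~ P (Nat.iter i h x) /\ ~ Q (Nat.iter i h x)) /\
                                 (~ P (Nat.iter i k x) /\ ~ Q (Nat.iter i k x))) ->
  phi x <> 0 /\ forall j, (j <= m)%nat -> 0 < phi x * phi (Nat.iter j h x).
Proof.
  intros Hkh Hrigid Hx.
  assert (Hgood : forall j, (j <= m)%nat -> 0 < phi (Nat.iter j h x) * phi (h (Nat.iter j h x))).
  { intros j Hj. apply Hrigid. intros i Hi. rewrite <- Nat.iter_add.
    split; [apply Hx; lia |].
    destruct (Nat.le_gt_cases i j) as [Hij | Hij].
    - rewrite iter_cancel_le by auto. apply Hx; lia.
    - replace i with ((i - j) + j)%nat by lia. rewrite Nat.iter_add, iter_cancel by auto.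
      apply Hx; lia. }
  assert (H0 : phi x <> 0).
  { intro E. pose proof (Hgood 0%nat ltac:(lia)) as Hg. simpl in Hg. rewrite E in Hg. lra. }
  split; auto. induction j as [| j IH]; intro Hj.
  - simpl. nra.
  - specialize (IH ltac:(lia)). specialize (Hgood j ltac:(lia)). simpl.
    set (a := phi (Nat.iter j h x)) in *. set (b := phi (h (Nat.iter j h x))) in *.
    destruct (Rtotal_order 0 a) as [Ha | [Ha | Ha]]; [nra | subst a; rewrite <- Ha in *; lra | nra].
Qed.

(** Replacing [x] by [h x] shifts the backward segment by one step, and rigidity in its middle keeps
    the sign. This invariance is what [lifted_transport] needs when [F 1] is [h]. *)
Lemma attached_invariant h k P Pb Q Qb phi m x :
  pushes h k P Pb Q Qb -> sign_rigid h k P Q phi m ->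
  attached k Q P phi m x -> attached k Q P phi m (h x).
Proof.
  intros Hpush Hrigid Hx. pose proof Hpush as [Hkh [Hhk [HPP [HQQ [HPh HQk]]]]].
  unfold attached. destruct (classic (P (h x))) as [| NPh]; [left; assumption | right].
  assert (NP : ~ P x) by auto.
  destruct Hx as [| [NQ Hphi]]; [contradiction |].
  assert (Hshift : forall n, Nat.iter (S n) k (h x) = Nat.iter n k x).
  { intro n. rewrite Nat.iter_succ_r, Hkh. reflexivity. }
  destruct m as [| m'].
  - simpl in *. split; auto.
    + intro Qh. apply NQ. rewrite <- (Hkh x). auto.
    + destruct (Hrigid x) as [Hg _]; [| nra].
      intros i Hi. replace i with 0%nat by lia. simpl. auto.
  - replace (2 * S m')%nat with (S (2 * m' + 1)) by lia. rewrite !Hshift. split.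
    + apply (not_P_earlier k h Q Qb P Pb (2 * S m')); auto; [apply pushes_swap; auto | lia].
    + destruct (rigid_middle k h Q Qb P Pb phi (S m') x) as [_ Hg]; auto.
      * apply pushes_swap; auto.
      * apply sign_rigid_swap; auto.
      * simpl in Hg. rewrite Hhk in Hg. simpl in Hphi. nra.
Qed.

Lemma open_iter_preimage (h : Ann -> Ann) (U : Ann -> Prop) n :
  continuousA h -> openA U -> openA (fun x => U (Nat.iter n h x)).
Proof. intros Hh HU. apply (open_preimage (Nat.iter n h)); auto. apply continuousA_iter; auto. Qed.

(** Every point has a neighbourhood missing one of the two sets, and a Lebesgue number then
    separates them. The delicate points are those whose orbit stays outside [P] and [Q] for [2 * m]
    steps both ways: there the signs of [phi] at times [m] and [- m] are that of [phi x0], whereas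
    the two sets require opposite signs. *)
Lemma attached_separated h k P Pb Q Qb phi m H :
  pushes h k P Pb Q Qb -> sign_rigid h k P Q phi m -> (1 <= m)%nat ->
  continuousA h -> continuousA k -> continuousR phi ->
  openA P -> openA Q -> openA (fun x => ~ Pb x) -> openA (fun x => ~ Qb x) ->
  (forall x, ~ (Pb x /\ Qb x)) -> (forall x, H < hA x -> P x) -> (forall x, hA x < - H -> Q x) ->
  exists d, 0 < d /\ forall x y, attached h P Q phi m x ->
    attached k Q P (fun u => - phi u) m y -> d <= distA x y.
Proof.
  intros Hpush Hrigid Hm Hh Hk Hphi oP oQ oPb oQb Hdis HP HQ.
  pose proof Hpush as [Hkh [Hhk [HPP [HQQ [HPh HQk]]]]].
  pose proof (pushes_swap _ _ _ _ _ _ Hpush) as Hpush'.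
  destruct (lebesgue_annulus
    (fun x y => ~ (attached h P Q phi m x /\ attached k Q P (fun u => - phi u) m y)) (Rabs H + 1))
    as [e [He Hleb]].
  - assert (Hred : forall U : Ann -> Prop, openA U ->
      (forall y, U y -> ~ attached h P Q phi m y) \/
      (forall y, U y -> ~ attached k Q P (fun u => - phi u) m y) ->
      forall x0, U x0 -> exists r, 0 < r /\ forall x y, distA x0 x < r -> distA x0 y < r ->
        ~ (attached h P Q phi m x /\ attached k Q P (fun u => - phi u) m y)).
    { intros U oU HU x0 Ux0. destruct (oU x0 Ux0) as [r [Hr HB]]. exists r. split; auto.
      intros x y Hx Hy [E G]. destruct HU as [HU | HU]; [apply (HU x) | apply (HU y)]; auto. }
    intro x0.
    destruct (classic (Qb x0)) as [Qb0 | NQb0].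
    { apply (Hred (fun y => Q (Nat.iter (2 * m) k y) /\ ~ Pb y)).
      - apply openA_and; auto. apply open_iter_preimage; auto.
      - right. intros y [Qy NPy] [Py | [NQ _]]; auto.
      - split; [| intro; apply (Hdis x0); auto].
        replace (2 * m)%nat with (S (2 * m - 1)) by lia. rewrite Nat.iter_succ_r.
        apply (iter_P k h Q Qb P Pb); auto. }
    destruct (classic (Pb x0)) as [Pb0 | NPb0].
    { apply (Hred (fun y => P (Nat.iter (2 * m) h y) /\ ~ Qb y)).
      - apply openA_and; auto. apply open_iter_preimage; auto.
      - left. intros y [Py NQy] [Qy | [NP _]]; auto.
      - split; [| intro; apply (Hdis x0); auto].
        replace (2 * m)%nat with (S (2 * m - 1)) by lia. rewrite Nat.iter_succ_r.
        apply (iter_P h k P Pb Q Qb); auto. }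
    destruct (classic (P (Nat.iter (2 * m) h x0))) as [P2 | NP2].
    { apply (Hred (fun y => P (Nat.iter (2 * m) h y) /\ ~ Qb y)); auto.
      - apply openA_and; auto. apply open_iter_preimage; auto.
      - left. intros y [Py NQy] [Qy | [NP _]]; auto. }
    destruct (classic (Q (Nat.iter (2 * m) k x0))) as [Q2 | NQ2].
    { apply (Hred (fun y => Q (Nat.iter (2 * m) k y) /\ ~ Pb y)); auto.
      - apply openA_and; auto. apply open_iter_preimage; auto.
      - right. intros y [Qy NPy] [Py | [NQ _]]; auto. }
    assert (NP0 : ~ P x0) by auto. assert (NQ0 : ~ Q x0) by auto.
    assert (Horb : forall i, (i <= 2 * m)%nat ->
      (~ P (Nat.iter i h x0) /\ ~ Q (Nat.iter i h x0)) /\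
      (~ P (Nat.iter i k x0) /\ ~ Q (Nat.iter i k x0))).
    { intros i Hi. repeat split.
      - apply (not_P_earlier h k P Pb Q Qb (2 * m)); auto.
      - apply (not_Q_later h k P Pb Q Qb); auto.
      - apply (not_Q_later k h Q Qb P Pb); auto.
      - apply (not_P_earlier k h Q Qb P Pb (2 * m)); auto. }
    destruct (rigid_forward h k P Q phi m x0 Hkh Hrigid Horb) as [Hne Hfw].
    destruct (rigid_forward k h Q P phi m x0 Hhk (sign_rigid_swap _ _ _ _ _ _ Hrigid)) as [_ Hbw].
    { intros i Hi. destruct (Horb i Hi) as [[? ?] [? ?]]. auto. }
    specialize (Hfw m (le_n m)). specialize (Hbw m (le_n m)).
    destruct (Rlt_dec 0 (phi x0)) as [Hpos | Hneg].
    + apply (Hred (fun y => 0 < phi (Nat.iter m k y) /\ ~ Pb y)).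
      * apply openA_and; auto. apply open_positive; auto. apply continuousA_iter; auto.
      * right. intros y [Hy NPy] [Py | [_ Hlt]]; [auto | lra].
      * split; auto. nra.
    + apply (Hred (fun y => 0 < - phi (Nat.iter m h y) /\ ~ Qb y)).
      * apply openA_and; auto.
        apply (open_positive (fun u => - phi u)); [apply continuousR_opp; auto |].
        apply continuousA_iter; auto.
      * left. intros y [Hy NQy] [Qy | [_ Hlt]]; [auto | lra].
      * split; auto. nra.
  (* With a distance below 1, the facts that [x] is not in [P] and [y] is not in [Q] confine [x] to
     the band of height [Rabs H + 1]. *)
  - exists (Rmin e 1). split; [apply Rmin_pos; lra |].
    intros x y E G. apply Rnot_lt_le. intro Hxy.
    pose proof (Rmin_l e 1). pose proof (Rmin_r e 1).
    assert (NPx : ~ P x).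
    { destruct E as [Qx | [NP _]]; [intro Px; apply (Hdis x); auto |].
      apply (not_P_earlier h k P Pb Q Qb (2 * m) 0); auto. lia. }
    assert (NQy : ~ Q y).
    { destruct G as [Py | [NQ _]]; [intro Qy; apply (Hdis y); auto |].
      apply (not_P_earlier k h Q Qb P Pb (2 * m) 0); auto. lia. }
    apply (Hleb x y); auto; [| lra].
    assert (hA x <= H) by (apply Rnot_lt_le; auto).
    assert (- H <= hA y) by (apply Rnot_lt_le; auto).
    pose proof (hA_dist x y) as Hxyh. apply Rabs_bounds in Hxyh. pose proof (Rle_abs H).
    pose proof (Rle_abs (- H)) as Ha. rewrite Rabs_Ropp in Ha. apply Rabs_le. lra.
Qed.

(** The points outside [P] at time [2 * m] form a homeomorphic image of the complement of [P], so
    they are chain connected. On a fine chain the sign at time [m] cannot change outside [Q]; hence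
    the chain stays attached until it enters [Q], which is itself connected. *)
Lemma attached_reaches h k P Pb Q Qb phi m H e x q :
  pushes h k P Pb Q Qb -> sign_rigid h k P Q phi m ->
  continuousA h -> continuousA k -> continuousR phi ->
  openA P -> openA Q -> connectedA (fun x => ~ P x) -> connectedA Q ->
  (forall x, ~ (Pb x /\ Qb x)) -> (forall x, ~ P x -> ~ Q x -> Rabs (hA x) <= H) ->
  0 < e -> attached h P Q phi m x -> Q q -> reachA (attached h P Q phi m) e x q.
Proof.
  intros Hpush Hrigid Hh Hk Hphi oP oQ cP cQ Hdis Hbd He Hx Qq.
  pose proof Hpush as [Hkh [Hhk [HPP [HQQ [HPh HQk]]]]].
  set (L := fun u => ~ P (Nat.iter (2 * m) h u)).
  assert (Hnz : forall u, L u -> ~ Q u -> phi (Nat.iter m h u) <> 0).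
  { intros u Lu NQ E. destruct (rigid_middle h k P Pb Q Qb phi m u) as [Hg _]; auto.
    rewrite E in Hg. lra. }
  destruct (lebesgue_annulus (fun u v => L u -> ~ Q u -> L v -> ~ Q v ->
    0 < phi (Nat.iter m h u) -> 0 < phi (Nat.iter m h v)) H) as [e0 [He0 Hsign]].
  { intro x0. destruct (classic (P (Nat.iter (2 * m) h x0))) as [P0 | L0].
    { destruct (open_iter_preimage h P (2 * m) Hh oP x0 P0) as [r [Hr HB]].
      exists r. split; auto. intros u v Hu _ Lu. exfalso. apply Lu, HB, Hu. }
    destruct (classic (Q x0)) as [Q0 | NQ0].
    { destruct (oQ x0 Q0) as [r [Hr HB]]. exists r. split; auto.
      intros u v Hu _ _ NQu. exfalso. apply NQu, HB, Hu. }
    pose proof (Hnz x0 L0 NQ0) as H0. pose proof (continuousA_iter h m Hh) as Hhm.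
    destruct (Rlt_dec 0 (phi (Nat.iter m h x0))) as [Hpos | Hneg].
    - destruct (open_positive phi _ Hphi Hhm x0 Hpos) as [r [Hr HB]]. exists r. split; auto.
    - destruct (open_positive _ _ (continuousR_opp _ Hphi) Hhm x0) as [r [Hr HB]]; [lra |].
      exists r. split; auto. intros u v Hu _ _ _ _ _ Hlt. specialize (HB u Hu). simpl in HB. lra. }
  set (e1 := Rmin e e0).
  assert (He1 : 0 < e1 /\ e1 <= e /\ e1 <= e0).
  { unfold e1. split; [apply Rmin_pos; auto | split; [apply Rmin_l | apply Rmin_r]]. }
  apply (reachA_sub (attached h P Q phi m) _ e1); auto; [lra |].
  assert (Hin : forall u, Q u -> reachA (attached h P Q phi m) e1 u q).
  { intros u Qu. apply (reachA_sub Q _ e1); [intros; left; auto | lra |].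
    apply connected_reachA; auto; lra. }
  destruct Hx as [Qx | [Lx Hpos]]; [apply Hin; exact Qx |].
  (* A target for the chain: [t] is in [Q], as [k] maps [Q] into itself, and its image at time
     [2 * m] is [q], outside [P]. *)
  set (t := Nat.iter (2 * m) k q).
  assert (Qt : Q t) by (apply (iter_P k h Q Qb P Pb); auto; apply pushes_swap; auto).
  assert (Lt : L t).
  { unfold L, t. rewrite iter_cancel by exact Hhk. intro Pq. apply (Hdis q). auto. }
  assert (cL : connectedA L).
  { apply (connected_image (Nat.iter (2 * m) k) (Nat.iter (2 * m) h)) with (S := fun x => ~ P x); auto.
    - intro u. apply iter_cancel; auto.
    - intro u. apply iter_cancel; auto.
    - apply continuousA_iter; auto. }
  pose proof (connected_reachA L e1 x t cL ltac:(lra) Lx Lt) as Hreach.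
  clearbody t. revert Hpos Qt. induction Hreach as [u Lu | u v w Lu Huv Hvw IH]; intros Hpos Qt.
  - apply Hin; exact Qt.
  - destruct (classic (Q u)) as [Qu | NQu]; [apply Hin; exact Qu |].
    assert (Lv : L v) by (destruct Hvw; assumption).
    apply reach_step with v; auto; [right; auto |].
    destruct (classic (Q v)) as [Qv | NQv]; [apply Hin; exact Qv |].
    apply IH; auto. apply (Hsign u v); auto; [| lra].
    apply Hbd; auto. apply (not_P_earlier h k P Pb Q Qb (2 * m) 0); auto. lia.
Qed.

(* [v] is the identity or the half turn. *)
Lemma reachA_chain_up (v : R2 -> R2) (S : Ann -> Prop) (e H : R) :
  (forall a, v (v a) = a) -> (forall a b, near e a b -> near e (v a) (v b)) -> 0 < e ->
  exists d, 0 < d /\ forall x q w, reachA S d x q -> piA w = x ->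
    (forall w', piA w' = q -> H <= snd (v w')) ->
    exists lo hi, chain_up (fun a => S (piA (v a))) e H lo hi (v w).
Proof.
  intros Hv Hnear He. destruct (distA_lift e He) as [d [Hd Hl]].
  exists d. split; auto. intros x q w Hr. revert w.
  induction Hr as [x Sx | x y q Sx Hxy _ IH]; intros w Hw Hq.
  - exists (fst (v w) - 1), (fst (v w) + 1). apply chain_top; [| apply Hq; exact Hw | lra].
    rewrite Hv, Hw. exact Sx.
  - rewrite <- Hw in Hxy. destruct (Hl w y Hxy) as [w' [Hw' Hn]].
    destruct (IH w' Hw' Hq) as [lo [hi Hc]].
    exists (Rmin lo (fst (v w) - 1)), (Rmax hi (fst (v w) + 1)).
    pose proof (Rmin_l lo (fst (v w) - 1)). pose proof (Rmin_r lo (fst (v w) - 1)).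
    pose proof (Rmax_l hi (fst (v w) + 1)). pose proof (Rmax_r hi (fst (v w) + 1)).
    apply chain_step with (v w'); auto.
    + rewrite Hv, Hw. exact Sx.
    + lra.
    + apply (chain_up_sub (fun a => S (piA (v a))) (fun a => S (piA (v a))) e e H H lo hi); auto; lra.
Qed.

Lemma chain_up_deck G e H lo hi k w :
  (forall a, G a -> G (deck k a)) -> chain_up G e H lo hi w ->
  chain_up G e H (lo + IZR k) (hi + IZR k) (deck k w).
Proof.
  intro HG. induction 1 as [w Gw Hw Hb | w w' Gw Hb Hn _ IH].
  - apply chain_top; auto. simpl. lra.
  - apply chain_step with (deck k w'); auto; [simpl; lra | apply near_deck; exact Hn].
Qed.

(** A chain starting at [b] serves all points of [K] within [e] of [b] after one extra step, so
    widths are locally bounded; deck translations reduce to a compact rectangle. *)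
Lemma uniform_width (G K : R2 -> Prop) (e H M : R) :
  (forall a k, G a -> G (deck k a)) -> (forall a k, K a -> K (deck k a)) ->
  (forall a, K a -> Rabs (snd a) <= M) -> 0 < e ->
  (forall a, K a -> exists lo hi, chain_up G e H lo hi a) ->
  exists W, forall a, K a -> chain_up G e H (fst a - W) (fst a + W) a.
Proof.
  intros HG HK HM He Hc.
  destruct (compact_rectangle
    (fun a n => K a -> chain_up G e H (fst a - INR n) (fst a + INR n) a) 0 1 (- M) M) as [n Hn].
  - intros a m n Hmn Ha Ka. apply le_INR in Hmn.
    apply (chain_up_sub G G e e H H (fst a - INR m) (fst a + INR m)); auto; lra.
  - intros a0 _ _. destruct (classic (exists b, K b /\ near (e / 2) b a0)) as [[b [Kb Hb]] | Hno].
    + destruct (Hc b Kb) as [lo [hi Hch]].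
      destruct (INR_archimed 1 (Rabs (fst a0 + e - lo) + Rabs (hi - fst a0 + e) + 1) ltac:(lra)) as [n Hn].
      exists (e / 2), n. split; [lra |]. intros a Ha Ka.
      pose proof (Rle_abs (fst a0 + e - lo)). pose proof (Rle_abs (hi - fst a0 + e)).
      pose proof (Rabs_pos (fst a0 + e - lo)). pose proof (Rabs_pos (hi - fst a0 + e)).
      assert (Hab : near e a b).
      { apply near_le with (e / 2 + e / 2); [lra |]. apply near_trans with a0; auto.
        apply near_sym; exact Hb. }
      destruct Ha as [Ha _]. apply Rabs_def2 in Ha.
      destruct (Hc a Ka) as [lo' [hi' Hch']]. apply chain_in in Hch'.
      apply chain_step with b; auto; [apply Hch' | lra |].
      apply (chain_up_sub G G e e H H lo hi); auto; lra.
    + exists (e / 2), 0%nat. split; [lra |]. intros a Ha Ka. exfalso. apply Hno. exists a; auto.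
  - exists (INR n). intros a Ka. destruct (deck_unit a) as [k Hk].
    assert (Ha : chain_up G e H (fst (deck k a) - INR n) (fst (deck k a) + INR n) (deck k a)).
    { apply Hn; auto. apply HM in Ka. apply Rabs_bounds in Ka. simpl. lra. }
    apply (chain_up_deck _ _ _ _ _ (- k)) in Ha; auto.
    rewrite deck_deck, Z.add_opp_diag_r, deck_0, opp_IZR in Ha. simpl in Ha.
    apply (chain_up_sub G G e e H H _ _ (fst a - INR n) (fst a + INR n)) in Ha; auto; lra.
Qed.

(** * Excluding a gap in the rotation set *)

Definition positive_orbit (f g : Ann -> Ann) (P Q : Ann -> Prop) (phi : Ann -> R) (x : Ann) : Prop :=
  forall n, (~ P (Nat.iter n f x) /\ ~ Q (Nat.iter n f x) /\ 0 < phi (Nat.iter n f x)) /\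
            (~ P (Nat.iter n g x) /\ ~ Q (Nat.iter n g x) /\ 0 < phi (Nat.iter n g x)).

Lemma positive_orbit_swap f g P Q phi x :
  positive_orbit f g P Q phi x -> positive_orbit g f Q P phi x.
Proof. intros Hx n. destruct (Hx n) as [[? [? ?]] [? [? ?]]]. auto 6. Qed.

Lemma positive_orbit_next f g P Q phi x :
  (forall x, g (f x) = x) -> positive_orbit f g P Q phi x -> positive_orbit f g P Q phi (f x).
Proof.
  intros Hgf Hx n. split.
  - rewrite <- Nat.iter_succ_r. apply Hx.
  - destruct n as [| n].
    + apply (Hx 1%nat).
    + rewrite Nat.iter_succ_r, Hgf. apply Hx.
Qed.

Lemma positive_orbit_attached h k P Q phi m x :
  positive_orbit h k P Q phi x -> attached h P Q phi m x.
Proof. intro Hx. right. split; apply Hx. Qed.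

Lemma attached_ext h P Q (phi psi : Ann -> R) m x :
  (forall u, phi u = psi u) -> attached h P Q phi m x -> attached h P Q psi m x.
Proof. intros He [Qx | [NP Hp]]; [left | right]; auto. split; auto. rewrite <- He. exact Hp. Qed.

(** Two kinds of ties are needed: arbitrarily fine ones, of uncontrolled width, to transport the
    angle, and ones at the fixed scale [e], of uniform width [W], to read left and right from the
    angle. *)
Definition tethered (S K : R2 -> Prop) (e H W : R) : Prop :=
  forall a, K a -> S a /\ reaches_up S a /\ chain_up S e H (fst a - W) (fst a + W) a.

Lemma tethered_exists (S K : R2 -> Prop) (e H M : R) :
  (forall a k, S a -> S (deck k a)) -> (forall a k, K a -> K (deck k a)) ->
  (forall a, K a -> Rabs (snd a) <= M) -> 0 < e -> (forall a, K a -> reaches_up S a) ->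
  exists W0, forall W, W0 <= W -> tethered S K e H W.
Proof.
  intros HS HK HM He Hr.
  destruct (uniform_width S K e H M HS HK HM He) as [W0 HW0].
  { intros a Ka. apply (Hr a Ka e H He). }
  exists W0. intros W HW a Ka. specialize (HW0 a Ka). split; [apply (chain_in _ _ _ _ _ _ HW0) |].
  split; auto. apply (chain_up_sub S S e e H H (fst a - W0) (fst a + W0)); auto; lra.
Qed.

Lemma attached_reaches_up h k P Pb Q Qb phi m H w :
  pushes h k P Pb Q Qb -> sign_rigid h k P Q phi m ->
  continuousA h -> continuousA k -> continuousR phi ->
  openA P -> openA Q -> connectedA (fun x => ~ P x) -> connectedA Q ->
  (forall x, ~ (Pb x /\ Qb x)) -> (forall x, ~ P x -> ~ Q x -> Rabs (hA x) <= H) ->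
  forall v : R2 -> R2, (forall a, v (v a) = a) -> (forall e a b, near e a b -> near e (v a) (v b)) ->
  (forall M, exists q, Q q /\ forall w', piA w' = q -> M <= snd (v w')) ->
  attached h P Q phi m (piA w) -> reaches_up (fun a => attached h P Q phi m (piA (v a))) (v w).
Proof.
  intros Hpush Hrigid Hh Hk Hphi oP oQ cP cQ Hdis Hbd v Hv Hnear Hend Hw e M He.
  destruct (reachA_chain_up v (attached h P Q phi m) e M Hv (Hnear e) He) as [d [Hd Hlift]].
  destruct (Hend M) as [q [Qq Hq]].
  apply (Hlift (piA w) q w); auto.
  apply (attached_reaches h k P Pb Q Qb phi m H); auto.
Qed.

(** * Orbits that cross both curves in the same direction *)

Section Crossing.

Variables (h k : Ann -> Ann) (P Pb Q Qb : Ann -> Prop) (phi : Ann -> R) (m : nat) (H : R).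
Hypothesis Hpush : pushes h k P Pb Q Qb.
Hypothesis Hm : (1 <= m)%nat.
Hypotheses (Hh : continuousA h) (Hk : continuousA k).
Hypotheses (oP : openA P) (oQ : openA Q) (oPb : openA (fun x => ~ Pb x)) (oQb : openA (fun x => ~ Qb x)).
Hypothesis Hdis : forall x, ~ (Pb x /\ Qb x).
Hypotheses (HP : forall x, H < hA x -> P x) (HQ : forall x, hA x < - H -> Q x).
Hypotheses (cP : connectedA P) (cQ : connectedA Q).
Hypotheses (cPc : connectedA (fun x => ~ P x)) (cQc : connectedA (fun x => ~ Q x)).

Let bound x : ~ P x -> ~ Q x -> Rabs (hA x) <= H.
Proof. intros NP NQ. apply Rabs_le. split; apply Rnot_lt_le; auto. Qed.

Let lower psi a := attached h P Q psi m (piA a).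
Let upper psi a := attached k Q P psi m (piA a).
Let orbit psi a := positive_orbit h k P Q psi (piA a).

Lemma attached_sets_separated psi :
  sign_rigid h k P Q psi m -> continuousR psi ->
  exists d, 0 < d /\ forall d', d' <= d -> separated (lower psi) (upper (fun u => - psi u)) d' (H + 1).
Proof.
  intros Hr Hc.
  destruct (attached_separated h k P Pb Q Qb psi m H) as [d [Hd Hsep]]; auto.
  exists (d / 24). split; [lra |]. intros d' Hd'. split; [| split; [| split]].
  - intros z j. unfold lower. rewrite piA_deck. auto.
  - intros z w Ez Gw Hn. specialize (Hsep _ _ Ez Gw).
    assert (distA (piA z) (piA w) < d).
    { apply near_distA; auto. apply near_le with d'; auto. }
    lra.
  - intros z Ez. unfold lower, attached in Ez. rewrite <- hA_piA.
    assert (NP : ~ P (piA z)).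
    { destruct Hpush as [_ [_ [HPP [HQQ _]]]].
      destruct Ez as [Qz | [NP _]]; [intro Pz; apply (Hdis (piA z)); auto |].
      apply (not_P_earlier h k P Pb Q Qb (2 * m) 0); auto. lia. }
    assert (hA (piA z) <= H) by (apply Rnot_lt_le; auto). lra.
  - intros w Gw. unfold upper, attached in Gw. rewrite <- hA_piA.
    assert (NQ : ~ Q (piA w)).
    { pose proof Hpush as [_ [_ [HPP [HQQ _]]]].
      destruct Gw as [Pz | [NQ _]]; [intro Qz; apply (Hdis (piA w)); auto |].
      apply (not_P_earlier k h Q Qb P Pb (2 * m) 0); auto; [apply pushes_swap; auto | lia]. }
    assert (- H <= hA (piA w)) by (apply Rnot_lt_le; auto). lra.
Qed.

Lemma orbit_tethered psi e :
  sign_rigid h k P Q psi m -> continuousR psi -> 0 < e ->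
  exists W0, forall W, W0 <= W ->
    tethered (upper psi) (orbit psi) e (H + 1) W /\
    tethered (fun a => lower psi (opp2 a)) (fun a => orbit psi (opp2 a)) e (H + 1) W.
Proof.
  intros Hr Hc He.
  assert (Horb : forall a j, orbit psi a -> orbit psi (deck j a)).
  { intros a j. unfold orbit. rewrite piA_deck. auto. }
  assert (Hb : forall a, orbit psi a -> Rabs (snd a) <= H).
  { intros a Ha. rewrite <- hA_piA. apply bound; apply (Ha 0%nat). }
  destruct (tethered_exists (upper psi) (orbit psi) e (H + 1) H) as [W1 HW1]; auto.
  - intros a j. unfold upper. rewrite piA_deck. auto.
  - intros a Ha. apply (attached_reaches_up k h Q Qb P Pb psi m H) with (v := fun b : R2 => b); auto.
    + apply pushes_swap; auto.
    + apply sign_rigid_swap; auto.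
    + intros x [X1 X2]. apply (Hdis x); auto.
    + intro M. exists (piA (0, Rmax M (H + 1))). pose proof (Rmax_l M (H + 1)).
      pose proof (Rmax_r M (H + 1)). split.
      * apply HP. rewrite hA_piA. simpl. lra.
      * intros w' Hw'. apply (f_equal hA) in Hw'. rewrite !hA_piA in Hw'. simpl in Hw'. lra.
    + apply (positive_orbit_attached k h). apply positive_orbit_swap. exact Ha.
  - destruct (tethered_exists (fun a => lower psi (opp2 a)) (fun a => orbit psi (opp2 a)) e (H + 1) H)
      as [W2 HW2]; auto.
    + intros a j. unfold lower. rewrite deck_opp2, piA_deck. auto.
    + intros a j. rewrite deck_opp2. auto.
    + intros a Ha. specialize (Hb _ Ha). simpl in Hb. rewrite Rabs_Ropp in Hb. exact Hb.
    + intros a Ha. rewrite <- (opp2_opp2 a).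
      apply (attached_reaches_up h k P Pb Q Qb psi m H) with (v := opp2); auto.
      * apply opp2_opp2.
      * apply near_opp2.
      * intro M. exists (piA (0, - Rmax M (H + 1))). pose proof (Rmax_l M (H + 1)).
        pose proof (Rmax_r M (H + 1)). split.
        -- apply HQ. rewrite hA_piA. simpl. lra.
        -- intros w' Hw'. apply (f_equal hA) in Hw'. rewrite !hA_piA in Hw'. simpl in *. lra.
      * apply (positive_orbit_attached h k). exact Ha.
    + exists (Rmax W1 W2). intros W HW. pose proof (Rmax_l W1 W2). pose proof (Rmax_r W1 W2).
      split; [apply HW1 | apply HW2]; lra.
Qed.

(** On the orbit of [z] the function [phi] is negative, on that of [w] positive. So [E] and [G] are
    the lower set for [- phi] and the upper set for [phi], and the second pair has the signs
    exchanged. If [F 1] is [k], the dynamics preserves the lower sets, and the version obtained by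
    the half turn applies. *)
Lemma opposite_orbits_no_overtaking (F : R -> Ann -> Ann) (Ft : R -> R2 -> R2) (z w : R2) :
  isotopy F -> isotopy_lift F Ft -> F 1 = h \/ F 1 = k ->
  sign_rigid h k P Q phi m -> continuousR phi ->
  orbit (fun u => - phi u) z -> orbit phi w ->
  exists W, forall (j : Z) (n : nat),
    fst (deck j w) - fst z < - W ->
    W < fst (Nat.iter n (Ft 1) (deck j w)) - fst (Nat.iter n (Ft 1) z) -> False.
Proof.
  intros HF HL Hfh Hr Hc Hz Hw.
  pose proof (lift_tame F Ft HF HL) as Htame.
  assert (Hpi : forall a, piA (Ft 1 a) = F 1 (piA a)) by (intro a; apply HL; lra).
  pose proof (sign_rigid_opp _ _ _ _ _ _ Hr) as Hr'. pose proof (continuousR_opp _ Hc) as Hc'.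
  destruct (attached_sets_separated phi Hr Hc) as [d1 [Hd1 Sep1]].
  destruct (attached_sets_separated (fun u => - phi u) Hr' Hc') as [d2 [Hd2 Sep2]].
  set (d := Rmin d1 d2).
  assert (Hd : 0 < d /\ d <= d1 /\ d <= d2).
  { unfold d. split; [apply Rmin_pos; auto | split; [apply Rmin_l | apply Rmin_r]]. }
  specialize (Sep1 d ltac:(lra)). specialize (Sep2 d ltac:(lra)).
  assert (Sep2' : separated (lower (fun u => - phi u)) (upper phi) d (H + 1)).
  { destruct Sep2 as [A1 [A2 [A3 A4]]].
    assert (Hup : forall a, upper phi a -> upper (fun u => - - phi u) a).
    { intros a. apply attached_ext. intro u. ring. }
    split; [exact A1 |]. split; [| split]; auto. }
  set (e := d / 2).
  destruct (orbit_tethered phi e Hr Hc ltac:(unfold e; lra)) as [W1 T1].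
  destruct (orbit_tethered (fun u => - phi u) e Hr' Hc' ltac:(unfold e; lra)) as [W2 T2].
  set (W := Rmax W1 W2).
  destruct (T1 W (Rmax_l _ _)) as [T1u T1l]. destruct (T2 W (Rmax_r _ _)) as [T2u T2l].
  exists W. intros j n H0 Hn.
  assert (Hw' : orbit phi (deck j w)) by (unfold orbit; rewrite piA_deck; exact Hw).
  set (w0 := deck j w) in *. clearbody w0.
  assert (Hstep : forall psi a, orbit psi a -> orbit psi (Ft 1 a)).
  { intros psi a Ha. unfold orbit. rewrite Hpi. pose proof Hpush as [Hkh [Hhk _]].
    destruct Hfh as [-> | ->].
    - apply positive_orbit_next; auto.
    - apply positive_orbit_swap, positive_orbit_next; auto. apply positive_orbit_swap. exact Ha. }
  assert (Hzi : forall i, orbit (fun u => - phi u) (Nat.iter i (Ft 1) z)).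
  { induction i as [| i IH]; simpl; auto. }
  assert (Hwi : forall i, orbit phi (Nat.iter i (Ft 1) w0)).
  { induction i as [| i IH]; simpl; auto. }
  assert (Hlow : forall psi a, orbit psi a -> lower psi a).
  { intros psi a. apply positive_orbit_attached. }
  assert (Hupp : forall psi a, orbit psi a -> upper psi a).
  { intros psi a Ha. apply (positive_orbit_attached k h). apply positive_orbit_swap. exact Ha. }
  assert (Hzo : forall i, orbit (fun u => - phi u) (opp2 (opp2 (Nat.iter i (Ft 1) z)))).
  { intro i. rewrite opp2_opp2. apply Hzi. }
  assert (Hwo : forall i, orbit phi (opp2 (opp2 (Nat.iter i (Ft 1) w0)))).
  { intro i. rewrite opp2_opp2. apply Hwi. }
  assert (Hreach : forall i, reaches_up (upper phi) (Nat.iter i (Ft 1) w0) /\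
     reaches_up (upper (fun u => - phi u)) (Nat.iter i (Ft 1) z) /\
     reaches_up (fun a => lower (fun u => - phi u) (opp2 a)) (opp2 (Nat.iter i (Ft 1) z)) /\
     reaches_up (fun a => lower phi (opp2 a)) (opp2 (Nat.iter i (Ft 1) w0))).
  { intro i. split; [apply T1u; auto |]. split; [apply T2u; auto |].
    split; [apply T2l; auto | apply T1l; auto]. }
  destruct Hfh as [Ef | Ef].
  - apply (no_overtaking_up Ft (lower (fun u => - phi u)) (upper phi) (lower phi)
      (upper (fun u => - phi u)) d (H + 1) e W z w0 n); auto; try (unfold e; lra).
    + intros a Ga. unfold upper. rewrite Hpi, Ef. apply (attached_invariant h k P Pb Q Qb); auto.
    + intros a Ga. unfold upper. rewrite Hpi, Ef. apply (attached_invariant h k P Pb Q Qb); auto.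
    + intro i. split; [apply T1u; auto | apply T2u; auto].
  - apply (no_overtaking_down Ft (lower (fun u => - phi u)) (upper phi) (lower phi)
      (upper (fun u => - phi u)) d (H + 1) e W z w0 n); auto; try (unfold e; lra).
    + intros a l. unfold upper. rewrite piA_deck. auto.
    + intros a l. unfold upper. rewrite piA_deck. auto.
    + intros a Ea. unfold lower. rewrite Hpi, Ef.
      apply (attached_invariant k h Q Qb P Pb); auto; [apply pushes_swap; auto | apply sign_rigid_swap; auto].
    + intros a Ea. unfold lower. rewrite Hpi, Ef.
      apply (attached_invariant k h Q Qb P Pb); auto; [apply pushes_swap; auto | apply sign_rigid_swap; auto].
    + intro i. split; [apply (T2l _ (Hzo i)) | apply (T1l _ (Hwo i))].
Qed.

End Crossing.

(** Here [k] maps both [P] and [Q] into themselves. A point whose [m]-th image by [k] is outside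
    them has [m] free steps on each side, so [phi] does not vanish on the set of these points. This
    set is an image of A, hence connected, and contains [x] and [y], where [phi] has opposite signs.
    It replaces the decreasing intersection. *)
Lemma sign_rigid_attractor (h k : Ann -> Ann) (P Pb Q Qb : Ann -> Prop) phi m x y :
  (forall x, k (h x) = x) -> (forall x, h (k x) = x) -> continuousA h -> continuousA k ->
  (forall x, P x -> Pb x) -> (forall x, Q x -> Qb x) ->
  (forall x, Pb x -> P (k x)) -> (forall x, Qb x -> Q (k x)) ->
  connectedA (fun x => ~ P x /\ ~ Q x) -> continuousR phi -> sign_rigid h k P Q phi m ->
  positive_orbit h k P Q (fun u => - phi u) x -> positive_orbit h k P Q phi y -> False.
Proof.
  intros Hkh Hhk Hh Hk HPP HQQ HPk HQk cA Hc Hr Hx Hy.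
  assert (Hcon : connectedA (fun u => ~ P (Nat.iter m k u) /\ ~ Q (Nat.iter m k u))).
  { apply (connected_image (Nat.iter m h) (Nat.iter m k)) with (S := fun u => ~ P u /\ ~ Q u); auto.
    - intro u. apply iter_cancel; auto.
    - intro u. apply iter_cancel; auto.
    - apply continuousA_iter; auto. }
  assert (Hback : forall (T Tb : Ann -> Prop), (forall u, T u -> Tb u) -> (forall u, Tb u -> T (k u)) ->
    forall n u, T u -> T (Nat.iter n k u)).
  { intros T Tb H1 H2 n u Tu. induction n as [| n IH]; simpl; auto. }
  assert (Hnz : forall u, ~ P (Nat.iter m k u) /\ ~ Q (Nat.iter m k u) -> phi u <> 0).
  { intros u [NP NQ] E. destruct (Hr u) as [Hg _]; [| rewrite E in Hg; lra].
    assert (HT : forall (T Tb : Ann -> Prop), (forall u, T u -> Tb u) -> (forall u, Tb u -> T (k u)) ->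
      ~ T (Nat.iter m k u) -> forall i, (i <= m)%nat -> ~ T (Nat.iter i h u) /\ ~ T (Nat.iter i k u)).
    { intros T Tb H1 H2 HN i Hi. split; intro HTi; apply HN.
      - apply (Hback T Tb H1 H2 i) in HTi. rewrite iter_cancel in HTi by auto.
        apply (Hback T Tb); auto.
      - replace m with ((m - i) + i)%nat by lia. rewrite Nat.iter_add. apply (Hback T Tb); auto. }
    intros i Hi. destruct (HT P Pb HPP HPk NP i Hi). destruct (HT Q Qb HQQ HQk NQ i Hi). auto. }
  destruct (Hcon (fun u => 0 < phi u) (fun u => 0 < - phi u)) as [H | H].
  - apply (open_positive phi (fun u => u)); auto. intros u e He. exists e. auto.
  - apply (open_positive (fun u => - phi u) (fun u => u)); [apply continuousR_opp; auto |].
    intros u e He. exists e. auto.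
  - intros u Hu. specialize (Hnz u Hu). lra.
  - intros u [_ [H1 H2]]. lra.
  - destruct (Hx 0%nat) as [_ Hx0]. simpl in Hx0.
    specialize (H x ltac:(split; apply (Hx m))). lra.
  - specialize (H y ltac:(split; apply (Hy m))). destruct (Hy 0%nat) as [_ Hy0]. simpl in Hy0. lra.
Qed.

(** By compactness. If the orbit of a point leaves at time [i], the premise fails nearby for every
    [m] at least [i]; at a point of the maximal invariant set the signs of [phi x], [phi (f x)] and
    [phi (g x)] are constant nearby. *)
Lemma sign_rigid_exists f g P Pb Q Qb H phi :
  annulus_between f g P Pb Q Qb H -> continuousR phi ->
  (forall x, (forall n, (~ P (Nat.iter n f x) /\ ~ Q (Nat.iter n f x)) /\
                        (~ P (Nat.iter n g x) /\ ~ Q (Nat.iter n g x))) ->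
     0 < phi x * phi (f x) /\ 0 < phi x * phi (g x)) ->
  exists m, (1 <= m)%nat /\ sign_rigid f g P Q phi m.
Proof.
  intros [Hgf Hfg Hf Hg oP oQ oPb oQb HPP HQQ Hdis cP cQ cPc cQc cA HP HQ] Hphi Hinv.
  destruct (compact_annulus (fun x n => (forall i, (i <= n)%nat ->
      (~ P (Nat.iter i f x) /\ ~ Q (Nat.iter i f x)) /\ (~ P (Nat.iter i g x) /\ ~ Q (Nat.iter i g x))) ->
    0 < phi x * phi (f x) /\ 0 < phi x * phi (g x)) H) as [n Hn].
  - intros x m n Hmn Hm Hx. apply Hm. intros i Hi. apply Hx. lia.
  - intro x0.
    assert (Hout : forall (h : Ann -> Ann) (T : Ann -> Prop) i, continuousA h -> openA T ->
      T (Nat.iter i h x0) -> exists r, 0 < r /\ forall x, distA x0 x < r -> T (Nat.iter i h x)).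
    { intros h T i Hh oT Ti. destruct (open_iter_preimage h T i Hh oT x0 Ti) as [r [Hr HB]].
      exists r. auto. }
    destruct (classic (exists i, P (Nat.iter i f x0) \/ Q (Nat.iter i f x0) \/
      P (Nat.iter i g x0) \/ Q (Nat.iter i g x0))) as [[i Hi] | Hno].
    + assert (Hr : exists r, 0 < r /\ forall x, distA x0 x < r ->
        P (Nat.iter i f x) \/ Q (Nat.iter i f x) \/ P (Nat.iter i g x) \/ Q (Nat.iter i g x)).
      { destruct Hi as [Hi | [Hi | [Hi | Hi]]].
        - destruct (Hout f P i Hf oP Hi) as [r [Hr HB]]. exists r. auto 10.
        - destruct (Hout f Q i Hf oQ Hi) as [r [Hr HB]]. exists r. auto 10.
        - destruct (Hout g P i Hg oP Hi) as [r [Hr HB]]. exists r. auto 10.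
        - destruct (Hout g Q i Hg oQ Hi) as [r [Hr HB]]. exists r. auto 10. }
      destruct Hr as [r [Hr HB]]. exists r, i. split; auto. intros x Hx Hall.
      specialize (HB x Hx). specialize (Hall i (le_n i)). tauto.
    + destruct (Hinv x0) as [H1 H2].
      { intro n. pose proof (not_ex_all_not _ _ Hno n) as Hn. cbv beta in Hn. tauto. }
      assert (Hsame : forall h : Ann -> Ann, continuousA h -> 0 < phi x0 * phi (h x0) ->
        exists r, 0 < r /\ forall x, distA x0 x < r -> 0 < phi x * phi (h x)).
      { intros h Hh Hpos.
        assert (Hid : continuousA (fun u => u)) by (intros u e He; exists e; auto).
        destruct (Rlt_dec 0 (phi x0)) as [Hp | Hp].
        - assert (Hp' : 0 < phi (h x0)) by nra.
          destruct (open_positive phi _ Hphi Hid x0 Hp) as [r [Hr HB]].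
          destruct (open_positive phi h Hphi Hh x0 Hp') as [r' [Hr' HB']].
          exists (Rmin r r'). split; [apply Rmin_pos; auto |]. intros x Hx.
          pose proof (Rmin_l r r'). pose proof (Rmin_r r r').
          apply Rmult_lt_0_compat; [apply HB | apply HB']; lra.
        - assert (Hne : phi x0 <> 0) by (intro E; rewrite E in Hpos; lra).
          assert (Hp0 : 0 < - phi x0) by lra. assert (Hp' : 0 < - phi (h x0)) by nra.
          pose proof (continuousR_opp _ Hphi) as Hphi'.
          destruct (open_positive _ _ Hphi' Hid x0 Hp0) as [r [Hr HB]].
          destruct (open_positive _ h Hphi' Hh x0 Hp') as [r' [Hr' HB']].
          exists (Rmin r r'). split; [apply Rmin_pos; auto |]. intros x Hx.
          pose proof (Rmin_l r r'). pose proof (Rmin_r r r').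
          specialize (HB x ltac:(lra)). specialize (HB' x ltac:(lra)). simpl in HB, HB'. nra. }
      destruct (Hsame f Hf H1) as [r [Hr HB]]. destruct (Hsame g Hg H2) as [r' [Hr' HB']].
      exists (Rmin r r'), 0%nat. split; [apply Rmin_pos; auto |]. intros x Hx _.
      pose proof (Rmin_l r r'). pose proof (Rmin_r r r').
      split; [apply HB | apply HB']; lra.
  - exists (S n). split; [lia |]. intros x Hx. apply Hn.
    + destruct (Hx 0%nat ltac:(lia)) as [[NP NQ] _]. simpl in NP, NQ.
      apply Rabs_le. split; apply Rnot_lt_le; auto.
    + intros i Hi. apply Hx. lia.
Qed.

Lemma signed_orbits_no_overtaking F Ft g P Pb Q Qb H phi (z w : R2) :
  isotopy F -> isotopy_lift F Ft -> annulus_between (F 1) g P Pb Q Qb H ->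
  ((forall x, Pb x -> P (F 1 x)) \/ (forall x, Pb x -> P (g x))) ->
  ((forall x, Qb x -> Q (F 1 x)) \/ (forall x, Qb x -> Q (g x))) ->
  continuousR phi ->
  (forall x, (forall n, (~ P (Nat.iter n (F 1) x) /\ ~ Q (Nat.iter n (F 1) x)) /\
                        (~ P (Nat.iter n g x) /\ ~ Q (Nat.iter n g x))) ->
     0 < phi x * phi (F 1 x) /\ 0 < phi x * phi (g x)) ->
  positive_orbit (F 1) g P Q (fun u => - phi u) (piA z) -> positive_orbit (F 1) g P Q phi (piA w) ->
  exists W, forall (j : Z) (n : nat),
    fst (deck j w) - fst z < - W ->
    W < fst (Nat.iter n (Ft 1) (deck j w)) - fst (Nat.iter n (Ft 1) z) -> False.
Proof.
  intros HF HL Hab HdP HdQ Hc Hinv Hz Hw.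
  destruct (sign_rigid_exists (F 1) g P Pb Q Qb H phi Hab Hc Hinv) as [m [Hm Hr]].
  destruct Hab as [Hgf Hfg Hf Hg oP oQ oPb oQb HPP HQQ Hdis cP cQ cPc cQc cA HP HQ].
  assert (Hswap : forall psi x, positive_orbit (F 1) g P Q psi x -> positive_orbit g (F 1) P Q psi x).
  { intros psi x Hx n. destruct (Hx n). split; assumption. }
  assert (Hr' : sign_rigid g (F 1) P Q phi m).
  { intros x Hx. destruct (Hr x); [intros i Hi; destruct (Hx i Hi); split; assumption | auto]. }
  (* If one map sends both [Pb] and [Qb] inside, the annulus is an attractor or a repeller.
     Otherwise orbits cross from [Q] to [P] under [F 1] or under [g]. *)
  destruct HdP as [HdP | HdP]; destruct HdQ as [HdQ | HdQ].
  - exfalso. apply (sign_rigid_attractor g (F 1) P Pb Q Qb phi m (piA z) (piA w)); auto.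
  - apply (opposite_orbits_no_overtaking (F 1) g P Pb Q Qb phi m H) with (F := F); auto.
    repeat split; auto.
  - apply (opposite_orbits_no_overtaking g (F 1) P Pb Q Qb phi m H) with (F := F); auto.
    repeat split; auto.
  - exfalso. apply (sign_rigid_attractor (F 1) g P Pb Q Qb phi m (piA z) (piA w)); auto.
Qed.

(** * The rotation set *)

(** This is [n] times the difference between the rotation number in time [n] and [c]. Unlike the
    quotient, it changes by a bounded amount when [n] increases by one on the invariant set. *)
Definition excess (ft : R2 -> R2) (c : R) (n : nat) (z : R2) : R :=
  fst (Nat.iter n ft z) - fst z - INR n * c.

Definition full_orbit_in (f g : Ann -> Ann) (P Q : Ann -> Prop) (x : Ann) : Prop :=
  forall n, (~ P (Nat.iter n f x) /\ ~ Q (Nat.iter n f x)) /\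
            (~ P (Nat.iter n g x) /\ ~ Q (Nat.iter n g x)).

Lemma full_orbit_next f g P Q x :
  (forall x, g (f x) = x) -> full_orbit_in f g P Q x -> full_orbit_in f g P Q (f x).
Proof.
  intros Hgf Hx n. split.
  - rewrite <- Nat.iter_succ_r. apply Hx.
  - destruct n as [| n].
    + apply (Hx 1%nat).
    + rewrite Nat.iter_succ_r, Hgf. apply Hx.
Qed.

Lemma full_orbit_prev f g P Q x :
  (forall x, f (g x) = x) -> full_orbit_in f g P Q x -> full_orbit_in f g P Q (g x).
Proof.
  intros Hfg Hx.
  assert (Hx' : full_orbit_in g f P Q x) by (intro n; destruct (Hx n); auto).
  intro n. destruct (full_orbit_next g f P Q x Hfg Hx' n). auto.
Qed.

Lemma Theta_full_orbit f g P Q (A : Ann -> Prop) x :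
  (forall x, g (f x) = x) -> (forall x, f (g x) = x) -> (forall x, A x <-> ~ P x /\ ~ Q x) ->
  Theta f A x <-> full_orbit_in f g P Q x.
Proof.
  intros Hgf Hfg HA. split.
  - intros Hx n. destruct (Hx n) as [H1 H2]. split; apply HA; auto.
    apply H2. apply iter_cancel; exact Hfg.
  - intros Hx n. destruct (Hx n) as [H1 H2]. split; [apply HA; exact H1 |].
    intros y <-. apply HA. rewrite iter_cancel in H2 by exact Hgf. exact H2.
Qed.

Lemma iter_lift F Ft n z : isotopy_lift F Ft -> piA (Nat.iter n (Ft 1) z) = Nat.iter n (F 1) (piA z).
Proof.
  intro HL. induction n as [| n IH]; simpl; auto.
  destruct HL as [_ [Hpi _]]. rewrite Hpi by lra. rewrite IH. reflexivity.
Qed.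

Lemma iter_lift_deck F Ft n k z :
  isotopy_lift F Ft -> Nat.iter n (Ft 1) (deck k z) = deck k (Nat.iter n (Ft 1) z).
Proof.
  intro HL. induction n as [| n IH]; simpl; auto.
  rewrite IH. apply (lift_deck F); auto. lra.
Qed.

Lemma iter_lift_cont F Ft n z e :
  isotopy_lift F Ft -> 0 < e -> exists d, 0 < d /\
    forall w, near d z w -> near e (Nat.iter n (Ft 1) z) (Nat.iter n (Ft 1) w).
Proof.
  intro HL. revert e. induction n as [| n IH]; intros e He; simpl.
  - exists e. auto.
  - destruct (lift_unif_cont F Ft HL (Rabs (snd (Nat.iter n (Ft 1) z))) e He) as [d [Hd Hcd]].
    destruct (IH d Hd) as [d' [Hd' IHd]]. exists d'. split; auto. intros w Hw.
    apply Hcd; auto; try lra. rewrite Rminus_diag, Rabs_R0. exact Hd.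
Qed.

(** The excess is invariant under deck translations, so any choice of lifts gives the same function;
    it is continuous because the covering has local inverses. *)
Lemma excess_descends F Ft c n :
  isotopy_lift F Ft ->
  exists phi, continuousR phi /\ forall z, phi (piA z) = excess (Ft 1) c n z.
Proof.
  intro HL.
  set (sec := fun x => proj1_sig (constructive_indefinite_description _ (piA_surj x))).
  assert (Hsec : forall x, piA (sec x) = x).
  { intro x. unfold sec. destruct (constructive_indefinite_description _ (piA_surj x)). auto. }
  assert (Heq : forall z, excess (Ft 1) c n (sec (piA z)) = excess (Ft 1) c n z).
  { intro z. destruct (piA_eq (sec (piA z)) z) as [k Hk]; [apply Hsec |].
    rewrite Hk at 2. unfold excess. rewrite (iter_lift_deck F) by auto. simpl. ring. }
  exists (fun x => excess (Ft 1) c n (sec x)). split; auto.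
  intros x eps Heps.
  destruct (piA_surj x) as [z <-].
  destruct (iter_lift_cont F Ft n z (eps / 2) HL ltac:(lra)) as [d [Hd Hcd]].
  destruct (distA_lift (Rmin d (eps / 2)) ltac:(apply Rmin_pos; lra)) as [d' [Hd' Hl]].
  exists d'. split; auto. intros y Hy. destruct (Hl z y Hy) as [w [<- Hn]].
  rewrite !Heq. unfold excess.
  destruct (Hcd w) as [H1 _]; [apply near_le with (Rmin d (eps / 2)); auto; apply Rmin_l |].
  destruct Hn as [H2 _]. pose proof (Rmin_r d (eps / 2)).
  apply Rabs_def2 in H1, H2. apply Rabs_def1; lra.
Qed.

Lemma displacement_bounded F Ft H :
  isotopy_lift F Ft ->
  exists D, 0 < D /\ forall z, Rabs (snd z) <= H -> Rabs (fst (Ft 1 z) - fst z) <= D.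
Proof.
  intro HL.
  destruct (compact_rectangle (fun z n => Rabs (fst (Ft 1 z) - fst z) <= INR n) 0 1 (- H) H) as [n Hn].
  - intros z m n Hmn Hz. apply le_INR in Hmn. lra.
  - intros z0 _ _. destruct (iter_lift_cont F Ft 1 z0 1 HL ltac:(lra)) as [d [Hd Hcd]].
    destruct (INR_archimed 1 (Rabs (fst (Ft 1 z0) - fst z0) + 2) ltac:(lra)) as [n Hn].
    exists (Rmin d 1), n. split; [apply Rmin_pos; lra |]. intros z Hz.
    pose proof (Rmin_l d 1). pose proof (Rmin_r d 1).
    destruct (Hcd z) as [HN1 _]; [apply near_sym; apply near_le with (Rmin d 1); auto |].
    simpl in HN1. destruct Hz as [HN2 _].
    pose proof (Rle_abs (fst (Ft 1 z0) - fst z0)). pose proof (Rle_abs (- (fst (Ft 1 z0) - fst z0))).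
    rewrite Rabs_Ropp in *. apply Rabs_def2 in HN1, HN2. apply Rabs_le. lra.
  - exists (INR n + 1). split; [pose proof (pos_INR n); lra |].
    intros z Hz. destruct (deck_unit z) as [k Hk]. apply Rabs_bounds in Hz.
    specialize (Hn (deck k z) Hk Hz). rewrite (lift_deck F) in Hn by (auto; lra). simpl in Hn.
    replace (_ - _) with (fst (Ft 1 z) - fst z) in Hn by ring. lra.
Qed.

(** * Consequences of a gap at c *)

Section Gap.

Variables (F : R -> Ann -> Ann) (Ft : R -> R2 -> R2) (g : Ann -> Ann).
Variables (P Pb Q Qb : Ann -> Prop) (H D c eps : R) (m : nat).
Hypotheses (HF : isotopy F) (HL : isotopy_lift F Ft).
Hypothesis Hab : annulus_between (F 1) g P Pb Q Qb H.

Let K x := full_orbit_in (F 1) g P Q x.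
Let s := excess (Ft 1) c.

Hypothesis HD : forall z, K (piA z) -> Rabs (fst (Ft 1 z) - fst z) <= D.

Lemma invariant_iter n z : K (piA z) -> K (piA (Nat.iter n (Ft 1) z)).
Proof.
  intro Kz. induction n as [| n IH]; simpl; auto.
  destruct HL as [_ [Hpi _]]. rewrite Hpi by lra. apply full_orbit_next; auto. apply Hab.
Qed.

Lemma excess_step n z : K (piA z) -> Rabs (s (S n) z - s n z) <= D + Rabs c.
Proof.
  intro Kz. pose proof (HD _ (invariant_iter n z Kz)) as Hd. apply Rabs_bounds in Hd.
  pose proof (Rle_abs c). pose proof (Rle_abs (- c)). rewrite Rabs_Ropp in *.
  unfold s, excess. rewrite S_INR. simpl. apply Rabs_le. lra.
Qed.

Lemma excess_next n z : s n (Ft 1 z) = s (S n) z - s 1 z.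
Proof.
  unfold s, excess. rewrite S_INR, <- Nat.iter_succ_r. simpl. ring.
Qed.

Hypotheses (Heps : 0 < eps) (Hm : (1 <= m)%nat) (Hbig : D + Rabs c < INR m * eps).
Hypothesis Hgap : forall n z, (m <= n)%nat -> K (piA z) -> INR n * eps <= Rabs (s n z).

Lemma excess_bound_mono n : (m <= n)%nat -> D + Rabs c < INR n * eps.
Proof. intro Hn. apply le_INR in Hn. nra. Qed.

(** One step of the excess is shorter than the forbidden interval around 0, so it cannot jump
    across. *)
Lemma excess_sign n z : (m <= n)%nat -> K (piA z) -> (s n z < 0 <-> s m z < 0).
Proof.
  intros Hn Kz. induction Hn as [| n Hn IH]; [tauto |].
  rewrite <- IH. pose proof (excess_step n z Kz) as Hst. apply Rabs_bounds in Hst.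
  pose proof (excess_bound_mono n Hn). pose proof (excess_bound_mono (S n) ltac:(lia)).
  pose proof (Hgap n z Hn Kz) as G1. pose proof (Hgap (S n) z ltac:(lia) Kz) as G2.
  assert (0 <= INR n * eps) by (apply Rmult_le_pos; [apply pos_INR | lra]).
  assert (0 <= INR (S n) * eps) by (apply Rmult_le_pos; [apply pos_INR | lra]).
  unfold Rabs in G1, G2. destruct (Rcase_abs (s n z)), (Rcase_abs (s (S n) z)); lra.
Qed.

(** Passing from [z] to its image changes the excess by at most [2 * (D + Rabs c)], still less than
    the width [2 * INR m * eps] of the forbidden interval. *)
Lemma excess_sign_next z : K (piA z) -> 0 < s m z * s m (Ft 1 z).
Proof.
  intro Kz.
  assert (Kf : K (piA (Ft 1 z))) by apply (invariant_iter 1 z Kz).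
  pose proof (Hgap m z (le_n m) Kz) as G1. pose proof (Hgap m _ (le_n m) Kf) as G2.
  rewrite excess_next in *.
  pose proof (excess_step m z Kz) as Hst. apply Rabs_bounds in Hst.
  pose proof (excess_step 0 z Kz) as Hs1. apply Rabs_bounds in Hs1.
  assert (E0 : s 0 z = 0) by (unfold s, excess; simpl; ring).
  assert (0 < INR m * eps).
  { apply Rmult_lt_0_compat; auto. apply lt_0_INR. lia. }
  unfold Rabs in G1, G2.
  destruct (Rcase_abs (s m z)), (Rcase_abs (s (S m) z - s 1 z)); nra.
Qed.

Lemma gap_one_sided z w :
  ((forall x, Pb x -> P (F 1 x)) \/ (forall x, Pb x -> P (g x))) ->
  ((forall x, Qb x -> Q (F 1 x)) \/ (forall x, Qb x -> Q (g x))) ->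
  K (piA z) -> K (piA w) -> s m z < 0 -> 0 < s m w -> False.
Proof.
  intros HdP HdQ Kz Kw Hz Hw.
  destruct (excess_descends F Ft c m HL) as [phi [Hphi Ephi]].
  pose proof (ab_gf _ _ _ _ _ _ _ Hab) as Hgf. pose proof (ab_fg _ _ _ _ _ _ _ Hab) as Hfg.
  assert (Hpi : forall a, piA (Ft 1 a) = F 1 (piA a)) by (intro a; apply HL; lra).
  assert (Hnext : forall x, K x -> 0 < phi x * phi (F 1 x)).
  { intros x Kx. destruct (piA_surj x) as [a <-]. rewrite <- Hpi, !Ephi.
    apply excess_sign_next; exact Kx. }
  assert (Hprev : forall x, K x -> 0 < phi x * phi (g x)).
  { intros x Kx. rewrite Rmult_comm. rewrite <- (Hfg x) at 2. apply Hnext.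
    apply full_orbit_prev; auto. }
  assert (Hsame : forall a b, 0 < a * b -> 0 < a -> 0 < b) by (intros; nra).
  assert (Hsgn : forall psi : Ann -> R, (forall x, K x -> 0 < psi x * psi (F 1 x)) ->
    (forall x, K x -> 0 < psi x * psi (g x)) -> forall x, K x -> 0 < psi x ->
    positive_orbit (F 1) g P Q psi x).
  { intros psi H1 H2 x Kx Hx.
    assert (Hf : forall n, K (Nat.iter n (F 1) x) /\ 0 < psi (Nat.iter n (F 1) x)).
    { induction n as [| n [IH1 IH2]]; simpl; auto. split; [apply full_orbit_next; auto |].
      apply (Hsame (psi (Nat.iter n (F 1) x))); auto. }
    assert (Hg : forall n, K (Nat.iter n g x) /\ 0 < psi (Nat.iter n g x)).
    { induction n as [| n [IH1 IH2]]; simpl; auto. split; [apply full_orbit_prev; auto |].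
      apply (Hsame (psi (Nat.iter n g x))); auto. }
    intro n. destruct (Hf n) as [Kf Pf]. destruct (Hg n) as [Kg Pg].
    destruct (Kf 0%nat) as [[? ?] _]. destruct (Kg 0%nat) as [[? ?] _]. auto 6. }
  assert (Oz : positive_orbit (F 1) g P Q (fun u => - phi u) (piA z)).
  { apply (Hsgn (fun u => - phi u)); cbv beta.
    - intros x Kx. specialize (Hnext x Kx). lra.
    - intros x Kx. specialize (Hprev x Kx). lra.
    - exact Kz.
    - rewrite Ephi. fold s. lra. }
  assert (Ow : positive_orbit (F 1) g P Q phi (piA w)).
  { apply Hsgn; auto. rewrite Ephi. exact Hw. }
  destruct (signed_orbits_no_overtaking F Ft g P Pb Q Qb H phi z w HF HL Hab HdP HdQ Hphi)
    as [W HW]; auto.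
  (* Another lift of the same orbit, starting to the left of [z] by more than [W]. *)
  set (j := (- up (fst w - fst z + W))%Z).
  set (D0 := fst (deck j w) - fst z).
  assert (HD0 : D0 < - W).
  { unfold D0, j. simpl. rewrite opp_IZR. pose proof (archimed (fst w - fst z + W)). lra. }
  (* By time [N] the excess of [w] is at least [INR N * eps] and that of [z] at most the opposite, a
     gain of at least [2 * eps * INR N], enough to go from [D0] beyond [W]. *)
  destruct (INR_archimed (2 * eps) (W - D0) ltac:(lra)) as [n Hn].
  set (N := (m + n)%nat).
  apply (HW j N HD0).
  rewrite (iter_lift_deck F) by auto.
  assert (HN : (m <= N)%nat) by (unfold N; lia).
  pose proof (Hgap N z HN Kz) as Gz. pose proof (Hgap N w HN Kw) as Gw.
  assert (Sz : s N z < 0) by (apply excess_sign; auto).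
  assert (Sw : ~ s N w < 0) by (rewrite excess_sign; auto; lra).
  rewrite Rabs_left in Gz by lra. rewrite Rabs_pos_eq in Gw by lra.
  assert (HnN : INR n <= INR N) by (apply le_INR; unfold N; lia).
  unfold s, excess in Gz, Gw. unfold D0 in *. simpl in *. nra.
Qed.

End Gap.

Theorem theoremD (F : R -> Ann -> Ann) (Ft : R -> R2 -> R2)
    (gp gm : Ann -> Prop) :
  isotopy F -> isotopy_lift F Ft ->
  jordan_curve gp -> jordan_curve gm ->
  essential gp -> essential gm ->
  (forall x, ~ (gp x /\ gm x)) ->
  f_free (F 1) gp -> f_free (F 1) gm ->
  (exists x, Theta (F 1) (closed_annulus gp gm) x) ->
  e_interval (rhoK (F 1) (Ft 1) (Theta (F 1) (closed_annulus gp gm))).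
Proof.
  intros HF HL Jp Jm Ep Em Hdis Fp Fm [x0 Hx0].
  destruct (annulus_between_exists F Ft gp gm) as [g [P [Pb [Q [Qb [H [Hab [HA [HdP HdQ]]]]]]]]]; auto.
  pose proof (ab_gf _ _ _ _ _ _ _ Hab) as Hgf. pose proof (ab_fg _ _ _ _ _ _ _ Hab) as Hfg.
  set (f := F 1) in *. set (ft := Ft 1) in *. set (A := closed_annulus gp gm) in *.
  assert (HTh : forall x, Theta f A x <-> full_orbit_in f g P Q x).
  { intro x. apply Theta_full_orbit; auto. }
  destruct (displacement_bounded F Ft H HL) as [D [HD0 HD]]. fold ft in HD.
  assert (HDK : forall z, full_orbit_in f g P Q (piA z) -> Rabs (fst (ft z) - fst z) <= D).
  { intros z Kz. apply HD. rewrite <- hA_piA. destruct (Kz 0%nat) as [[NP NQ] _].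
    simpl in NP, NQ. apply Rabs_le. split; apply Rnot_lt_le; intro Hlt.
    - apply NQ, (ab_Qend _ _ _ _ _ _ _ Hab), Hlt.
    - apply NP, (ab_Pend _ _ _ _ _ _ _ Hab), Hlt. }
  assert (Hdisp : forall n z, full_orbit_in f g P Q (piA z) ->
    Rabs (fst (Nat.iter n ft z) - fst z) <= INR n * D).
  { intros n z Kz. induction n as [| n IH].
    - simpl. rewrite Rminus_diag, Rabs_R0. lra.
    - pose proof (HDK _ (invariant_iter F Ft g P Pb Q Qb H HL Hab n z Kz)) as Hst.
      rewrite S_INR. simpl. apply Rabs_bounds in IH, Hst. fold ft in Hst. apply Rabs_le. lra. }
  assert (Hrho : forall n z, (1 <= n)%nat -> full_orbit_in f g P Q (piA z) ->
    - D <= (p1 (Nat.iter n ft z) - p1 z) / INR n <= D).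
  { intros n z Hn Kz. specialize (Hdisp n z Kz). apply Rabs_bounds in Hdisp.
    assert (Hpos : 0 < INR n) by (apply lt_0_INR; lia). unfold p1.
    set (q := fst (Nat.iter n ft z) - fst z) in *.
    assert (Eq : q = q / INR n * INR n) by (field; lra). set (r := q / INR n) in *. nra. }
  assert (Htail : forall m r, rho_tail f ft (Theta f A) m r -> - D <= r <= D).
  { intros m r [n [z [Hn [_ [Kz [_ ->]]]]]]. apply Hrho; auto. apply HTh; exact Kz. }
  assert (Hit : forall n z, full_orbit_in f g P Q (piA z) -> Theta f A (Nat.iter n f (piA z))).
  { intros n z Kz. apply HTh. unfold f. rewrite <- (iter_lift F Ft) by exact HL.
    apply (invariant_iter F Ft g P Pb Q Qb H HL Hab); exact Kz. }
  split.
  - destruct (piA_surj x0) as [z Ez]. rewrite <- Ez in Hx0.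
    assert (Kz : full_orbit_in f g P Q (piA z)) by (apply HTh; exact Hx0).
    (* A cluster point of the bounded sequence of rotation numbers of one orbit; the shift to [S n]
       avoids the time 0. *)
    destruct (Bolzano_Weierstrass (fun n => (p1 (Nat.iter (S n) ft z) - p1 z) / INR (S n))
      (fun r => - D <= r <= D)) as [l Hl].
    + apply compact_P3.
    + intro n. apply Hrho; auto. lia.
    + exists (Fin l). intros m Hm eps Heps.
      destruct (Hl (disc l (mkposreal eps Heps)) m) as [n [Hn Hd]].
      { exists (mkposreal eps Heps). intros u Hu. exact Hu. }
      exists ((p1 (Nat.iter (S n) ft z) - p1 z) / INR (S n)). split; [| exact Hd].
      exists (S n), z. split; [lia |]. split; [lia |]. auto.
  - assert (Hfin : forall a, rhoK f ft (Theta f A) a -> exists r, a = Fin r).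
    { intros [r | |] Ha; [exists r; reflexivity | |]; exfalso.
      - destruct (Ha 1%nat (le_n 1) D) as [r [Hr Hlt]]. apply Htail in Hr. lra.
      - destruct (Ha 1%nat (le_n 1) (- D)) as [r [Hr Hlt]]. apply Htail in Hr. lra. }
    intros a b c Ja Jb Hac Hcb.
    destruct (Hfin a Ja) as [ra ->]. destruct (Hfin b Jb) as [rb ->].
    destruct c as [rc | |]; simpl in Hac, Hcb; try contradiction.
    apply NNPP; intro Hno.
    assert (Hgap : exists m eps, (1 <= m)%nat /\ 0 < eps /\
      forall r, rho_tail f ft (Theta f A) m r -> eps <= Rabs (r - rc)).
    { apply not_all_ex_not in Hno. destruct Hno as [m Hno]. apply imply_to_and in Hno.
      destruct Hno as [Hm Hno]. apply not_all_ex_not in Hno. destruct Hno as [eps Hno].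
      apply imply_to_and in Hno. destruct Hno as [Heps Hno].
      exists m, eps. repeat split; auto. intros r Hr. apply Rnot_lt_le. intro Hlt.
      apply Hno. exists r. auto. }
    destruct Hgap as [m0 [eps [Hm0 [Heps Hgap]]]].
    assert (Hra : ra < rc) by (destruct Hac as [| ->]; [assumption | contradiction]).
    assert (Hrb : rc < rb) by (destruct Hcb as [| <-]; [assumption | contradiction]).
    (* Enlarging [m0] by [p] makes one step of the excess smaller than the gap at time [m]. *)
    destruct (INR_archimed eps (D + Rabs rc) Heps) as [p Hp].
    set (m := (m0 + p)%nat).
    assert (Hmp : D + Rabs rc < INR m * eps).
    { assert (INR p <= INR m) by (apply le_INR; unfold m; lia). nra. }
    assert (Hgap' : forall n z, (m <= n)%nat -> full_orbit_in f g P Q (piA z) ->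
      INR n * eps <= Rabs (excess ft rc n z)).
    { intros n z Hn Kz. assert (Hpos : 0 < INR n) by (apply lt_0_INR; unfold m in Hn; lia).
      specialize (Hgap ((p1 (Nat.iter n ft z) - p1 z) / INR n)).
      replace (excess ft rc n z) with (INR n * ((p1 (Nat.iter n ft z) - p1 z) / INR n - rc)).
      2: { unfold excess, p1. field. lra. }
      rewrite Rabs_mult, (Rabs_pos_eq (INR n)) by lra.
      apply Rmult_le_compat_l; [lra |]. apply Hgap.
      exists n, z. split; [unfold m in Hn; lia |]. split; [unfold m in Hn; lia |].
      split; [apply HTh; exact Kz | auto]. }
    assert (Hone : (1 <= m)%nat) by (unfold m; lia).
    assert (Hsign : forall n z, (m <= n)%nat -> full_orbit_in f g P Q (piA z) ->
      (excess ft rc n z < 0 <-> excess ft rc m z < 0)).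
    { apply (excess_sign F Ft g P Pb Q Qb H D rc eps m); auto. }
    assert (Hex : forall n z, (1 <= n)%nat ->
      excess ft rc n z = INR n * ((p1 (Nat.iter n ft z) - p1 z) / INR n - rc)).
    { intros n z Hn. unfold excess, p1. field. apply not_0_INR. lia. }
    (* The tolerances [rc - ra] and [rb - rc] give rotation numbers strictly on each side of [rc],
       at times at least [m]; [Hsign] brings the signs of the excess back to time [m]. *)
    destruct (Ja m Hone (rc - ra) ltac:(lra)) as [ra' [[n [z [Hn1 [Hn [Kz [_ Era]]]]]] Hclose]].
    destruct (Jb m Hone (rb - rc) ltac:(lra)) as [rb' [[n' [w [Hn1' [Hn' [Kw [_ Erb]]]]]] Hclose']].
    apply Rabs_def2 in Hclose, Hclose'.
    apply HTh in Kz. apply HTh in Kw.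
    assert (Sz : excess ft rc m z < 0).
    { apply (Hsign n z Hn Kz). rewrite Hex, <- Era by exact Hn1.
      assert (0 < INR n) by (apply lt_0_INR; lia). nra. }
    assert (Sw : ~ excess ft rc m w < 0).
    { rewrite <- (Hsign n' w Hn' Kw), Hex, <- Erb by exact Hn1'.
      assert (0 < INR n') by (apply lt_0_INR; lia). nra. }
    pose proof (Hgap' m w (le_n m) Kw) as Gw.
    assert (0 < INR m * eps).
    { apply Rmult_lt_0_compat; auto. apply lt_0_INR. lia. }
    rewrite Rabs_pos_eq in Gw by lra.
    apply (gap_one_sided F Ft g P Pb Q Qb H D rc eps m HF HL Hab HDK Heps Hone Hmp Hgap' z w); auto.
    fold ft. lra.
Qed.
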